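(* Consider the system of equations $$m\int_0^\alpha s^{-m-1}[h(s)-rK_1]\,ds-rK\zeta^{-m}=0,\qquad n\int_\alpha^\infty s^{-n-1}[h(s)-rK_1]\,ds+rK\zeta^{-n}=0\qquad(\ast)$$ for $(\zeta,\alpha)$, and let $$\Delta_1=\frac{rK\zeta^{-m}}{\sigma^2m(n-m)},\quad\Delta_2=-\frac{rK\zeta^{-n}}{\sigma^2n(n-m)},\quad w_1(x)=R_h(x)\ (x>0),\quad w_0(x)=\begin{cases}-K,&x\le\zeta,\\ \Delta_1x^m+\Delta_2x^n,&\zeta<x<\alpha,\\ R_h(x)-K_1,&x\ge\alpha.\end{cases}$$ The system $(\ast)$ has a unique solution $(\zeta,\alpha)$ such that $0<\zeta<\alpha$ and the functions $w_1,w_0$, with $\Delta_1>0$, $\Delta_2>0$ given by the formulas above, are increasing and satisfy the HJB equation (stated in the context) if and only if $$K<0\quad\text{and}\quad-rK\le h(0)<rK_1-rK.$$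
   Context: Let $b\in\mathbb R$, $\sigma\ne0$, $r>0$ be constants, $W$ a standard one-dimensional Brownian motion and, for $x>0$, let $X$ solve $dX_t=bX_t\,dt+\sqrt2\,\sigma X_t\,dW_t$, $X_0=x$. Standing assumption: $h:(0,\infty)\to\mathbb R$ is right-continuous and increasing (''increasing'' does not mean strictly increasing), $\lim_{x\to\infty}h(x)=\infty$, $\mathbb E[\int_0^\infty e^{-rt}|h(X_t)|\,dt]<\infty$ for every $x>0$; $K_1,K_0>0$, $K\in\mathbb R$. Put $h(0):=\lim_{x\downarrow0}h(x)$. The constants $m<0<n$ are $m,n=\frac1{2\sigma^2}\big[\sigma^2-b\mp\sqrt{(b-\sigma^2)^2+4\sigma^2r}\big]$, and $$R_h(x)=\frac1{\sigma^2(n-m)}\Big[x^m\int_0^xs^{-m-1}h(s)\,ds+x^n\int_x^\infty s^{-n-1}h(s)\,ds\Big]=\mathbb E\Big[\int_0^\infty e^{-rs}h(X_s)\,ds\Big].$$ HJB equation: the coupled quasi-variational inequalities $$\max\{\sigma^2x^2w_1''(x)+bxw_1'(x)-rw_1(x)+h(x),\ w_0(x)-w_1(x)-K_0,\ -w_1(x)-K\}=0,$$ $$\max\{\sigma^2x^2w_0''(x)+bxw_0'(x)-rw_0(x),\ w_1(x)-w_0(x)-K_1,\ -w_0(x)-K\}=0$$ on $(0,\infty)$; the solutions $w_1,w_0$ are $C^1$ as well as $C^2$ outside a finite set, and satisfy these equations in the classical sense.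
   Formalization: ''C^2 outside a finite set'' is read as outside a finite set together with the jumps of h, the HJB equations being required off that set; if h has infinitely many jumps, w_1=R_h has no second derivative at any of them, so the literal claim fails. *)

(* Defs.v *)
From HB Require Import structures.
From mathcomp Require Export all_boot all_order all_algebra.
From mathcomp Require Export all_classical all_reals all_analysis.
Import Order.TTheory GRing.Theory Num.Theory.
Import numFieldNormedType.Exports.

Set Implicit Arguments.
Unset Strict Implicit.
Unset Printing Implicit Defensive.

Local Open Scope classical_set_scope.
Local Open Scope ring_scope.

Section Process.
Context {d : measure_display} {T : measurableType d} {R : realType}.
Variable P : probability T R.

(* Processes are indexed by R, but only their values at times t >= 0 matter. *)
Definition continuous_paths (X : R -> {RV P >-> R}) :=
  forall w, {within `[0, +oo[, continuous (fun t => X t w)}.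

(* The second argument of [normal_prob] is the standard deviation; at 0 it
   does not give a Dirac mass, whence the strict inequality s < t. *)
Definition brownian_motion (W : R -> {RV P >-> R}) :=
  [/\ {ae P, forall w, W 0 w = 0},
      continuous_paths W,
      forall s t : R, 0 <= s -> s < t -> forall A : set R, measurable A ->
        P [set w | A (W t w - W s w)] = normal_prob 0 (Num.sqrt (t - s)) A
    & forall (k : nat) (t : nat -> R) (A : nat -> set R),
        0 <= t 0%N -> {homo t : i j / (i <= j)%N >-> i <= j} ->
        (forall i, measurable (A i)) ->
        P [set w | forall i, (i < k)%N -> A i (W (t i.+1) w - W (t i) w)] =
        (\prod_(i < k) P [set w | A i (W (t i.+1) w - W (t i) w)%R])%E].

(* Natural filtration: the sigma-algebra generated by the W s, 0 <= s <= t. *)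
Definition natural_filtration (W : R -> {RV P >-> R}) (t : R) : set (set T) :=
  <<s [set B | exists (s : R) (A : set R),
         [/\ 0 <= s <= t, measurable A & B = W s @^-1` A]] >>.

Definition adapted_to (W X : R -> {RV P >-> R}) :=
  forall t : R, 0 <= t -> forall A : set R, measurable A ->
    natural_filtration W t (X t @^-1` A).

Definition cvg_in_probability (S : nat -> T -> R) (I : T -> R) :=
  forall e : R, 0 < e -> P [set w | e <= `|S N w - I w|] @[N --> \oo] --> 0%E.

(* For a continuous adapted integrand X, the Ito integral of X against W over
   [0, t] is the limit in probability of the left-endpoint Riemann sums. *)
Definition is_ito_integral (W X : R -> {RV P >-> R}) (t : R) (I : T -> R) :=
  cvg_in_probability
    (fun N w => \sum_(i < N) X (i%:R * t / N%:R) w *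
                  (W (i.+1%:R * t / N%:R) w - W (i%:R * t / N%:R) w)) I.

(* dX = b X dt + sqrt 2 sigma X dW with X_0 = x, in integral form. *)
Definition gbm_solution (W : R -> {RV P >-> R}) (b sigma x : R)
    (X : R -> {RV P >-> R}) :=
  [/\ continuous_paths X,
      adapted_to W X,
      {ae P, forall w, X 0 w = x}
    & forall t : R, 0 <= t -> exists I : {RV P >-> R},
        is_ito_integral W X t I /\
        {ae P, forall w, X t w =
           x + \int[lebesgue_measure]_(s in `[0, t]) (b * X s w)
             + Num.sqrt 2 * sigma * I w}].

End Process.

Definition increasing_on_pos {R : realType} (f : R -> R) :=
  forall x y : R, 0 < x -> x <= y -> f x <= f y.

(* h(0) := lim_{x -> 0+} h(x); it may be -oo. *)
Definition value_at_zero {R : realType} (h : R -> R) : \bar R :=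
  lim ((h x)%:E @[x --> 0^'+]).

Section Candidate.
Context {R : realType}.
Variables (b sigma r : R) (h : R -> R).

Definition root_m : R :=
  (sigma ^+ 2 - b - Num.sqrt ((b - sigma ^+ 2) ^+ 2 + 4 * sigma ^+ 2 * r)) /
  (2 * sigma ^+ 2).

Definition root_n : R :=
  (sigma ^+ 2 - b + Num.sqrt ((b - sigma ^+ 2) ^+ 2 + 4 * sigma ^+ 2 * r)) /
  (2 * sigma ^+ 2).

Local Notation m := root_m.
Local Notation n := root_n.

Definition R_h (x : R) : R :=
  (sigma ^+ 2 * (n - m))^-1 *
  (x `^ m * \int[lebesgue_measure]_(s in `]0, x[) (s `^ (- m - 1) * h s) +
   x `^ n * \int[lebesgue_measure]_(s in `]x, +oo[) (s `^ (- n - 1) * h s)).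

Definition free_boundary_system (K1 K zeta alpha : R) :=
  m * \int[lebesgue_measure]_(s in `]0, alpha[)
        (s `^ (- m - 1) * (h s - r * K1)) - r * K * zeta `^ (- m) = 0 /\
  n * \int[lebesgue_measure]_(s in `]alpha, +oo[)
        (s `^ (- n - 1) * (h s - r * K1)) + r * K * zeta `^ (- n) = 0.

Definition Delta1 (K zeta : R) : R :=
  r * K * zeta `^ (- m) / (sigma ^+ 2 * m * (n - m)).

Definition Delta2 (K zeta : R) : R :=
  - (r * K * zeta `^ (- n) / (sigma ^+ 2 * n * (n - m))).

Definition cand1 : R -> R := R_h.

Definition cand0 (K1 K zeta alpha x : R) : R :=
  if x <= zeta then - K
  else if x < alpha then Delta1 K zeta * x `^ m + Delta2 K zeta * x `^ n
  else R_h x - K1.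

Definition C1_on_pos (w : R -> R) :=
  forall x : R, 0 < x -> derivable w x 1 /\ {for x, continuous (derive1 w)}.

Definition C2_off (E : set R) (w : R -> R) :=
  (forall x : R, 0 < x -> ~ E x -> derivable (derive1 w) x 1) /\
  {within `]0, +oo[ `\` E, continuous (derive1 (derive1 w))}.

(* The exceptional set consists of finitely many points and the discontinuity
   points of h.  Within (0, +oo) it is itself finite when h has finitely many
   jumps there; when h has infinitely many, the derivative of R_h has a corner
   at each of them, and no finite exceptional set exists. *)
Definition solves_HJB (K1 K0 K : R) (w1 w0 : R -> R) :=
  [/\ C1_on_pos w1, C1_on_pos w0 &
   exists2 F : set R, finite_set F &
   let E := F `|` [set x | ~ {for x, continuous h}] in
   [/\ C2_off E w1, C2_off E w0 &
    forall x : R, 0 < x -> ~ E x ->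
      Num.max (Num.max
        (sigma ^+ 2 * x ^+ 2 * derive1 (derive1 w1) x + b * x * derive1 w1 x
         - r * w1 x + h x)
        (w0 x - w1 x - K0))
        (- w1 x - K) = 0 /\
      Num.max (Num.max
        (sigma ^+ 2 * x ^+ 2 * derive1 (derive1 w0) x + b * x * derive1 w0 x
         - r * w0 x)
        (w1 x - w0 x - K1))
        (- w0 x - K) = 0]].

End Candidate.

(* Main.v *)
From HB Require Import structures.
Require Import Defs.
From mathcomp Require Import ring lra measurable_realfun.
Import Order.TTheory GRing.Theory Num.Theory.
Import numFieldNormedType.Exports.

(** Write p = - m and n for the two exponents, kap = - r K, g = h - r K1.

    Potentials.  Up to the factor 1 / (sigma^2 (n + p)), the function R_h is
    x^-p I(x) + x^n J(x), where I(x) is the integral of s^(p - 1) h(s) over (0, x)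
    and J(x) that of s^(- n - 1) h(s) over (x, +oo).  Freezing I and J at a point
    gives a combination of two powers, which differs from the potential by the
    integral of h against a kernel that vanishes on the diagonal: the error is of
    second order.  So potentials are C1 even at the jumps of h
    ([is_derive_potential]); where h is continuous they are C2 and solve the
    expected equation ([potential_ode]).

    Integrability.  That J converges is known only through the finiteness of the
    expected discounted payoff along every solution of the stochastic equation.
    The explicit geometric Brownian motion is such a solution ([gbm_solves]): the
    left-endpoint sums differ from the announced stochastic integral by the error
    of a Riemann sum and by a sum of orthogonal variables whose total variance
    tends to 0.  Its expected discounted time in [s, 2 s] is at least of order s^-n
    ([occupation_lower_bound]), and Tonelli's theorem turns the hypothesis into
    the convergence of J ([integrable_at_infinity]).

    The system.  Let a(x) = p x^-p I(x) and b(x) = n x^n J(x), for g in place of h;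
    they are means of g over (0, x) and (x, +oo).  Both increase with x, and
    a <= g < b.  The system reads a(alpha) = kap (zeta / alpha)^p and
    b(alpha) = kap (zeta / alpha)^-n.  The right-hand sides vary in opposite
    directions with zeta / alpha, which gives uniqueness
    ([free_boundary_unique]); eliminating this ratio and applying the intermediate
    value theorem gives existence as soon as g starts below kap
    ([free_boundary_exists]).

    Sufficiency ([candidates_solve_HJB]).  On (zeta, alpha) the function w0 is the
    potential of g frozen at alpha; the two equations say that it joins - K with
    derivative 0 at zeta, and at alpha it joins R_h - K1 to first order.  The
    inequality that is not immediate is w1 - K1 <= w0 on (zeta, alpha)
    ([obstacle_middle]).  It compares the integrals of g for two weights whose
    ratio is increasing; since g changes sign only once, the comparison at the
    point of change settles the case where the second integral is nonnegative,
    and otherwise the comparison is transported from zeta, where both means are at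
    most kap.  The other inequalities follow from monotonicity and h >= kap.

    Necessity.  Delta1 > 0 means K < 0.  If h(0) < kap, both means of h are below
    kap near 0, so w1 < - K there, which contradicts the equation at any point
    outside the exceptional set; such points exist in every interval because a
    monotone function has countably many discontinuities ([HJB_low]).  If
    h(0) >= r K1 - r K, then g >= kap, so a(alpha) >= kap, against the first
    equation and zeta < alpha ([free_boundary_value_at_zero]). *)


Set Implicit Arguments.
Unset Strict Implicit.
Unset Printing Implicit Defensive.

Local Open Scope classical_set_scope.
Local Open Scope ring_scope.

(** * Integrability of real functions *)

Section integrable_real.
Context d (T : measurableType d) (R : realType).
Variable mu : {measure set T -> \bar R}.
Variable D : set T.
Hypothesis mD : measurable D.

Lemma integrable_realD (f g : T -> R) :
  mu.-integrable D (EFin \o f) -> mu.-integrable D (EFin \o g) ->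
  mu.-integrable D (EFin \o (fun x => f x + g x)).
Proof.
by move=> i1 i2; rewrite /comp; under eq_fun do rewrite EFinD; apply: integrableD.
Qed.

Lemma integrable_realB (f g : T -> R) :
  mu.-integrable D (EFin \o f) -> mu.-integrable D (EFin \o g) ->
  mu.-integrable D (EFin \o (fun x => f x - g x)).
Proof.
by move=> i1 i2; rewrite /comp; under eq_fun do rewrite EFinB; apply: integrableB.
Qed.

Lemma integrable_realZl (k : R) (f : T -> R) :
  mu.-integrable D (EFin \o f) -> mu.-integrable D (EFin \o (fun x => k * f x)).
Proof.
by move=> i1; rewrite /comp; under eq_fun do rewrite EFinM; apply: integrableZl.
Qed.

Lemma integrable_real_cst (k : R) :
  (mu D < +oo)%E -> mu.-integrable D (EFin \o (fun=> k)).
Proof.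
move=> Dfin; apply/integrableP; split; first exact/measurable_EFinP.
rewrite /= integral_cst//.
by have := ge0_fin_numE (measure_ge0 mu D); rewrite Dfin => /fineK <-; rewrite -EFinM ltry.
Qed.
End integrable_real.

Lemma integrable_setU d (T : measurableType d) (R : realType)
  (mu : {measure set T -> \bar R}) (A B : set T) (f : T -> \bar R) :
  measurable A -> measurable B ->
  mu.-integrable A f -> mu.-integrable B f -> mu.-integrable (A `|` B) f.
Proof.
move=> mA mB /integrableP[mfA fA] fB.
have mBA : measurable (B `\` A) by exact: measurableD.
have BAB : B `\` A `<=` B by exact: subDsetl.
have /integrableP[mfBA fBA] := integrableS mB mBA BAB fB.
have E : A `|` B = A `|` (B `\` A) by rewrite setDE setUIr setUv setIT.
have mf : measurable_fun (A `|` B) f by rewrite E; apply/measurable_funU.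
apply/integrableP; split => //.
rewrite E ge0_integral_setU//; first by rewrite lte_add_pinfty.
- by rewrite -E; exact: measurableT_comp.
- by apply/disj_setPS => x -[Ax [_ /(_ Ax)]].
Qed.

(** * Integrals of products of independent variables *)

Section density.
Local Open Scope ereal_scope.
Context d d' (T : measurableType d) (T' : measurableType d') (R : realType).
Variables (mu : {measure set T -> \bar R}) (nu : {measure set T' -> \bar R}).
Variables (U : T -> R) (V : T -> T').
Hypotheses (mU : measurable_fun setT U) (U0 : forall x, (0 <= U x)%R)
           (mV : measurable_fun setT V).
Hypothesis nuE : forall A, measurable A ->
  nu A = \int[mu]_(x in V @^-1` A) (U x)%:E.

Import HBNNSimple.

Let mEU : measurable_fun setT (EFin \o U).
Proof. exact/measurable_EFinP. Qed.

(** Indicators satisfy the formula by hypothesis, hence simple functions do, and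
    nonnegative measurable functions are monotone limits of simple ones.  With
    [V] the identity this is integration against a density; with [V] a random
    variable it reweights the law of [V] by the other factors of a product. *)
Lemma ge0_integral_density (f : T' -> \bar R) :
  measurable_fun setT f -> (forall x, 0 <= f x) ->
  \int[nu]_x f x = \int[mu]_x (f (V x) * (U x)%:E).
Proof.
move=> mf f0.
pose g := nnsfun_approx measurableT mf.
have gf x : EFin \o g^~ x @ \oo --> f x by exact: cvg_nnsfun_approx.
have ndg x : nondecreasing_seq (g^~ x).
  by move=> m n mn; exact/lefP/nd_nnsfun_approx.
have simple n : \int[nu]_x (g n x)%:E = \int[mu]_x ((g n (V x))%:E * (U x)%:E).
  have gE x : (g n x)%:E =
      \sum_(k \in range (g n)) k%:E * (\1_(g n @^-1` [set k]) x)%:E.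
    by rewrite fsumEFin //= fimfunE.
  under eq_integral do rewrite gE.
  rewrite ge0_integral_fsum//; last 2 first.
  - by move=> r; exact/measurable_EFinP/measurableT_comp.
  - by move=> r /= z _; exact: nnfun_muleindic_ge0.
  under [RHS]eq_integral => x _.
    rewrite gE ge0_mule_fsuml; last first.
      by move=> r; exact: nnfun_muleindic_ge0.
    over.
  rewrite /= ge0_integral_fsum//; last 2 first.
  - move=> r; apply: emeasurable_funM => //.
    by apply/measurable_EFinP/measurable_funM => //; apply: measurableT_comp => //;
       apply: measurable_indic.
  - move=> r x _; apply: mule_ge0; rewrite ?lee_fin//.
    exact: nnfun_muleindic_ge0.
  apply: eq_fsbigr => k; rewrite inE => -[y _ ky].
  have k0 : (0 <= k)%R by rewrite -ky.
  rewrite ge0_integralZl//; last exact/measurable_EFinP.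
  rewrite integral_indic// setIT nuE//.
  under [RHS]eq_integral do rewrite -muleA.
  rewrite [RHS]ge0_integralZl//; last 2 first.
  - apply: emeasurable_funM => //.
    by apply/measurable_EFinP; apply: measurableT_comp => //;
       apply: measurable_indic.
  - by move=> x _; rewrite -EFinM lee_fin mulr_ge0.
  congr (_ * _); rewrite integral_mkcond; apply: eq_integral => x _.
  rewrite patchE indicE.
  have -> : (V x \in g n @^-1` [set k]) = (x \in V @^-1` (g n @^-1` [set k])).
    by apply/idP/idP; rewrite !inE.
  by case: ifPn => _; rewrite ?mul1e ?mul0e.
have lim1 : (fun n => \int[nu]_x (g n x)%:E) @ \oo --> \int[nu]_x f x.
  have -> : \int[nu]_x f x = \int[nu]_x limn (fun n => (g n x)%:E).
    by apply: eq_integral => x _; apply/esym/cvg_lim => //; exact: gf.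
  apply: cvg_monotone_convergence => //.
  - by move=> n; exact/measurable_EFinP.
  - by move=> n x _; rewrite lee_fin.
  - by move=> x _ a b ab; rewrite lee_fin ndg.
have lim2 : (fun n => \int[mu]_x ((g n (V x))%:E * (U x)%:E)) @ \oo -->
            \int[mu]_x (f (V x) * (U x)%:E).
  have -> : \int[mu]_x (f (V x) * (U x)%:E) =
      \int[mu]_x limn (fun n => (g n (V x))%:E * (U x)%:E).
    apply: eq_integral => x _; apply/esym/cvg_lim => //.
    by apply: cvgeMr => //; exact: gf.
  apply: cvg_monotone_convergence => //.
  - move=> n; apply: emeasurable_funM => //.
    by apply/measurable_EFinP; apply: measurableT_comp.
  - by move=> n x _; rewrite -EFinM lee_fin mulr_ge0.
  - by move=> x _ a b ab; rewrite -!EFinM lee_fin ler_wpM2r// ndg.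
rewrite -(cvg_lim _ lim1)// -(cvg_lim _ lim2)//.
by congr (limn _); apply/funext => n; rewrite simple.
Qed.
End density.

Section independent_products.
Local Open Scope ereal_scope.
Context d (T : measurableType d) (R : realType) (P : probability T R).
Variables (N : nat) (D : nat -> {RV P >-> R}).
Hypothesis indepD : forall A : nat -> set R, (forall i, measurable (A i)) ->
  P [set w | forall i, (i < N)%N -> A i (D i w)] =
  \prod_(i < N) P [set w | A i (D i w)].

(** Independence is known on cells only, that is for products of indicators, so
    the factors are generalized one at a time: only those of index below [k] are
    not indicators.  With all other factors fixed, both sides are integrals of
    [f k] against measures on the line that agree on sets. *)
Lemma ge0_integral_indep_prod (k : nat) (f : nat -> R -> R) (e : nat -> R) :
  (forall j, measurable_fun setT (f j)) -> (forall j x, (0 <= f j x)%R) ->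
  (forall j, \int[P]_w (f j (D j w))%:E = (e j)%:E) ->
  (forall j, (k <= j)%N -> exists2 A, measurable A & f j = \1_A) ->
  \int[P]_w (\prod_(j < N) f j (D j w))%:E = (\prod_(j < N) e j)%:E.
Proof.
elim: k f e => [|k IHk] f e mf f0 fe find.
  have /choice[A mA] : forall j, exists A, measurable A /\ f j = \1_A.
    by move=> j; have [A ? ?] := find j isT; exists A.
  have eP j : (e j)%:E = P [set w | A j (D j w)].
    rewrite -fe (mA j).2.
    under eq_integral => w _.
      rewrite (_ : \1_(A j) (D j w) = \1_(D j @^-1` A j) w); first over.
      by rewrite !indicE.
    rewrite integral_indic ?setIT// -[X in measurable X]setTI.
    by apply: measurable_funP => //; exact: (mA j).1.
  rewrite -prodEFin; under [RHS]eq_bigr do rewrite eP.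
  rewrite -indepD; last by move=> i; exact: (mA i).1.
  have mB : measurable [set w | forall i, (i < N)%N -> A i (D i w)].
    have -> : [set w | forall i, (i < N)%N -> A i (D i w)] =
        \bigcap_(i in [set i | (i < N)%N]) (D i @^-1` A i) by [].
    apply: bigcap_measurableType => // i _.
    by rewrite -[X in measurable X]setTI; apply: measurable_funP => //; exact: (mA i).1.
  under eq_integral => w _.
    rewrite (_ : (\prod_(j < N) f j (D j w))%R =
       \1_[set w | forall i, (i < N)%N -> A i (D i w)] w); first over.
    rewrite indicE; case: (asboolP (forall i, (i < N)%N -> A i (D i w))) => h.
      rewrite mem_set//= big1// => i _.
      by rewrite (mA i).2 indicE mem_set//; exact: h.
    rewrite memNset//.
    have [i /not_implyP[iN Ai]] : exists i, ~ ((i < N)%N -> A i (D i w)).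
      exact/existsNP.
    rewrite (bigD1 (Ordinal iN))//= (mA i).2 indicE memNset// mul0r//.
  by rewrite integral_indic// setIT.
have [kN|Nk] := ltnP k N; last first.
  pose f' j := if j == k then \1_setT else f j.
  pose e' j := if j == k then 1%R else e j.
  have fE (w : T) : (\prod_(j < N) f j (D j w) = \prod_(j < N) f' j (D j w))%R.
    by apply: eq_bigr => i _; rewrite /f' ltn_eqF// (leq_trans (ltn_ord i)).
  have -> : (\prod_(j < N) e j = \prod_(j < N) e' j)%R.
    by apply: eq_bigr => i _; rewrite /e' ltn_eqF// (leq_trans (ltn_ord i)).
  under eq_integral do rewrite fE.
  apply: IHk => [j|j x|j|j kj].
  - by rewrite /f'; case: ifP.
  - by rewrite /f'; case: ifP => // _; rewrite indicE.
  - rewrite /f' /e'; case: ifP => // _.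
    under eq_integral do rewrite indicE in_setT.
    by rewrite integral_cst//= probability_setT mule1.
  - rewrite /f'; case: ifPn => [_|jk]; first by exists setT.
    by apply: find; rewrite ltn_neqAle eq_sym jk.
pose K := Ordinal kN.
pose U w := (\prod_(j < N | j != K) f j (D j w))%R.
pose u := (\prod_(j < N | j != K) e j)%R.
have e0 j : (0 <= e j)%R.
  by rewrite -lee_fin -fe integral_ge0// => w _; rewrite lee_fin.
have u0 : (0 <= u)%R by apply: prodr_ge0.
have mU : measurable_fun setT U.
  rewrite /U; under eq_fun do rewrite -big_filter.
  apply: measurable_prod => j _.
  exact: measurableT_comp.
have U0 w : (0 <= U w)%R by apply: prodr_ge0.
pose nu := mscale (NngNum u0) (distribution P (D k)).
have nuE A : measurable A -> nu A = \int[P]_(w in D k @^-1` A) (U w)%:E.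
  move=> mA.
  pose f' j := if j == k then \1_A else f j.
  pose e' j := if j == k then fine (P (D k @^-1` A)) else e j.
  have mDA : measurable (D k @^-1` A).
    by rewrite -[X in measurable X]setTI; apply: measurable_funP.
  have fE w : (\prod_(j < N) f' j (D j w) = \1_(D k @^-1` A) w * U w)%R.
    rewrite (bigD1 K)//= {1}/f' eqxx !indicE; congr (_ * _)%R.
    by apply: eq_bigr => i iK; rewrite /f' ifN.
  transitivity ((\prod_(j < N) e' j)%:E).
    rewrite (bigD1 K)//= {1}/e' eqxx EFinM fineK ?fin_num_measure// muleC.
    rewrite /nu /mscale/=; congr (_%:E * _).
    by apply: eq_bigr => i iK; rewrite /e' ifN.
  rewrite -(IHk f' e').
  - rewrite [RHS]integral_mkcond; apply: eq_integral => w _.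
    rewrite fE patchE indicE; case: ifPn => _; first by rewrite mul1r.
    by rewrite mul0r.
  - by move=> j; rewrite /f'; case: ifP.
  - by move=> j x; rewrite /f'; case: ifP => // _; rewrite indicE.
  - move=> j; rewrite /f' /e'; case: eqP => [->|_]; last exact: fe.
    under eq_integral => w _.
      rewrite (_ : \1_A (D k w) = \1_(D k @^-1` A) w); last by rewrite !indicE.
      over.
    by rewrite integral_indic// setIT fineK// fin_num_measure.
  - move=> j kj; rewrite /f'; case: eqP => [_|/eqP jk]; first by exists A.
    by apply: find; rewrite ltn_neqAle eq_sym jk.
have mfk : measurable_fun setT (EFin \o f k) by exact/measurable_EFinP.
have := ge0_integral_density mU U0 (measurable_funP (D k)) nuE mfk.
rewrite ge0_integral_mscale//=; last by move=> x _; rewrite lee_fin.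
rewrite ge0_integral_pushforward//=; last by move=> x _; rewrite lee_fin.
rewrite preimage_setT fe => H.
rewrite (bigD1 K)//= mulrC EFinM H; last by move=> x; rewrite lee_fin.
by apply: eq_integral => w _; rewrite (bigD1 K)//= EFinM.
Qed.

(** Signed factors are split one at a time into positive and negative parts. *)
Lemma integral_indep_prod (f : nat -> R -> R) (e : nat -> R) :
  (forall j, measurable_fun setT (f j)) ->
  (forall j, P.-integrable setT (fun w => (f j (D j w))%:E)) ->
  (forall j, \int[P]_w (f j (D j w))%:E = (e j)%:E) ->
  P.-integrable setT (fun w => (\prod_(j < N) f j (D j w))%:E) /\
  \int[P]_w (\prod_(j < N) f j (D j w))%:E = (\prod_(j < N) e j)%:E.
Proof.
suff main k : forall (f : nat -> R -> R) (e : nat -> R),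
  (forall j, measurable_fun setT (f j)) ->
  (forall j, P.-integrable setT (fun w => (f j (D j w))%:E)) ->
  (forall j, \int[P]_w (f j (D j w))%:E = (e j)%:E) ->
  (forall j, (k <= j)%N -> forall x, (0 <= f j x)%R) ->
  P.-integrable setT (fun w => (\prod_(j < N) f j (D j w))%:E) /\
  \int[P]_w (\prod_(j < N) f j (D j w))%:E = (\prod_(j < N) e j)%:E.
  move=> mf intf fe.
  pose f' j := if (j < N)%N then f j else \1_setT.
  pose e' j := if (j < N)%N then e j else 1%R.
  have fE w : (\prod_(j < N) f j (D j w) = \prod_(j < N) f' j (D j w))%R.
    by apply: eq_bigr => i _; rewrite /f' ltn_ord.
  have -> : (\prod_(j < N) e j = \prod_(j < N) e' j)%R.
    by apply: eq_bigr => i _; rewrite /e' ltn_ord.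
  under eq_fun do rewrite fE.
  apply: (main N) => [j|j|j|j jN x]; rewrite /f' /e'.
  - by case: ifP.
  - case: ifP => // _; under eq_fun do rewrite indicE in_setT.
    exact: finite_measure_integrable_cst.
  - case: ifP => // _; under eq_integral do rewrite indicE in_setT.
    by rewrite integral_cst//= probability_setT mule1.
  - by rewrite ltnNge jN/= indicE.
elim: k => [|k IHk] {}f {}e mf intf fe f0.
  have mprod : measurable_fun setT (fun w => (\prod_(j < N) f j (D j w))%:E).
    apply/measurable_EFinP; apply: measurable_prod => j _.
    exact: measurableT_comp.
  have H : \int[P]_w (\prod_(j < N) f j (D j w))%:E = (\prod_(j < N) e j)%:E.
    pose f' j := if (j < N)%N then f j else \1_setT.
    pose e' j := if (j < N)%N then e j else 1%R.
    have fE w : (\prod_(j < N) f j (D j w) = \prod_(j < N) f' j (D j w))%R.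
      by apply: eq_bigr => i _; rewrite /f' ltn_ord.
    have -> : (\prod_(j < N) e j = \prod_(j < N) e' j)%R.
      by apply: eq_bigr => i _; rewrite /e' ltn_ord.
    under eq_integral do rewrite fE.
    apply: (@ge0_integral_indep_prod N) => [j|j x|j|j jN]; rewrite /f' /e'.
    - by case: ifP.
    - by case: ifP => // _; exact: f0.
    - case: ifP => // _; under eq_integral do rewrite indicE in_setT.
      by rewrite integral_cst//= probability_setT mule1.
    - by rewrite ltnNge jN/=; exists setT.
  split => //; apply/integrableP; split => //.
  rewrite (eq_integral (fun w => (\prod_(j < N) f j (D j w))%:E)) ?H ?ltry//.
  by move=> w _; rewrite gee0_abs// lee_fin prodr_ge0// => i _; exact: f0.
pose fp x := Num.max (f k x) 0%R; pose fn x := Num.max (- f k x)%R 0%R.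
have mfp : measurable_fun setT fp by exact: measurable_maxr.
have mfn : measurable_fun setT fn.
  by apply: measurable_maxr => //; exact: measurable_funN.
have fpn x : (f k x = fp x - fn x)%R.
  by rewrite /fp /fn /Num.max; case: ltP => h1; case: ltP => h2; lra.
have le_fp x : (`|fp x| <= `|f k x|)%R.
  rewrite /fp /Num.max; case: ltP => h; last by [].
  by rewrite normr0.
have le_fn x : (`|fn x| <= `|f k x|)%R.
  rewrite /fn /Num.max; case: ltP => h; first by rewrite normr0.
  by rewrite normrN.
have ifp : P.-integrable setT (fun w => (fp (D k w))%:E).
  apply: (le_integrable measurableT _ _ (intf k)) => [|w _].
    by apply/measurable_EFinP; exact: measurableT_comp.
  by rewrite lee_fin.
have ifn : P.-integrable setT (fun w => (fn (D k w))%:E).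
  apply: (le_integrable measurableT _ _ (intf k)) => [|w _].
    by apply/measurable_EFinP; exact: measurableT_comp.
  by rewrite lee_fin.
pose up g j := if j == k then g else f j.
pose upe a j := if j == k then a else e j.
have IH g a : measurable_fun setT g ->
    P.-integrable setT (fun w => (g (D k w))%:E) ->
    \int[P]_w (g (D k w))%:E = a%:E -> (forall x, 0 <= g x)%R ->
    P.-integrable setT (fun w => (\prod_(j < N) up g j (D j w))%:E) /\
    \int[P]_w (\prod_(j < N) up g j (D j w))%:E = (\prod_(j < N) upe a j)%:E.
  move=> mg ig ga g0; apply: IHk => j; rewrite /up /upe.
  - by case: ifP.
  - by case: eqP => [->|].
  - by case: eqP => [->|].
  - move=> kj x; case: eqP => [//|/eqP jk]; apply: f0.
    by rewrite ltn_neqAle eq_sym jk.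
have fp_fin : \int[P]_w (fp (D k w))%:E \is a fin_num.
  exact: integrable_fin_num.
have fn_fin : \int[P]_w (fn (D k w))%:E \is a fin_num.
  exact: integrable_fin_num.
have [ip Ep] := IH fp _ mfp ifp (esym (fineK fp_fin))
  (fun x => ltac:(by rewrite /fp le_max lexx orbT)).
have [in_ En] := IH fn _ mfn ifn (esym (fineK fn_fin))
  (fun x => ltac:(by rewrite /fn le_max lexx orbT)).
have [kN|Nk] := ltnP k N; last first.
  have upE g w : (\prod_(j < N) up g j (D j w) = \prod_(j < N) f j (D j w))%R.
    by apply: eq_bigr => i _; rewrite /up ltn_eqF// (leq_trans (ltn_ord i)).
  have upeE a : (\prod_(j < N) upe a j = \prod_(j < N) e j)%R.
    by apply: eq_bigr => i _; rewrite /upe ltn_eqF// (leq_trans (ltn_ord i)).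
  by move: ip Ep; under eq_fun do rewrite upE; rewrite upeE.
pose K := Ordinal kN.
have upE g w : (\prod_(j < N) up g j (D j w) =
     g (D k w) * \prod_(j < N | j != K) f j (D j w))%R.
  rewrite (bigD1 K)//= {1}/up eqxx; congr (_ * _)%R.
  by apply: eq_bigr => i iK; rewrite /up ifN.
have upeE a : (\prod_(j < N) upe a j = a * \prod_(j < N | j != K) e j)%R.
  rewrite (bigD1 K)//= {1}/upe eqxx; congr (_ * _)%R.
  by apply: eq_bigr => i iK; rewrite /upe ifN.
have fE w : (\prod_(j < N) f j (D j w) =
    \prod_(j < N) up fp j (D j w) - \prod_(j < N) up fn j (D j w))%R.
  by rewrite !upE -mulrBl -fpn (bigD1 K).
have ek : (e k = fine (\int[P]_w (fp (D k w))%:E) -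
    fine (\int[P]_w (fn (D k w))%:E))%R.
  apply/EFin_inj; rewrite EFinB !fineK// -integralB_EFin// -fe.
  by apply: eq_integral => w _; rewrite fpn EFinB.
split.
  under eq_fun do rewrite fE EFinB.
  exact: integrableB.
under eq_integral do rewrite fE EFinB.
rewrite integralB_EFin// Ep En -EFinB !upeE -mulrBl -ek.
by rewrite [in RHS](bigD1 K).
Qed.
End independent_products.

(** * Moments of the centred normal law *)

(** The right-hand side is the square of 2 sinh (y / 2).  This bounds second
    moments by exponential ones. *)
Lemma sqr_le_expRD {R : realType} (y : R) : y ^+ 2 <= expR y + expR (- y) - 2.
Proof.
wlog y0 : y / 0 <= y.
  move=> H; have [/H//|yneg] := leP 0 y.
  by have := H (- y); rewrite sqrrN opprK [_ (- y) + _]addrC; apply; lra.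
have sinh : y <= expR (y / 2) - expR (- (y / 2)).
  have [->|ypos] := eqVneq y 0; first by rewrite mul0r oppr0 subrr.
  have lt0y : 0 < y by rewrite lt_neqAle eq_sym ypos.
  pose f (x : R) := expR (x / 2) - expR (- (x / 2)).
  have df (x : R) : is_derive x (1 : R) f ((expR (x / 2) + expR (- (x / 2))) / 2).
    rewrite /f; apply: is_derive_eq.
    by rewrite /GRing.scale/=; field.
  have [|c _] := MVT lt0y (fun x _ => df x).
    apply: continuous_subspaceT => x.
    by apply: differentiable_continuous; apply/derivable1_diffP; exact: ex_derive.
  rewrite /f mul0r oppr0 subrr !subr0 => ->.
  rewrite addr0 ler_peMl// ler_pdivlMr// mul1r.
  have e0 := expR_gt0 (c / 2).
  rewrite expRN -subr_ge0.
  have -> : expR (c / 2) + (expR (c / 2))^-1 - 2 =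
    (expR (c / 2) - 1) ^+ 2 / expR (c / 2) by field; exact: lt0r_neq0.
  by rewrite divr_ge0 ?sqr_ge0 ?ltW.
have -> : expR y + expR (- y) - 2 = (expR (y / 2) - expR (- (y / 2))) ^+ 2.
  have -> : expR y = expR (y / 2) ^+ 2.
    by rewrite -expRM_natl; congr expR; lra.
  rewrite !expRN; have -> : (expR y)^-1 = (expR (y / 2))^-1 ^+ 2.
    by rewrite -!expRN -expRM_natl; congr expR; lra.
  by field; rewrite expR_eq0.
by rewrite ler_sqr// nnegrE (le_trans y0).
Qed.

Section gaussian_moments.
Context d (T : measurableType d) (R : realType) (P : probability T R).
Variables (X : {RV P >-> R}) (s : R).
Hypothesis s0 : 0 < s.
Hypothesis lawX : forall A : set R, measurable A ->
  P [set w | A (X w)] = normal_prob 0 s A.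

Let ge0_integral_law (f : R -> \bar R) :
  measurable_fun setT f -> (forall x, (0 <= f x)%E) ->
  (\int[P]_w f (X w) =
   \int[lebesgue_measure]_y (f y * (normal_pdf 0 s y)%:E))%E.
Proof.
move=> mf f0.
have := @ge0_integral_density _ _ _ _ _ (@lebesgue_measure R) (distribution P X)
  (normal_pdf 0 s) id (measurable_normal_pdf 0 s) (normal_pdf_ge0 0 s)
  (@measurable_id _ _ _).
move=> /(_ lawX f mf f0) <-.
by rewrite ge0_integral_pushforward.
Qed.

(** Completing the square turns the tilted density into the density of mean
    [q * s ^+ 2]. *)
Lemma integral_expR_normal q :
  (\int[P]_w (expR (q * X w))%:E = (expR (q ^+ 2 * s ^+ 2 / 2))%:E)%E.
Proof.
rewrite (ge0_integral_law (f := fun y => (expR (q * y))%:E)); last 2 first.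
- by apply/measurable_EFinP; apply: measurableT_comp.
- by move=> x; rewrite lee_fin expR_ge0.
have E y : ((expR (q * y))%:E * (normal_pdf 0 s y)%:E =
    (expR (q ^+ 2 * s ^+ 2 / 2))%:E * (normal_pdf (q * s ^+ 2) s y)%:E)%E.
  rewrite -!EFinM; congr EFin.
  rewrite !normal_pdfE ?gt_eqF//= [LHS]mulrCA [RHS]mulrCA; congr (_ * _).
  rewrite /normal_fun -!expRD; congr expR.
  by field; rewrite gt_eqF.
under eq_integral do rewrite E.
rewrite ge0_integralZl//.
- by rewrite integral_normal_pdf mule1.
- by apply/measurable_EFinP; exact: measurable_normal_pdf.
- by move=> y _; rewrite lee_fin normal_pdf_ge0.
Qed.

Lemma integrable_expR_normal q :
  P.-integrable setT (fun w => (expR (q * X w))%:E).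
Proof.
apply/integrableP; split.
  apply/measurable_EFinP; apply: measurableT_comp => //.
  exact: measurable_funM.
under eq_integral do rewrite gee0_abs ?lee_fin ?expR_ge0//.
by rewrite integral_expR_normal ltry.
Qed.

Lemma Rintegral_expR_normal q :
  \int[P]_w expR (q * X w) = expR (q ^+ 2 * s ^+ 2 / 2).
Proof. by rewrite /Rintegral integral_expR_normal. Qed.

Lemma integrable_id_expR_normal q :
  P.-integrable setT (fun w => (X w * expR (q * X w))%:E).
Proof.
have ib : P.-integrable setT (fun w =>
    ((expR ((q + 1) * X w))%:E + (expR ((q - 1) * X w))%:E)%E).
  by apply: integrableD => //; exact: integrable_expR_normal.
apply: (le_integrable measurableT _ _ ib) => [|w _].
  apply/measurable_EFinP; apply: measurable_funM => //.
  by apply: measurableT_comp => //; exact: measurable_funM.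
rewrite -EFinD !abse_EFin lee_fin normrM (ger0_norm (expR_ge0 (q * X w))).
rewrite [leRHS]ger0_norm ?addr_ge0 ?expR_ge0//.
have -> : expR ((q + 1) * X w) + expR ((q - 1) * X w) =
    (expR (X w) + expR (- X w)) * expR (q * X w).
  by rewrite [RHS]mulrDl -!expRD; congr (expR _ + expR _); ring.
rewrite ler_wpM2r ?expR_ge0// ler_norml.
have := expR_ge1Dx (X w); have := expR_ge1Dx (- X w).
have := expR_ge0 (X w); have := expR_ge0 (- X w).
by move=> *; apply/andP; split; lra.
Qed.

(** No integration by parts: the convexity bound [1 + y <= expR y] makes 0 a
    minimum of e |-> E[expR ((q + e) X)] - e E[X expR (q X)], whose derivative
    there must vanish. *)
Lemma Rintegral_id_expR_normal q :
  \int[P]_w (X w * expR (q * X w)) = q * s ^+ 2 * expR (q ^+ 2 * s ^+ 2 / 2).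
Proof.
set a := LHS.
pose f (e : R) := expR ((q + e) ^+ 2 * s ^+ 2 / 2) - e * a.
have fmin e : f 0 <= f e.
  have i1 := integrable_expR_normal q.
  have i2 : P.-integrable setT (fun w => (e * (X w * expR (q * X w)))%:E).
    under eq_fun do rewrite EFinM.
    by apply: integrableZl => //; exact: integrable_id_expR_normal.
  rewrite /f mul0r subr0 addr0 lerBrDr.
  rewrite -!Rintegral_expR_normal -RintegralZl//; last first.
    exact: integrable_id_expR_normal.
  rewrite -RintegralD//; apply: le_Rintegral => //.
  - rewrite /comp; under eq_fun do rewrite EFinD.
    by apply: integrableD.
  - exact: integrable_expR_normal.
  - move=> w _; rewrite mulrDl expRD.
    have -> : expR (q * X w) + e * (X w * expR (q * X w)) =
      expR (q * X w) * (1 + e * X w) by ring.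
    by rewrite ler_wpM2l ?expR_ge0// expR_ge1Dx.
have df (e : R) : is_derive e (1 : R) f
    ((q + e) * s ^+ 2 * expR ((q + e) ^+ 2 * s ^+ 2 / 2) - a).
  rewrite /f; apply: is_derive_eq.
  by rewrite /GRing.scale/=; field.
have d0 : is_derive (0 : R) (1 : R) f 0.
  apply: (@derive1_at_min R f (-1) 1 0) => [|t _||t _].
  - by lra.
  - exact: ex_derive.
  - by rewrite in_itv/=; apply/andP; split; lra.
  - exact: fmin.
have := df 0; rewrite addr0 => -[_ D1]; have [_ D2] := d0.
by apply/esym/eqP; rewrite -subr_eq0 -D1 D2.
Qed.

Lemma integrable_sqr_normal : P.-integrable setT (fun w => (X w ^+ 2)%:E).
Proof.
have ib : P.-integrable setT (fun w =>
    ((expR (1 * X w))%:E + (expR (- 1 * X w))%:E)%E).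
  by apply: integrableD => //; exact: integrable_expR_normal.
apply: (le_integrable measurableT _ _ ib) => [|w _].
  by apply/measurable_EFinP; apply: measurable_funX.
rewrite -EFinD !abse_EFin lee_fin ger0_norm ?sqr_ge0//.
rewrite ger0_norm ?addr_ge0 ?expR_ge0// mul1r mulN1r.
by have := sqr_le_expRD (X w); lra.
Qed.

Lemma Rintegral_sqr_normal_le :
  \int[P]_w (X w ^+ 2) <= 2 * (expR (s ^+ 2 / 2) - 1).
Proof.
have i1 := integrable_expR_normal 1.
have i2 := integrable_expR_normal (-1).
have ib : P.-integrable setT (fun w =>
    (expR (1 * X w) + expR (- 1 * X w))%:E).
  by under eq_fun do rewrite EFinD; apply: integrableD.
have ic : P.-integrable setT (fun w => (2%:E : \bar R)).
  exact: finite_measure_integrable_cst.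
have -> : 2 * (expR (s ^+ 2 / 2) - 1) =
    \int[P]_w (expR (1 * X w) + expR (- 1 * X w) - 2).
  rewrite RintegralB// RintegralD// !Rintegral_expR_normal.
  rewrite Rintegral_cst//= probability_setT/=.
  by rewrite sqrrN expr1n !mul1r; ring.
apply: le_Rintegral => //.
- exact: integrable_sqr_normal.
- by rewrite /comp; under eq_fun do rewrite EFinB; apply: integrableB.
- by move=> w _; rewrite mul1r mulN1r; exact: sqr_le_expRD.
Qed.
End gaussian_moments.

(** * The remainder of an Euler scheme *)

Section euler_remainder.
Context d (T : measurableType d) (R : realType) (P : probability T R).
Variables (b c delta : R) (N : nat) (D : nat -> {RV P >-> R}).
Hypothesis delta0 : 0 < delta.
Hypothesis indepD : forall A : nat -> set R, (forall i, measurable (A i)) ->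
  P [set w | forall i, (i < N)%N -> A i (D i w)] =
  (\prod_(i < N) P [set w | A i (D i w)])%E.
Hypothesis lawD : forall j (A : set R), measurable A ->
  P [set w | A (D j w)] = normal_prob 0 (Num.sqrt delta) A.

(** The growth factor of geometric Brownian motion over a step of length [delta]
    on which the Brownian motion moves by [y]. *)
Definition euler_factor (y : R) := expR ((b - c ^+ 2 / 2) * delta + c * y).
(** The growth factor minus its first-order Euler approximation; subtracting
    [expR (b * delta)], and not [1 + b * delta], makes it centred. *)
Definition euler_defect (y : R) := euler_factor y - expR (b * delta) - c * y.
Local Notation g := euler_factor.
Local Notation eta := euler_defect.

(** The factor of index [j] in the [i]-th summand of the remainder: growth up to
    step [i], defect at step [i], nothing afterwards.  Padding with 1 makes all
    summands products over the same range. *)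
Definition euler_term i j (y : R) : R :=
  if (j < i)%N then g y else if j == i then eta y else 1.
Local Notation phi := euler_term.

Definition euler_remainder (w : T) : R :=
  \sum_(i < N) \prod_(j < N) phi i j (D j w).

(** An upper bound for the second moment of the defect; it is o(delta). *)
Definition euler_variance : R :=
  expR ((2 * b + c ^+ 2) * delta) - expR (2 * b * delta)
  + c ^+ 2 * (2 * (expR (delta / 2) - 1))
  - 2 * c ^+ 2 * delta * expR (b * delta).

Let s0 : 0 < Num.sqrt delta. Proof. by rewrite sqrtr_gt0. Qed.
Let s2 : Num.sqrt delta ^+ 2 = delta. Proof. by rewrite sqr_sqrtr// ltW. Qed.

Let integrable_mul (f1 f2 : T -> R) :
  measurable_fun setT f1 -> measurable_fun setT f2 ->
  P.-integrable setT (fun w => (f1 w ^+ 2)%:E) ->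
  P.-integrable setT (fun w => (f2 w ^+ 2)%:E) ->
  P.-integrable setT (fun w => (f1 w * f2 w)%:E).
Proof.
move=> m1 m2 i1 i2.
have ib : P.-integrable setT (fun w => ((f1 w ^+ 2)%:E + (f2 w ^+ 2)%:E)%E).
  exact: integrableD.
apply: (le_integrable measurableT _ _ ib) => [|w _].
  by apply/measurable_EFinP; exact: measurable_funM.
rewrite -EFinD !abse_EFin lee_fin [leRHS]ger0_norm ?addr_ge0 ?sqr_ge0//.
rewrite ler_norml; apply/andP; split.
  by have := sqr_ge0 (f1 w + f2 w); have := sqr_ge0 (f1 w);
     have := sqr_ge0 (f2 w); rewrite sqrrD; lra.
by have := sqr_ge0 (f1 w - f2 w); have := sqr_ge0 (f1 w);
   have := sqr_ge0 (f2 w); rewrite sqrrB; lra.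
Qed.

Let integrable_lin (a1 a2 : R) (f1 f2 : T -> R) :
  P.-integrable setT (fun w => (f1 w)%:E) ->
  P.-integrable setT (fun w => (f2 w)%:E) ->
  P.-integrable setT (fun w => (a1 * f1 w + a2 * f2 w)%:E).
Proof.
move=> i1 i2; under eq_fun do rewrite EFinD !EFinM.
by apply: integrableD => //; apply: integrableZl.
Qed.

Let Rintegral_lin (a1 a2 : R) (f1 f2 : T -> R) :
  P.-integrable setT (fun w => (f1 w)%:E) ->
  P.-integrable setT (fun w => (f2 w)%:E) ->
  \int[P]_w (a1 * f1 w + a2 * f2 w) =
  a1 * (\int[P]_w f1 w) + a2 * (\int[P]_w f2 w).
Proof.
move=> i1 i2; rewrite RintegralD//; last 2 first.
- by rewrite /comp; under eq_fun do rewrite EFinM; apply: integrableZl.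
- by rewrite /comp; under eq_fun do rewrite EFinM; apply: integrableZl.
by rewrite (RintegralZl _ measurableT i1) (RintegralZl _ measurableT i2).
Qed.

Let icst (r : R) : P.-integrable setT (fun w => r%:E).
Proof. exact: finite_measure_integrable_cst. Qed.

Let Rcst (r : R) : \int[P]_w r = r.
Proof. by rewrite Rintegral_cst//= probability_setT/= mulr1. Qed.

Let iX q j : P.-integrable setT (fun w => (expR (q * D j w))%:E).
Proof. exact: (integrable_expR_normal s0 (lawD j)). Qed.
Let iXX q j : P.-integrable setT (fun w => (D j w * expR (q * D j w))%:E).
Proof. exact: (integrable_id_expR_normal s0 (lawD j)). Qed.
Let iX2 j : P.-integrable setT (fun w => (D j w ^+ 2)%:E).
Proof. exact: (integrable_sqr_normal s0 (lawD j)). Qed.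
Let EX q j : \int[P]_w expR (q * D j w) = expR (q ^+ 2 * delta / 2).
Proof. by rewrite (Rintegral_expR_normal s0 (lawD j)) s2. Qed.
Let EXX q j : \int[P]_w (D j w * expR (q * D j w)) =
  q * delta * expR (q ^+ 2 * delta / 2).
Proof. by rewrite (Rintegral_id_expR_normal s0 (lawD j)) s2. Qed.
Let EX2 j : \int[P]_w (D j w ^+ 2) <= 2 * (expR (delta / 2) - 1).
Proof. by have := Rintegral_sqr_normal_le s0 (lawD j); rewrite s2. Qed.

Let gE j w : g (D j w) = expR ((b - c ^+ 2 / 2) * delta) * expR (c * D j w).
Proof. by rewrite /g expRD. Qed.

Let mg : measurable_fun setT g.
Proof.
apply: measurableT_comp => //; apply: measurable_funD => //.
Qed.
Let meta : measurable_fun setT eta.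
Proof. by do 2 apply: measurable_funB => //. Qed.

Let g2E j w : g (D j w) ^+ 2 =
  expR (2 * (b - c ^+ 2 / 2) * delta) * expR ((2 * c) * D j w).
Proof.
by rewrite /g -expRM_natl -expRD; congr expR; ring.
Qed.

Let ig2 j : P.-integrable setT (fun w => (g (D j w) ^+ 2)%:E).
Proof.
under eq_fun do rewrite g2E EFinM.
by apply: integrableZl.
Qed.

Let Eg2 j : \int[P]_w (g (D j w) ^+ 2) = expR ((2 * b + c ^+ 2) * delta).
Proof.
under eq_Rintegral do rewrite g2E.
by rewrite (RintegralZl _ measurableT (iX _ j)) EX -expRD; congr expR; field.
Qed.

Let ig j : P.-integrable setT (fun w => (g (D j w))%:E).
Proof. by under eq_fun do rewrite gE EFinM; apply: integrableZl. Qed.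

Let Eg j : \int[P]_w (g (D j w)) = expR (b * delta).
Proof.
under eq_Rintegral do rewrite gE.
by rewrite (RintegralZl _ measurableT (iX _ j)) EX -expRD; congr expR; field.
Qed.

Let iD j : P.-integrable setT (fun w => (D j w)%:E).
Proof.
have := iXX 0 j; congr (_.-integrable _ _); apply/funext => w.
by rewrite mul0r expR0 mulr1.
Qed.

Let ED j : \int[P]_w (D j w) = 0.
Proof.
have := EXX 0 j; rewrite !mul0r => <-; apply: eq_Rintegral => w _.
by rewrite mul0r expR0 mulr1.
Qed.

Let etaE j w : eta (D j w) =
  1 * (1 * g (D j w) + (- expR (b * delta)) * 1) + (- c) * D j w.
Proof. by rewrite /eta; ring. Qed.

Let ieta j : P.-integrable setT (fun w => (eta (D j w))%:E).
Proof.
by under eq_fun do rewrite etaE; apply: integrable_lin => //; apply: integrable_lin.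
Qed.

Let Eeta j : \int[P]_w (eta (D j w)) = 0.
Proof.
under eq_Rintegral do rewrite etaE.
rewrite Rintegral_lin//; last exact: integrable_lin.
by rewrite Rintegral_lin// Eg Rcst ED; ring.
Qed.

Let eta2E j w : eta (D j w) ^+ 2 =
  1 * (1 * (1 * g (D j w) ^+ 2 + (- 2 * expR (b * delta)) * g (D j w))
  + c ^+ 2 * D j w ^+ 2)
  + 1 * ((- 2 * c * expR ((b - c ^+ 2 / 2) * delta)) * (D j w * expR (c * D j w))
    + 1 * (2 * c * expR (b * delta) * D j w + expR (b * delta) ^+ 2 * 1)).
Proof. by rewrite /eta gE; ring. Qed.

Let ieta2 j : P.-integrable setT (fun w => (eta (D j w) ^+ 2)%:E).
Proof.
under eq_fun do rewrite eta2E.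
by repeat (apply: integrable_lin => //).
Qed.

Let Eeta2 j : \int[P]_w (eta (D j w) ^+ 2) <= euler_variance.
Proof.
under eq_Rintegral do rewrite eta2E.
rewrite Rintegral_lin; [|by repeat (apply: integrable_lin => //)..].
rewrite Rintegral_lin; [|by repeat (apply: integrable_lin => //)..].
rewrite Rintegral_lin; [|by repeat (apply: integrable_lin => //)..].
rewrite Rintegral_lin; [|by repeat (apply: integrable_lin => //)..].
rewrite Rintegral_lin; [|by repeat (apply: integrable_lin => //)..].
rewrite Rcst ED Eg2 Eg EXX.
have -> : - 2 * c * expR ((b - c ^+ 2 / 2) * delta) *
   (c * delta * expR (c ^+ 2 * delta / 2)) = - 2 * c ^+ 2 * delta * expR (b * delta).
  rewrite (_ : expR (b * delta) = expR ((b - c ^+ 2 / 2) * delta) *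
     expR (c ^+ 2 * delta / 2)); first by ring.
  by rewrite -expRD; congr expR; field.
rewrite /euler_variance.
have -> : expR (2 * b * delta) = expR (b * delta) ^+ 2.
  by rewrite -expRM_natl mulrA.
have := EX2 j; move: (\int[P]_w _) => y hy.
have := ler_wpM2l (sqr_ge0 c) hy.
lra.
Qed.

Let mphi i j : measurable_fun setT (phi i j).
Proof.
have -> : phi i j =
    if (j < i)%N then g else if j == i then eta else cst 1.
  by apply/funext => y; rewrite /phi; do 2 case: ifP => //.
by do 2 case: ifP => //.
Qed.

Let iphi2 i j k : P.-integrable setT (fun w => (phi i j (D k w) ^+ 2)%:E).
Proof.
by rewrite /phi; case: (j < i)%N => //; case: (j == i).
Qed.

Let mphiD i j k : measurable_fun setT (fun w => phi i j (D k w)).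
Proof. exact: measurableT_comp. Qed.

Let iprod i k j : P.-integrable setT (fun w => (phi i j (D j w) * phi k j (D j w))%:E).
Proof. exact: integrable_mul. Qed.

Let pair_prod i k :
  P.-integrable setT (fun w => (\prod_(j < N) (phi i j (D j w) * phi k j (D j w)))%:E) /\
  \int[P]_w (\prod_(j < N) (phi i j (D j w) * phi k j (D j w))) =
  \prod_(j < N) \int[P]_w (phi i j (D j w) * phi k j (D j w)).
Proof.
have := @integral_indep_prod _ _ _ P N D indepD
  (fun j y => phi i j y * phi k j y)
  (fun j => \int[P]_w (phi i j (D j w) * phi k j (D j w))).
case=> [j|j|j|H1 H2].
- exact: measurable_funM.
- exact: iprod.
- rewrite fineK//; exact: integrable_fin_num (iprod i k j).
- by split => //; rewrite /Rintegral H2.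
Qed.

Let cross i k : (i < k < N)%N ->
  \int[P]_w (\prod_(j < N) (phi i j (D j w) * phi k j (D j w))) = 0.
Proof.
move=> /andP[ik kN]; rewrite (pair_prod i k).2 (bigD1 (Ordinal kN))//=.
rewrite (@eq_Rintegral _ _ _ _ _ (fun w => eta (D k w))) ?Eeta ?mul0r// => w _.
by rewrite /phi ltnn eqxx ltnNge (ltnW ik)/= gtn_eqF// mul1r.
Qed.

Let diag i : (i < N)%N ->
  \int[P]_w (\prod_(j < N) (phi i j (D j w) * phi i j (D j w))) <=
  expR ((2 * b + c ^+ 2) * delta) ^+ i * euler_variance.
Proof.
move=> iN; rewrite (pair_prod i i).2.
pose e j := \int[P]_w (phi i j (D j w) * phi i j (D j w)).
have e1 j : (j < i)%N -> e j = expR ((2 * b + c ^+ 2) * delta).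
  by move=> ji; rewrite /e -(Eg2 j); apply: eq_Rintegral => w _; rewrite /phi ji.
have e2 j : (i < j)%N -> e j = 1.
  move=> ij; rewrite /e -[RHS](Rcst 1); apply: eq_Rintegral => w _.
  by rewrite /phi ltnNge (ltnW ij)/= gtn_eqF// mulr1.
have e3 : e i <= euler_variance.
  rewrite (le_trans _ (Eeta2 i))//.
  rewrite /e (@eq_Rintegral _ _ _ _ _ (fun w => eta (D i w) ^+ 2))// => w _.
  by rewrite /phi ltnn eqxx.
rewrite -/(e _) (eq_bigr (fun j : 'I_N => e j))// -(big_mkord xpredT e).
rewrite (big_cat_nat (leq0n i) (ltnW iN))/= (big_ltn iN).
have -> : \prod_(0 <= j < i) e j = expR ((2 * b + c ^+ 2) * delta) ^+ i.
  rewrite big_nat (eq_bigr (fun=> expR ((2 * b + c ^+ 2) * delta))).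
    by rewrite -big_nat prodr_const_nat subn0.
  by move=> j /andP[_ ji]; exact: e1.
rewrite [X in e i * X]big_nat big1 ?mulr1; last first.
  by move=> j /andP[ij _]; exact: e2.
by rewrite ler_wpM2l// exprn_ge0// expR_ge0.
Qed.

Lemma measurable_euler_remainder : measurable_fun setT euler_remainder.
Proof.
apply: measurable_sum => i.
by apply: measurable_prod => j _; exact: mphiD.
Qed.

Let sqrE w : euler_remainder w ^+ 2 =
  \sum_(i < N) \sum_(k < N) \prod_(j < N) (phi i j (D j w) * phi k j (D j w)).
Proof.
rewrite expr2 /euler_remainder mulr_suml; apply: eq_bigr => i _.
by rewrite mulr_sumr; apply: eq_bigr => k _; rewrite -big_split.
Qed.

(** The summands are pairwise orthogonal: for i < k the factor of index k in
    their product is a centred variable independent of all the others. *)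
Lemma euler_remainder_sqr_le :
  (\int[P]_w (euler_remainder w ^+ 2)%:E <=
   (\sum_(i < N) expR ((2 * b + c ^+ 2) * delta) ^+ i * euler_variance)%:E)%E.
Proof.
under eq_integral do rewrite sqrE -sumEFin.
have ips i k := (pair_prod i k).1.
have isum i : P.-integrable setT (fun w =>
    (\sum_(k < N) \prod_(j < N) (phi i j (D j w) * phi k j (D j w)))%:E).
  by under eq_fun do rewrite -sumEFin; apply: integrable_sum.
rewrite integral_sum//.
rewrite -sumEFin; apply: lee_sum => i _.
under eq_integral do rewrite -sumEFin.
rewrite integral_sum//.
rewrite (bigD1 i)//= big1 ?adde0.
  rewrite -(@fineK _ (integral _ _ _)); last exact: integrable_fin_num.
  by rewrite lee_fin; exact: diag.
move=> k ki; rewrite -(@fineK _ (integral _ _ _)); last exact: integrable_fin_num.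
have [ik|ki'|/val_inj ik] := ltngtP i k; last by rewrite ik eqxx in ki.
  by congr EFin; apply: cross; rewrite ik ltn_ord.
congr EFin; rewrite -[RHS](@cross k i) ?ki' ?ltn_ord//.
by apply: eq_Rintegral => w _; apply: eq_bigr => j _; rewrite mulrC.
Qed.
End euler_remainder.

(** * Riemann sums *)

Section riemann_sums.
Context {R : realType}.
Implicit Types (f : R -> R) (t : R).

Lemma continuous_unif_itv f (a b : R) : continuous f ->
  forall e, 0 < e -> exists2 dl, 0 < dl &
    forall x y, x \in `[a, b] -> `|x - y| < dl -> `|f x - f y| < e.
Proof.
move=> cf e e0.
have cpt : compact `[a, b]%classic by exact: segment_compact.
pose P (dl x : R) := forall y, `|x - y| < dl -> `|f x - f y| < e.
have key x : `[a, b]%classic x -> \forall x' \near x & dl \near 0^'+, P dl x'.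
  move=> _.
  have /cvgrPdist_lt/(_ (e / 2)) := cf x.
  rewrite divr_gt0// => /(_ isT) [/= rho rho0 H].
  near=> x' dl => /= y xy.
  have h1 : `|f x - f x'| < e / 2.
    apply: H => /=; apply: (@lt_trans _ _ (rho / 2)).
      near: x'; apply: (@nbhsx_ballx _ _ x (rho / 2)); exact: divr_gt0.
    by rewrite ltr_pdivrMr// ltr_pMr// ltr1n.
  have h2 : `|f x - f y| < e / 2.
    apply: H => /=; rewrite (splitr rho).
    rewrite (le_lt_trans (ler_distD x' _ _))// ltrD//.
      near: x'; apply: (@nbhsx_ballx _ _ x (rho / 2)); exact: divr_gt0.
    apply: (lt_trans xy).
    by near: dl; apply: nbhs_right_lt; exact: divr_gt0.
  rewrite (le_lt_trans (ler_distD (f x) _ _))// [X in _ < X]splitr ltrD//.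
  by rewrite distrC.
have [dl /= dl0 H] := (compact_near_coveringP _).1 cpt R _ P _ key.
exists (dl / 2); first exact: divr_gt0.
move=> x y xab xy; apply: (H (dl / 2)) => //=.
- by rewrite sub0r normrN ger0_norm ?divr_ge0 ?ltW// ltr_pdivrMr// ltr_pMr// ltr1n.
- exact: divr_gt0.
Unshelve. all: by end_near. Qed.

(** On each cell of the mesh the function differs from its value at the left
    end by at most its modulus of uniform continuity. *)
Lemma riemann_sum_cvg f t : 0 < t -> continuous f ->
  \sum_(i < N) f (i%:R * t / N%:R) * (t / N%:R) @[N --> \oo] -->
  \int[lebesgue_measure]_(s in `[0, t]) f s.
Proof.
move=> t0 cf.
have intf u : lebesgue_measure.-integrable `[0, u] (EFin \o f).
  apply: continuous_compact_integrable; first exact: segment_compact.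
  exact: continuous_subspaceT.
apply/cvgrPdist_lt => e e0.
have et0 : 0 < e / (2 * t) by rewrite divr_gt0// mulr_gt0.
have [dl dl0 Hdl] := continuous_unif_itv 0 t cf et0.
near=> N.
have N0 : (0 < N)%N by near: N; exact: nbhs_infty_gt.
have NR0 : 0 < N%:R :> R by rewrite ltr0n.
pose h := t / N%:R.
have h0 : 0 < h by rewrite divr_gt0.
have hdl : h < dl.
  rewrite /h ltr_pdivrMr// mulrC -ltr_pdivrMr//.
  by near: N; exact: nbhs_infty_gtr.
pose F u := \int[lebesgue_measure]_(s in `[0, u]) f s.
have main i : (i <= N)%N ->
    `|F (i%:R * h) - \sum_(j < i) f (j%:R * h) * h| <= i%:R * h * (e / (2 * t)).
  elim: i => [_|i IHi iN].
    rewrite big_ord0 /F mul0r set_itv1 Rintegral_set1 subrr normr0.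
    by rewrite mul0r.
  have ih0 : 0 <= i%:R * h by rewrite mulr_ge0// ltW.
  have step : F (i.+1%:R * h) - F (i%:R * h) =
      \int[lebesgue_measure]_(s in `]i%:R * h, i.+1%:R * h]) f s.
    apply: Rintegral_itvB => //; rewrite bnd_simp//.
    by rewrite ler_wpM2r ?ler_nat// ltW.
  have mui : lebesgue_measure `]i%:R * h, i.+1%:R * h]%classic = h%:E.
    rewrite lebesgue_measure_itv/= lte_fin ltr_pM2r// ltr_nat ltnSn.
    by rewrite -EFinB -mulrBl -natrB// subSnn mul1r.
  have ii : lebesgue_measure.-integrable `]i%:R * h, i.+1%:R * h] (EFin \o f).
    apply: integrableS (intf (i.+1%:R * h)) => //.
    by apply: subset_itvr; rewrite bnd_simp.
  have ic r : lebesgue_measure.-integrable `]i%:R * h, i.+1%:R * h]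
      (EFin \o (fun=> r)).
    by apply: integrable_real_cst => //; rewrite [X in (X < _)%E]mui ltry.
  have ifc : lebesgue_measure.-integrable `]i%:R * h, i.+1%:R * h]
      (fun s => (f s - f (i%:R * h))%:E).
    exact: integrable_realB.
  have est : `|\int[lebesgue_measure]_(s in `]i%:R * h, i.+1%:R * h]) f s -
       f (i%:R * h) * h| <= h * (e / (2 * t)).
    have -> : f (i%:R * h) * h =
       \int[lebesgue_measure]_(s in `]i%:R * h, i.+1%:R * h]) f (i%:R * h).
      by rewrite Rintegral_cst//; congr (_ * _); exact: esym (congr1 fine mui).
    rewrite -RintegralB//.
    rewrite (le_trans (le_normr_Rintegral _ _))//.
    rewrite [leRHS]mulrC.
    have -> : e / (2 * t) * h =
       \int[lebesgue_measure]_(s in `]i%:R * h, i.+1%:R * h]) (e / (2 * t)).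
      by rewrite Rintegral_cst//; congr (_ * _); exact: esym (congr1 fine mui).
    apply: le_Rintegral => //.
      apply: (@integrable_norm _ _ _ lebesgue_measure _ (fun s => f s - f (i%:R * h))).
      exact: ifc.
    move=> s; rewrite /= in_itv/= => /andP[s1 s2].
    rewrite distrC ltW//; apply: Hdl.
      rewrite in_itv/= ih0/= /h mulrA ler_pdivrMr// mulrC ler_pM2l//.
      by rewrite ler_nat ltnW.
    rewrite distrC ger0_norm ?subr_ge0 ?ltW//.
    apply: (le_lt_trans _ hdl).
    by rewrite lerBlDl (le_trans s2)// -addn1 natrD mulrDl mul1r.
  rewrite big_ord_recr/=.
  have -> : F (i.+1%:R * h) - (\sum_(j < i) f (j%:R * h) * h + f (i%:R * h) * h) =
    (F (i%:R * h) - \sum_(j < i) f (j%:R * h) * h) +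
    (\int[lebesgue_measure]_(s in `]i%:R * h, i.+1%:R * h]) f s - f (i%:R * h) * h).
    by rewrite -step; ring.
  rewrite (le_trans (ler_normD _ _))//.
  rewrite [leRHS](_ : _ = i%:R * h * (e / (2 * t)) + h * (e / (2 * t))).
    by rewrite lerD// IHi// ltnW.
  by rewrite -addn1 natrD; ring.
have := main N (leqnn N).
rewrite /h mulrC divfK ?gt_eqF// -/h.
have -> : t * (e / (2 * t)) = e / 2 by field; rewrite gt_eqF.
move=> H; apply: (le_lt_trans _ (_ : e / 2 < e)); last first.
  by rewrite ltr_pdivrMr// ltr_pMr// ltr1n.
under eq_bigr do rewrite -mulrA.
exact: H.
Unshelve. all: by end_near. Qed.
End riemann_sums.

(** * Convergence in probability *)

Section in_probability.
Context d (T : measurableType d) (R : realType) (P : probability T R).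

Lemma pointwise_cvg_in_probability (r : nat -> T -> R) (e : R) :
  0 < e -> (forall n, measurable_fun setT (r n)) ->
  (forall w, r ^~ w @ \oo --> (0 : R)) ->
  P [set w | e <= `|r n w|] @[n --> \oo] --> 0%E.
Proof.
move=> e0 mr r0.
pose A n := [set w | e <= `|r n w|].
have mA n : measurable (A n).
  have -> : A n = (fun w => `|r n w|) @^-1` `[e, +oo[%classic.
    by apply/seteqP; split => w; rewrite /A /= in_itv/= andbT.
  rewrite -[X in measurable X]setTI.
  by apply: measurableT_comp => //.
have [] := @dominated_convergence _ _ _ P setT measurableT
  (fun n w => (\1_(A n) w)%:E) (cst 0%E) (cst 1%E).
- by move=> n; exact/measurable_EFinP/measurable_indic.
- exact: measurable_cst.
- apply: aeW => w _; apply: cvg_near_cst.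
  have /cvgrPdist_lt/(_ e e0) := r0 w; apply: filter_app; near=> n.
  rewrite sub0r normrN => h; rewrite indicE memNset// /A/=.
  by apply/negP; rewrite -ltNge.
- exact: finite_measure_integrable_cst.
- apply: aeW => w n _; rewrite indicE /=.
  by case: (_ \in _); rewrite ?normr1 ?normr0 lee_fin.
move=> _ _; rewrite integral0; apply: cvg_trans.
apply: near_eq_cvg; apply: nearW => n /=.
by rewrite integral_indic// setIT.
Unshelve. all: by end_near. Qed.

Lemma chebyshev_sqr (r : T -> R) (e V : R) : 0 < e ->
  measurable_fun setT r -> (\int[P]_w (r w ^+ 2)%:E <= V%:E)%E ->
  (P [set w | (e <= `|r w|)%R] <= (V / e ^+ 2)%:E)%E.
Proof.
move=> e0 mr rV.
have e20 : 0 < e ^+ 2 by rewrite exprn_gt0.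
pose A := [set w | e <= `|r w|].
have mA : measurable A.
  have -> : A = (fun w => `|r w|) @^-1` `[e, +oo[%classic.
    by apply/seteqP; split => w; rewrite /A /= in_itv/= andbT.
  rewrite -[X in measurable X]setTI.
  by apply: measurableT_comp => //.
have h : ((e ^+ 2)%:E * P A <= V%:E)%E.
  apply: le_trans rV.
  rewrite -[X in P X]setIT -integral_indic// -ge0_integralZl//; last by rewrite lee_fin ltW.
  apply: ge0_le_integral => //.
  - by move=> w _; rewrite -EFinM lee_fin indicE mulr_ge0 ?sqr_ge0//.
  - apply/measurable_EFinP; apply: measurable_funM => //.
  - by apply/measurable_EFinP; exact: measurable_funX.
  move=> w _; rewrite -EFinM lee_fin indicE.
  have [|_] := boolP (w \in A); last by rewrite mulr0 sqr_ge0.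
  rewrite inE /A/= => er; rewrite mulr1 -[leRHS]real_normK ?num_real//.
    by rewrite lerXn2r ?nnegrE ?(ltW e0).
  exact/measurable_EFinP/measurable_indic.
rewrite mulrC EFinM lee_pdivlMl//.
Qed.

Lemma in_probability_add (r1 r2 s : T -> R) (e : R) :
  measurable_fun setT r1 -> measurable_fun setT r2 -> measurable_fun setT s ->
  {ae P, forall w, s w = r1 w + r2 w} ->
  (P [set w | (e <= `|s w|)%R] <= P [set w | (e / 2 <= `|r1 w|)%R] +
     P [set w | (e / 2 <= `|r2 w|)%R])%E.
Proof.
move=> m1 m2 ms [N [mN PN0 subN]].
have mA (r : T -> R) e' : measurable_fun setT r ->
    measurable [set w | (e' <= `|r w|)%R].
  move=> mr; have -> : [set w | (e' <= `|r w|)%R] =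
      (fun w => `|r w|) @^-1` `[e', +oo[%classic.
    by apply/seteqP; split => w; rewrite /= in_itv/= andbT.
  by rewrite -[X in measurable X]setTI; apply: measurableT_comp.
set A := [set w | (e <= `|s w|)%R]; set B := [set w | (_ <= `|r1 w|)%R].
set C := [set w | (_ <= `|r2 w|)%R].
have mAs : measurable A by exact: mA.
have mB : measurable B by exact: mA.
have mC : measurable C by exact: mA.
have sub : A `<=` N `|` (B `|` C).
  move=> w; rewrite /A/= => es.
  have [Nw|nNw] := pselect (N w); first by left.
  right; have swE : s w = r1 w + r2 w by apply: contrapT => h; exact/nNw/subN.
  have [h|h] := leP (e / 2) `|r1 w|; first by left.
  right; rewrite /C/=; move: es; rewrite swE.
  by have := ler_normD (r1 w) (r2 w); lra.
apply: (@le_trans _ _ (P (N `|` (B `|` C)))).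
  apply: le_measure => //; rewrite ?inE//.
  by apply: measurableU => //; exact: measurableU.
have mBC : measurable (B `|` C) by exact: measurableU.
apply: (le_trans (measureU2 P mN mBC)).
suff H z : z = 0%E -> (z + P (B `|` C) <= P B + P C)%E by exact: H PN0.
by move=> ->; rewrite add0e; exact: (measureU2 P mB mC).
Qed.
End in_probability.

(** * Geometric Brownian motion *)

Lemma euler_term_prod {R : realType} (b c delta : R) (N i : nat) (y : nat -> R) :
  (i < N)%N ->
  \prod_(j < N) euler_term b c delta i j (y j) =
  (\prod_(j < i) euler_factor b c delta (y j)) * euler_defect b c delta (y i).
Proof.
move=> iN; rewrite -(big_mkord xpredT (fun j => euler_term b c delta i j (y j))).
rewrite (big_cat_nat (leq0n i) (ltnW iN))/= (big_ltn iN).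
rewrite [X in _ * (_ * X)]big_nat [X in _ * (_ * X)]big1 ?mulr1; last first.
  move=> j /andP[ij _]; rewrite /euler_term ltnNge (ltnW ij)/=.
  by rewrite gtn_eqF.
rewrite {2}/euler_term ltnn eqxx -(big_mkord xpredT (fun j => euler_factor b c delta (y j))).
congr (_ * _); rewrite big_nat [RHS]big_nat; apply: eq_bigr => j /andP[_ ji].
by rewrite /euler_term ji.
Qed.

Lemma diff_quotient_mesh {R : realType} (v : R -> R) (l t : R) : 0 < t ->
  v 0 = 0 -> is_derive (0 : R) (1 : R) v l ->
  (t / N%:R)^-1 * v (t / N%:R) @[N --> \oo] --> l.
Proof.
move=> t0 v0 dv.
have quo : h^-1 * v h @[h --> 0^'] --> l.
  have [dr dv0] := dv; rewrite -[X in _ --> X]dv0.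
  have := dr; rewrite /derivable /derive => /cvg_ex[k hk].
  rewrite (cvg_lim _ hk)//; apply: cvg_trans hk.
  apply: near_eq_cvg; near=> h.
  by rewrite /= addr0 [_ *: 1]mulr1 v0 subr0.
have inv0 : t / N%:R @[N --> \oo] --> (0 : R).
  rewrite -[X in _ --> X](mulr0 t); apply: cvgM; first exact: cvg_cst.
  apply/gtr0_cvgV0; first by near=> N; rewrite ltr0n; near: N; exact: nbhs_infty_gt.
  exact/cvgryPge/nbhs_infty_ger.
have inv0' : t / N%:R @[N --> \oo] --> (0 : R)^'.
  move=> A; rewrite /dnbhs /within/= => -[/= e e0 H].
  have /cvgrPdist_lt/(_ e e0) := inv0; apply: filter_app; near=> N => h.
  apply: H => //=; rewrite mulf_neq0// ?gt_eqF// invr_gt0 ltr0n.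
  by near: N; exact: nbhs_infty_gt.
exact: (cvg_comp _ _ inv0' quo).
Unshelve. all: by end_near. Qed.

(** The bound vanishes at 0 together with its first derivative. *)
Lemma euler_variance_little {R : realType} (b c t : R) : 0 < t ->
  N%:R * euler_variance b c (t / N%:R) @[N --> \oo] --> (0 : R).
Proof.
move=> t0; pose v := euler_variance b c : R -> R.
have v0 : v 0 = 0 by rewrite /v /euler_variance !mulr0 !mul0r expR0; ring.
have dv : is_derive (0 : R) (1 : R) v 0.
  rewrite /v /euler_variance; apply: is_derive_eq.
  by rewrite /GRing.scale/= !mulr0 !mul0r expR0; field.
have H : t * ((t / N%:R)^-1 * v (t / N%:R)) @[N --> \oo] --> t * 0.
  by apply: cvgM; [exact: cvg_cst|exact: diff_quotient_mesh].
rewrite -[X in _ --> X](mulr0 t).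
apply: cvg_trans H; apply: near_eq_cvg; near=> N => /=.
have N0 : N%:R != 0 :> R.
  by rewrite pnatr_eq0 -lt0n; near: N; exact: nbhs_infty_gt.
by rewrite /v; field; rewrite N0 gt_eqF.
Unshelve. all: by end_near. Qed.

Lemma expR_mesh_cvg {R : realType} (b t : R) : 0 < t ->
  (t / N%:R)^-1 * (expR (b * (t / N%:R)) - 1) @[N --> \oo] --> b.
Proof.
move=> t0; apply: (@diff_quotient_mesh _ (fun h => expR (b * h) - 1)) => //.
  by rewrite mulr0 expR0 subrr.
by apply: is_derive_eq; rewrite /GRing.scale/= !mulr0 expR0; ring.
Qed.

(** Freezing a path before time 0 makes it continuous on the whole line. *)
Lemma continuous_max0 {R : realType} (f : R -> R) :
  {within `[0, +oo[, continuous f} -> continuous (fun s : R => f (Num.max 0 s)).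
Proof.
move=> /subspace_continuousP cf s; apply/cvgrPdist_lt => e e0.
have m0 (u : R) : 0 <= Num.max 0 u by rewrite le_max lexx.
have /= := cf (Num.max 0 s); rewrite in_itv/= m0 => /(_ isT).
move=> /cvgrPdist_lt/(_ e e0) [/= dl dl0 H].
exists dl => //= u su; apply: H; rewrite /= ?in_itv/= ?m0//.
apply: le_lt_trans su.
by rewrite /Num.max; case: ltP => h1; case: ltP => h2;
   rewrite ler_norml; apply/andP; split; have := ler_norm (s - u);
   have := ler_norm (- (s - u)); rewrite normrN; lra.
Qed.

Section geometric_brownian_motion.
Context d (T : measurableType d) (R : realType) (P : probability T R).
Variables (W : R -> {RV P >-> R}) (b sigma x : R).
Hypothesis hW : brownian_motion W.
Hypothesis sigma0 : sigma != 0.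

Let c := Num.sqrt 2 * sigma.
Let mu := b - c ^+ 2 / 2.

Definition gbm_path (t : R) (w : T) : R := x * expR (mu * t + c * W t w).

Lemma measurable_gbm_path t : measurable_fun setT (gbm_path t).
Proof.
apply: (@measurable_funM _ _ _ _ (cst x)) => //.
apply: (measurableT_comp (@measurable_expR R)).
by apply: measurable_funD => //; apply: measurable_funM.
Qed.

HB.instance Definition _ t :=
  isMeasurableFun.Build _ _ _ _ (gbm_path t) (measurable_gbm_path t).

Definition gbm (t : R) : {RV P >-> R} := gbm_path t.

Let c0 : c != 0.
Proof. by rewrite mulf_neq0// gt_eqF// sqrtr_gt0. Qed.

(* the path frozen before time 0, hence continuous on the whole line *)
Let ext w (s : R) := gbm_path (Num.max 0 s) w.

Let max0E (s : R) : 0 <= s -> Num.max 0 s = s.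
Proof. by move=> s0; rewrite max_r. Qed.

Lemma brownian_max0_continuous w : continuous (fun s : R => W (Num.max 0 s) w).
Proof. by have [_ cW _ _] := hW; apply: (continuous_max0 (cW w)). Qed.

Let ext_continuous w : continuous (ext w).
Proof.
move=> s; apply: cvgM; first exact: cvg_cst.
apply: (cvg_comp _ expR); last exact: continuous_expR.
apply: cvgD; apply: cvgM; [exact: cvg_cst| |exact: cvg_cst|].
  by apply: (@continuous_max0 R id); apply: continuous_subspaceT => u; exact: cvg_id.
exact: brownian_max0_continuous.
Qed.

Lemma gbm_continuous : continuous_paths gbm.
Proof.
move=> w; apply/subspace_continuousP => s; rewrite /= in_itv/= andbT => s0.
have h : ext w u @[u --> s] --> ext w s by exact: ext_continuous.
rewrite /from_subspace/=; have -> : gbm_path s w = ext w s by rewrite /ext max0E.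
apply: (@cvg_trans _ (ext w u @[u --> within `[0, +oo[%classic (nbhs s)])).
  apply: near_eq_cvg; rewrite near_withinE; apply: nearW => u.
  by rewrite /= in_itv/= andbT => u0; rewrite /ext max0E.
by apply: cvg_trans h; apply: cvg_app; exact: cvg_within.
Qed.

Lemma gbm_adapted : adapted_to W gbm.
Proof.
move=> t t0 A mA; apply: sub_gen_smallest; exists t.
pose g : R -> R := fun y : R => x * expR (mu * t + c * y).
have mg : measurable_fun setT g.
  apply: (@measurable_funM _ _ _ _ (cst x)) => //.
  apply: (measurableT_comp (@measurable_expR R)).
  by apply: measurable_funD => //; apply: measurable_funM.
exists (g @^-1` A); split => //.
- by rewrite t0 lexx.
- by rewrite -[X in measurable X]setTI; exact: mg.
Qed.

Lemma gbm_start : {ae P, forall w, gbm 0 w = x}.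
Proof.
have [W0 _ _ _] := hW; move: W0; apply: filterS => w W0.
by rewrite /gbm/= /gbm_path W0 !mulr0 addr0 expR0 mulr1.
Qed.

(* the mesh-N Riemann sums and grid increments on [0, t] *)
Variable t : R.
Hypothesis t0 : 0 < t.
Let grid N (i : nat) : R := i%:R * t / N%:R.
Let incr N (i : nat) : {RV P >-> R} := (W (grid N i.+1) \- W (grid N i))%R.

Let grid_ge0 N i : 0 <= grid N i.
Proof. by rewrite /grid divr_ge0// mulr_ge0// ltW. Qed.

Let gridS N i : grid N i.+1 - grid N i = t / N%:R.
Proof. by rewrite /grid -mulrBl -mulrBl -natrB// subSnn mul1r. Qed.

Let incr_indep N (A : nat -> set R) : (forall i, measurable (A i)) ->
  P [set w | forall i, (i < N)%N -> A i (incr N i w)] =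
  (\prod_(i < N) P [set w | A i (incr N i w)])%E.
Proof.
move=> mA; have [_ _ _] := hW; apply=> // i j ij.
by rewrite /grid -!mulrA ler_wpM2r ?ler_nat// divr_ge0// ltW.
Qed.

Let incr_law N j (A : set R) : (0 < N)%N -> measurable A ->
  P [set w | A (incr N j w)] = normal_prob 0 (Num.sqrt (t / N%:R)) A.
Proof.
move=> N0 mA; have [_ _ law _] := hW.
rewrite -(gridS N j); apply: law => //.
by rewrite -subr_gt0 gridS divr_gt0// ltr0n.
Qed.

Let Xg N i w := gbm_path (grid N i) w.
Let delta N : R := t / N%:R.
Let factor N i w := euler_factor b c (delta N) (incr N i w).

Let XgS N i w : Xg N i.+1 w = Xg N i w * factor N i w.
Proof.
rewrite /Xg /gbm_path -mulrA -expRD; congr (_ * expR _).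
by rewrite /mu /incr/= /delta -(gridS N i); ring.
Qed.

Let Xg_prod N i w : W 0 w = 0 -> Xg N i w = x * \prod_(j < i) factor N j w.
Proof.
move=> W0; elim: i => [|i IHi].
  by rewrite big_ord0 /Xg /grid !mul0r /gbm_path W0 !mulr0 addr0 expR0.
by rewrite XgS IHi big_ord_recr/= mulrA.
Qed.

Let rem N w := euler_remainder b c (delta N) N (incr N) w.

(** Telescoping the path over the mesh: the remainder is what separates the
    left-endpoint sums from the stochastic integral. *)
Let rem_identity N w : (0 < N)%N -> W 0 w = 0 ->
  x * rem N w = gbm_path t w - x
    - (expR (b * delta N) - 1) * \sum_(i < N) Xg N i w
    - c * \sum_(i < N) Xg N i w * incr N i w.
Proof.
move=> N0 W0; rewrite /rem /euler_remainder mulr_sumr.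
have -> : gbm_path t w - x = \sum_(i < N) (Xg N i.+1 w - Xg N i w).
  rewrite -(big_mkord xpredT (fun i => Xg N i.+1 w - Xg N i w)).
  rewrite telescope_sumr// (Xg_prod N 0 W0) big_ord0 mulr1.
  by rewrite /Xg /grid mulrAC divff ?mul1r// pnatr_eq0 -lt0n.
rewrite !mulr_sumr -!sumrB; apply: eq_bigr => i _.
rewrite (euler_term_prod _ _ _ (fun j => incr N j w))// mulrA -Xg_prod//.
by rewrite XgS /euler_defect -/(factor N i w); ring.
Qed.

Let IX w := \int[lebesgue_measure]_(s in `[0, t]) gbm_path s w.

Let IX_cvg w : \sum_(i < N) Xg N i w * (t / N%:R) @[N --> \oo] --> IX w.
Proof.
have -> : IX w = \int[lebesgue_measure]_(s in `[0, t]) ext w s.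
  apply: eq_Rintegral => s; rewrite inE/= in_itv/= => /andP[s0 _].
  by rewrite /ext max0E.
have := riemann_sum_cvg t0 (ext_continuous (w := w)).
apply: cvg_trans; apply: near_eq_cvg; apply: nearW => N.
by apply: eq_bigr => i _; rewrite /ext max0E// (grid_ge0 N i).
Qed.

Lemma integrable_gbm_path w :
  lebesgue_measure.-integrable `[0, t] (EFin \o (fun s => gbm_path s w)).
Proof.
have ie : lebesgue_measure.-integrable `[0, t] (EFin \o ext w).
  apply: continuous_compact_integrable; first exact: segment_compact.
  exact: continuous_subspaceT.
apply: eq_integrable ie => // s; rewrite inE/= in_itv/= => /andP[s0' _].
by rewrite /ext max0E.
Qed.

Let mXg N i : measurable_fun setT (Xg N i).
Proof. exact: measurable_gbm_path. Qed.

Let mIX : measurable_fun setT IX.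
Proof.
apply: (measurable_fun_cvg
  (h := fun N w => \sum_(i < N) Xg N i w * (t / N%:R))) => [N|w _].
  by apply: measurable_sum => i; apply: measurable_funM.
exact: IX_cvg.
Qed.

(** The equation leaves no other choice for the stochastic integral. *)
Definition gbm_ito (w : T) : R := (gbm_path t w - x - b * IX w) / c.

Lemma measurable_gbm_ito : measurable_fun setT gbm_ito.
Proof.
apply: (@measurable_funM _ _ _ _ _ (cst c^-1)) => //.
apply: measurable_funB; last by apply: measurable_funM.
apply: measurable_funB => //; exact: measurable_gbm_path.
Qed.

HB.instance Definition _ :=
  isMeasurableFun.Build _ _ _ _ gbm_ito measurable_gbm_ito.

Let S N w := \sum_(i < N) Xg N i w * incr N i w.
Let err1 N w := - (x / c) * rem N w.
Let err2 N w := (b * IX w - (expR (b * delta N) - 1) * \sum_(i < N) Xg N i w) / c.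

Let mrem N : measurable_fun setT (rem N).
Proof. exact: measurable_euler_remainder. Qed.

Let merr1 N : measurable_fun setT (err1 N).
Proof. by apply: measurable_funM. Qed.

Let merr2 N : measurable_fun setT (err2 N).
Proof.
apply: (@measurable_funM _ _ _ _ _ (cst c^-1)) => //.
apply: measurable_funB; first by apply: measurable_funM.
by apply: measurable_funM => //; apply: measurable_sum => i.
Qed.

Let mS N : measurable_fun setT (S N).
Proof. by apply: measurable_sum => i; apply: measurable_funM. Qed.

Let err2_cvg w : err2 ^~ w @ \oo --> (0 : R).
Proof.
have H : (b * IX w - ((t / N%:R)^-1 * (expR (b * (t / N%:R)) - 1)) *
    (\sum_(i < N) Xg N i w * (t / N%:R))) / c @[N --> \oo] -->
    (b * IX w - b * IX w) / c.
  apply: cvgM; last exact: cvg_cst.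
  apply: cvgB; first exact: cvg_cst.
  by apply: cvgM; [exact: expR_mesh_cvg|exact: IX_cvg].
rewrite subrr mul0r in H.
apply: cvg_trans H; apply: near_eq_cvg; near=> N.
have N0 : N%:R != 0 :> R.
  by rewrite pnatr_eq0 -lt0n; near: N; exact: nbhs_infty_gt.
rewrite /err2 /delta -mulr_suml; field.
by rewrite c0 N0 gt_eqF.
Unshelve. all: by end_near. Qed.

Let err1_cvg e : 0 < e -> 0 < x ->
  P [set w | e <= `|err1 N w|] @[N --> \oo] --> 0%E.
Proof.
move=> e0 x0.
have xc0 : 0 < x / `|c| by rewrite divr_gt0// normr_gt0.
pose e' := e / (x / `|c|).
have e'0 : 0 < e' by rewrite divr_gt0.
pose K := expR (`|2 * b + c ^+ 2| * t).
pose V N := K * `|N%:R * euler_variance b c (t / N%:R)| / e' ^+ 2.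
have V0 : (V N)%:E @[N --> \oo] --> 0%E.
  apply: cvg_EFin; first exact: nearW.
  rewrite /V -[X in _ --> X](mul0r (e' ^+ 2)^-1).
  apply: cvgM; last exact: cvg_cst.
  rewrite -[X in _ --> X](mulr0 K); apply: cvgM; first exact: cvg_cst.
  rewrite -[X in _ --> X](@normr0 _ R); apply: cvg_norm.
  exact: euler_variance_little.
apply: (@squeeze_cvge _ _ _ _ (fun=> 0%E) _ (fun N => (V N)%:E)) => //; last exact: cvg_cst.
near=> N; rewrite measure_ge0/=.
have N0 : (0 < N)%N by near: N; exact: nbhs_infty_gt.
have NR0 : 0 < N%:R :> R by rewrite ltr0n.
have dl0 : 0 < delta N by rewrite divr_gt0.
have -> : [set w | e <= `|err1 N w|] = [set w | e' <= `|rem N w|].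
  apply/seteqP; split => w /=; rewrite /err1 normrM normrN normrM normfV (gtr0_norm x0);
    by rewrite /e' ler_pdivrMr// [`|rem N w| * _]mulrC.
apply: (le_trans (chebyshev_sqr (V := K * `|N%:R * euler_variance b c (t / N%:R)|) e'0 (mrem N) _)) => //.
apply: (le_trans (@euler_remainder_sqr_le _ _ _ P b c (delta N) N (incr N) dl0 (@incr_indep N)
   (fun j A mA => @incr_law N j A N0 mA))).
rewrite lee_fin normrM (gtr0_norm NR0) [leRHS]mulrCA -/(delta N).
have -> : N%:R * (K * `|euler_variance b c (delta N)|) =
    \sum_(i < N) K * `|euler_variance b c (delta N)|.
  by rewrite sumr_const card_ord mulr_natl.
apply: ler_sum => i _.
apply: (@le_trans _ _ (expR ((2 * b + c ^+ 2) * delta N) ^+ i * `|euler_variance b c (delta N)|)).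
  by rewrite ler_wpM2l ?exprn_ge0 ?expR_ge0// ler_norm.
rewrite ler_wpM2r// -expRM_natl ler_expR.
rewrite (_ : i%:R * _ = (2 * b + c ^+ 2) * (i%:R * delta N)); last by ring.
have h1 : 0 <= i%:R * delta N by rewrite mulr_ge0// ltW.
have h2 : i%:R * delta N <= t.
  by rewrite /delta mulrA ler_pdivrMr// mulrC ler_pM2l// ler_nat ltnW.
rewrite (le_trans (ler_wpM2r h1 (ler_norm _)))//.
by rewrite ler_wpM2l.
Unshelve. all: by end_near. Qed.

Lemma gbm_ito_eq w : gbm_path t w =
  x + \int[lebesgue_measure]_(s in `[0, t]) (b * gbm_path s w)
    + Num.sqrt 2 * sigma * gbm_ito w.
Proof.
rewrite RintegralZl//; last exact: integrable_gbm_path.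
rewrite -/(IX w) -/c /gbm_ito; move: (gbm_path t w) (IX w) => A B.
by move: c0; move: c => k k0; field.
Qed.

(** The error of the left-endpoint sums has two parts.  One is that of a Riemann
    sum and vanishes pointwise; the other is the Euler remainder, a sum of N
    orthogonal variables of variance o(1 / N). *)
Lemma gbm_is_ito_integral : 0 < x -> is_ito_integral W gbm t gbm_ito.
Proof.
move=> x0 e e0.
have e20 : 0 < e / 2 by rewrite divr_gt0.
have H : (P [set w | (e / 2 <= `|err1 N w|)%R] +
   P [set w | (e / 2 <= `|err2 N w|)%R])%E @[N --> \oo] --> (0 + 0)%E.
  apply: cvgeD => //; first exact: err1_cvg.
  exact: pointwise_cvg_in_probability.
rewrite adde0 in H.
apply: (@squeeze_cvge _ _ _ _ (fun=> 0%E) _ _) H => //; last exact: cvg_cst.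
near=> N; rewrite measure_ge0/=.
have N0 : (0 < N)%N by near: N; exact: nbhs_infty_gt.
apply: in_probability_add => //.
  by apply: measurable_funB; [exact: mS|exact: measurable_gbm_ito].
have [W0 _ _ _] := hW; move: W0; apply: filterS => w W0.
have := rem_identity N0 W0; rewrite -/(S N w) => hrem.
rewrite -/(S N w) /err1 /err2 mulNr mulrAC hrem /gbm_ito.
move: (\sum_(i < N) Xg N i w) (expR _) (IX w) (S N w) (gbm_path t w) => A B C D E.
by move: c0; move: c => k k0; field.
Unshelve. all: by end_near. Qed.
End geometric_brownian_motion.

(** The hypothesis on expected payoffs quantifies over all solutions of the
    stochastic equation; this one makes it usable. *)
Lemma gbm_solves d (T : measurableType d) (R : realType) (P : probability T R)
    (W : R -> {RV P >-> R}) (b sigma x : R) :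
  brownian_motion W -> sigma != 0 -> 0 < x ->
  gbm_solution W b sigma x (gbm W b sigma x).
Proof.
move=> hW sigma0 x0; split.
- exact: gbm_continuous.
- exact: gbm_adapted.
- exact: gbm_start.
move=> t; rewrite le_eqVlt => /predU1P[<-|t0].
  exists (cst 0); split.
    move=> e e0; rewrite (_ : (fun N : nat => _) = (fun=> 0%E)); first exact: cvg_cst.
    apply/funext => N; rewrite (_ : [set w | _] = set0) ?measure0//.
    apply/seteqP; split => // w /=; rewrite big1.
      by rewrite subr0 normr0 leNgt e0.
    by move=> i _; rewrite !mulr0 !mul0r subrr mulr0.
  have := gbm_start b sigma x hW; apply: filterS => w ->.
  by rewrite set_itv1 Rintegral_set1 mulr0 !addr0.
exists (gbm_ito W b sigma x t); split.
  exact: gbm_is_ito_integral.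
by apply: aeW => w; exact: gbm_ito_eq.
Unshelve. all: by []. Qed.

(** * Discounted time spent near a high level *)

Section joint_measurability.
Context d (T : measurableType d) (R : realType) (P : probability T R).
Variable W : R -> {RV P >-> R}.
Hypothesis cW : continuous_paths W.

(** A continuous path is the limit of its step functions on the meshes of size
    1 / N, and these are measurable in both variables. *)
Lemma measurable_joint : measurable_fun setT
  (fun z : T * R => if 0 <= z.2 then W z.2 z.1 else 0).
Proof.
pose I N k : set R := `[k%:R / N%:R, k.+1%:R / N%:R[%classic.
pose A N (z : T * R) : R := \sum_(k < N * N) \1_(I N k) z.2 * W (k%:R / N%:R) z.1.
apply: (measurable_fun_cvg (h := A)) => [N|[w t] _ /=].
  apply: measurable_sum => k; apply: measurable_funM.
    have mI : measurable_fun setT (\1_(I N k) : R -> R).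
      by apply: measurable_indic; exact: measurable_itv.
    exact: (measurableT_comp mI measurable_snd).
  exact: (measurableT_comp (measurable_funP (W (k%:R / N%:R))) measurable_fst).
case: ifPn => [t0|]; last first.
  rewrite -ltNge => t0; apply: cvg_near_cst; apply: nearW => N.
  apply: big1 => k _; rewrite indicE memNset ?mul0r// /I/= in_itv/= => /andP[h _].
  suff : 0 <= t by rewrite leNgt t0.
  by apply: le_trans h; rewrite divr_ge0.
have cm : continuous (fun s : R => W (Num.max 0 s) w).
  by apply: (@continuous_max0 R (fun t => W t w)); exact: cW.
apply/cvgrPdist_lt => e e0.
have [/= dl dl0 H] := (cvgrPdist_lt _ _).1 (cm t) e e0.
near=> N.
have N0 : (0 < N)%N by near: N; exact: nbhs_infty_gt.
have NR0 : 0 < N%:R :> R by rewrite ltr0n.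
have tN : t < N%:R by near: N; exact: nbhs_infty_gtr.
have Ndl : N%:R^-1 < dl.
  rewrite invf_plt ?posrE//; near: N; exact: nbhs_infty_gtr.
pose k := Num.trunc (t * N%:R).
have /andP[k1 k2] : k%:R <= t * N%:R < k.+1%:R.
  by apply: truncn_itv; rewrite mulr_ge0.
have kN : (k < N * N)%N.
  rewrite -(ltr_nat R) natrM; apply: (le_lt_trans k1).
  by rewrite ltr_pM2r.
have tI : I N k t.
  by rewrite /I/= in_itv/= ler_pdivrMr// k1/= ltr_pdivlMr.
have -> : A N (w, t) = W (k%:R / N%:R) w.
  rewrite /A (bigD1 (Ordinal kN))//= indicE mem_set// mul1r big1 ?addr0//.
  move=> j jk; rewrite indicE memNset ?mul0r// /I/= in_itv/= => /andP[].
  rewrite ler_pdivrMr// ltr_pdivlMr// => j1 j2.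
  have jE : nat_of_ord j = k by apply/esym/truncn_def; rewrite j1 j2.
  by move: jk; rewrite -val_eqE/= jE eqxx.
have k0 : 0 <= k%:R / N%:R :> R by rewrite divr_ge0.
have := H (k%:R / N%:R); rewrite /= (max_r t0) (max_r k0); apply.
rewrite ger0_norm; last by rewrite subr_ge0 ler_pdivrMr.
apply: le_lt_trans Ndl.
by rewrite lerBlDr -[X in _ <= X + _]div1r -mulrDl ler_pdivlMr// addrC natr1 ltW.
Unshelve. all: by end_near. Qed.
End joint_measurability.

Section green_kernel_bound.
Context {R : realType}.
Variables (mu sigma r q : R).
Hypothesis sigma0 : sigma != 0.
Hypothesis q2 : q ^+ 2 = mu ^+ 2 + 4 * sigma ^+ 2 * r.
Let n := (q - mu) / (2 * sigma ^+ 2).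

(** Since r = (q^2 - mu^2) / (4 sigma^2), the exponent equals
    n v + (q t - v)^2 / (4 sigma^2 t): it is within a constant of n v for times
    t within sqrt t1 of the optimal time t1 = v / q. *)
Lemma gaussian_exponent_le (t t1 v : R) : 1 <= t1 -> t1 <= t ->
  t <= t1 + Num.sqrt t1 -> q * t1 <= v -> v <= q * t1 + 1 -> 0 < n ->
  r * t + (v - mu * t) ^+ 2 / (4 * sigma ^+ 2 * t) <=
  n * (q * t1 + 1) + (q ^+ 2 + 1) / (2 * sigma ^+ 2).
Proof.
move=> t11 t1t tt1 v1 v2 n0.
have s2 : 0 < sigma ^+ 2 by rewrite exprn_even_gt0.
have t10 : 0 < t1 by lra.
have t0 : 0 < t by lra.
have -> : r * t + (v - mu * t) ^+ 2 / (4 * sigma ^+ 2 * t) =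
    n * v + (q * t - v) ^+ 2 / (4 * sigma ^+ 2 * t).
  have -> : r = (q ^+ 2 - mu ^+ 2) / (4 * sigma ^+ 2).
    by rewrite q2; field.
  by rewrite /n; field; rewrite sigma0 gt_eqF.
apply: lerD; first by rewrite ler_wpM2l// ltW.
rewrite ler_pdivrMr; last by apply: mulr_gt0 => //; apply: mulr_gt0.
have -> : (q ^+ 2 + 1) / (2 * sigma ^+ 2) * (4 * sigma ^+ 2 * t) = 2 * (q ^+ 2 + 1) * t.
  by field.
pose u := t - t1; pose th := v - q * t1.
have -> : q * t - v = q * u - th by rewrite /u /th; ring.
have u0 : 0 <= u by rewrite /u; lra.
have u2 : u ^+ 2 <= t1.
  rewrite -[leRHS]sqr_sqrtr; last by lra.
  by rewrite lerXn2r ?nnegrE ?sqrtr_ge0// /u; lra.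
have th0 : 0 <= th by rewrite /th; lra.
have th1 : th ^+ 2 <= 1 by rewrite expr_le1// /th; lra.
have h1 : (q * u) ^+ 2 <= q ^+ 2 * t1 by rewrite exprMn ler_wpM2l ?sqr_ge0.
have h2 : q ^+ 2 * t1 <= q ^+ 2 * t by rewrite ler_wpM2l ?sqr_ge0.
have h3 := sqr_ge0 (q * u + th).
have -> : (q * u - th) ^+ 2 = 2 * (q * u) ^+ 2 + 2 * th ^+ 2 - (q * u + th) ^+ 2 by ring.
lra.
Qed.
End green_kernel_bound.

Lemma normal_prob_itv_ge {R : realType} (s a l L : R) : 0 <= l -> 0 <= L ->
  (forall y, a <= y <= a + l -> L <= normal_pdf 0 s y) ->
  ((L * l)%:E <= normal_prob 0 s `[a, (a + l)%R]%classic)%E.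
Proof.
move=> l0 L0 H.
have -> : (L * l)%:E = (\int[lebesgue_measure]_(y in `[a, (a + l)%R]) (cst L%:E y))%E.
  rewrite integral_cst//= lebesgue_measure_itv/= lte_fin ltrDl.
  have [_|] := ltP 0 l; first by rewrite -EFinB addrC addKr EFinM.
  move=> l0'; have -> : l = 0 by apply/eqP; rewrite eq_le l0 l0'.
  by rewrite mulr0 mule0.
apply: ge0_le_integral => //.
by apply/measurable_EFinP; apply: measurable_funTS; exact: measurable_normal_pdf.
Qed.

Lemma brownian_law d (T : measurableType d) (R : realType) (P : probability T R)
    (W : R -> {RV P >-> R}) (t : R) (A : set R) :
  brownian_motion W -> 0 < t -> measurable A ->
  P [set w | A (W t w)] = normal_prob 0 (Num.sqrt t) A.
Proof.
move=> [W0 _ law _] t0 mA; rewrite -[X in Num.sqrt X]subr0 -law//.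
have mm (f : {RV P >-> R}) : measurable [set w | A (f w)].
  by rewrite -[X in measurable X]setTI; exact: (measurable_funP f).
have m1 : measurable [set w | A (W t w)] by exact: mm.
have m2 : measurable [set w | A (W t w - W 0 w)] by exact: (mm (W t \- W 0)%R).
rewrite -[X in P X = _]setIT -[X in _ = P X]setIT -!integral_indic//.
apply: ge0_ae_eq_integral => //.
- exact/measurable_EFinP/measurable_indic.
- exact/measurable_EFinP/measurable_indic.
apply: filterS W0 => w W0 _; congr EFin; rewrite !indicE.
have -> // : (w \in [set w | A (W t w)]) = (w \in [set w | A (W t w - W 0 w)]).
by apply/idP/idP; rewrite !inE/= W0 subr0.
Qed.

Section occupation_bound.
Context d (T : measurableType d) (R : realType) (P : probability T R).
Variables (W : R -> {RV P >-> R}) (b sigma r : R).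
Hypotheses (hW : brownian_motion W) (sigma0 : sigma != 0) (r0 : 0 < r).

Let q := Num.sqrt ((b - sigma ^+ 2) ^+ 2 + 4 * sigma ^+ 2 * r).
Let n := root_n b sigma r.
Let mu := b - sigma ^+ 2.
Let c := Num.sqrt 2 * sigma.
Let X := gbm_path W b sigma 1.

Let s2 : 0 < sigma ^+ 2. Proof. by rewrite exprn_even_gt0. Qed.
Let c2 : c ^+ 2 = 2 * sigma ^+ 2.
Proof. by rewrite /c exprMn sqr_sqrtr. Qed.
Let c0 : c != 0.
Proof. by rewrite mulf_neq0// gt_eqF// sqrtr_gt0. Qed.
Let sr0 : 0 < 4 * sigma ^+ 2 * r.
Proof. by apply: mulr_gt0 => //; apply: mulr_gt0. Qed.
Let q2 : q ^+ 2 = mu ^+ 2 + 4 * sigma ^+ 2 * r.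
Proof. by rewrite sqr_sqrtr// addr_ge0 ?sqr_ge0// ltW. Qed.
Let q0 : 0 < q.
Proof.
rewrite sqrtr_gt0 (@lt_le_trans _ _ (4 * sigma ^+ 2 * r))//.
by rewrite lerDr sqr_ge0.
Qed.
Let nE : n = (q - mu) / (2 * sigma ^+ 2).
Proof. by rewrite /n /root_n -/q /mu; congr (_ / _); ring. Qed.
Let n0 : 0 < n.
Proof.
rewrite nE; apply: divr_gt0; last by apply: mulr_gt0.
rewrite subr_gt0.
have [mu0|mu0] := leP mu 0; first exact: le_lt_trans q0.
rewrite -(@ltr_pXn2r _ 2)// ?nnegrE ?ltW//.
by rewrite q2 ltrDl.
Qed.

Let XE t w : X t w = expR (mu * t + c * W t w).
Proof.
have muE : b - c ^+ 2 / 2 = mu by rewrite c2 /mu; field.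
by rewrite /X /gbm_path mul1r -muE.
Qed.

(** The discount factor while the path started at 1 lies in [s, 2 s]. *)
Definition visit_weight (s : R) (w : T) (t : R) : R :=
  if [&& 0 < t, s <= X t w & X t w <= 2 * s] then expR (- (r * t)) else 0.

Let l : R := ln 2 / `|c|.
Let l0 : 0 <= l. Proof. by rewrite divr_ge0// ln_ge0// ler1n. Qed.

Let ln2_le1 : ln 2 <= 1 :> R.
Proof.
rewrite -[leRHS]expRK ler_ln ?posrE ?expR_gt0//.
by have := expR_ge1Dx (1 : R); lra.
Qed.

Let K0 : R := expR (- (n + (q ^+ 2 + 1) / (2 * sigma ^+ 2))).

(* the lower end of the set of y with s <= expR (mu * t + c * y) <= 2 * s,
   an interval of length l whatever the sign of c *)
Let low (s t : R) : R := (ln s - mu * t + (if c < 0 then ln 2 else 0)) / c.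

Let low_in (s t y : R) : 0 < s -> low s t <= y <= low s t + l ->
  ln s <= mu * t + c * y <= ln s + ln 2.
Proof.
move=> s0 /andP[y1 y2]; set z := ln s; set k := ln 2.
have k0 : 0 <= k by rewrite ln_ge0// ler1n.
move: y1 y2; rewrite /low /l -/z -/k.
have [cneg|cpos] := ltP c 0.
  rewrite ltr0_norm//.
  have -> : (z - mu * t + k) / c + k / - c = (z - mu * t) / c.
    by rewrite invrN mulrN mulrDl addrK.
  by rewrite ler_ndivrMr// ler_ndivlMr// => y1 y2; apply/andP; split; lra.
have {}cpos : 0 < c by rewrite lt_neqAle eq_sym c0.
rewrite gtr0_norm// addr0 -mulrDl ler_pdivrMr// ler_pdivlMr// => y1 y2.
by apply/andP; split; lra.
Qed.

Let measurable_visit s t : measurable [set w | (s <= X t w <= 2 * s)%R].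
Proof.
have -> : [set w | (s <= X t w <= 2 * s)%R] = X t @^-1` `[s, 2 * s]%classic.
  by apply/seteqP; split => w; rewrite /= in_itv/=.
rewrite -[Y in measurable Y]setTI.
exact: measurable_gbm_path.
Qed.

(** For times in a window of length sqrt t1 after t1 = ln s / q, the Gaussian
    density of the position is at least a constant times s^-n / sqrt t1. *)
Let visit_prob s t : expR q <= s -> ln s / q <= t ->
  t <= ln s / q + Num.sqrt (ln s / q) ->
  ((expR (- (r * t)))%:E * P [set w | (s <= X t w <= 2 * s)%R] >=
   ((Num.sqrt (4 * pi * (ln s / q)))^-1 * K0 * expR (- (n * ln s)) * l)%:E)%E.
Proof.
move=> sq; set t1 := ln s / q => t1t tt1.
have s0 : 0 < s by exact: lt_le_trans (expR_gt0 q) sq.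
have zq : q <= ln s by rewrite -[leLHS]expRK ler_ln ?posrE ?expR_gt0.
have t11 : 1 <= t1 by rewrite ler_pdivlMr// mul1r.
have t0 : 0 < t by lra.
have zE : q * t1 = ln s by rewrite mulrC divfK// gt_eqF.
have pint : (P [set w | (s <= X t w <= 2 * s)%R] >=
    normal_prob 0 (Num.sqrt t) `[low s t, (low s t + l)%R]%classic)%E.
  rewrite -(brownian_law hW t0)//; apply: le_measure; rewrite ?inE//.
    by rewrite -[Y in measurable Y]setTI; apply: measurable_funP.
  move=> w /=; rewrite in_itv/= => /(low_in s0)/andP[h1 h2].
  rewrite !XE -[s in s <= _](lnK s0) ler_expR h1/=.
  have -> : 2 * s = expR (ln s + ln 2) by rewrite expRD !lnK ?posrE// mulrC.
  by rewrite ler_expR.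
apply: le_trans (_ : _ <= (expR (- (r * t)))%:E * _)%E _; last first.
  by apply: lee_wpmul2l pint; rewrite lee_fin expR_ge0.
pose L := (Num.sqrt (4 * pi * t1))^-1 * K0 * expR (- (n * ln s)) * expR (r * t).
have L0 : 0 <= L.
  by rewrite !mulr_ge0 ?invr_ge0 ?sqrtr_ge0 ?expR_ge0.
apply: le_trans (_ : _ <= (expR (- (r * t)))%:E * (L * l)%:E)%E _.
  have e1 : expR (- (r * t)) * expR (r * t) = 1 by rewrite -expRD addNr expR0.
  rewrite -EFinM lee_fin /L; move: (_^-1 * K0 * _) => A.
  have -> // : expR (- (r * t)) * (A * expR (r * t) * l) =
    (expR (- (r * t)) * expR (r * t)) * (A * l) by ring.
  by rewrite e1 mul1r.
apply: lee_wpmul2l; first by rewrite lee_fin expR_ge0.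
apply: normal_prob_itv_ge => // y /(low_in s0) /andP[v1 v2].
have st0 : Num.sqrt t != 0 by rewrite gt_eqF// sqrtr_gt0.
rewrite normal_pdfE//= /L -mulrA -mulrA; apply: ler_pM.
- by rewrite invr_ge0 sqrtr_ge0.
- by rewrite !mulr_ge0 ?expR_ge0.
- have pi0 := pi_gt0 R.
  have p1 : 0 < 4 * pi * t1 by apply: mulr_gt0; [exact: mulr_gt0|lra].
  have p2 : 0 < Num.sqrt t ^+ 2 * pi *+ 2.
    by rewrite sqr_sqrtr ?ltW// pmulrn_lgt0// mulr_gt0.
  rewrite /normal_peak lef_pV2 ?posrE ?sqrtr_gt0// ler_sqrt ?(ltW p1)//.
  rewrite sqr_sqrtr ?(ltW t0)// -mulr_natr.
  have st1 : Num.sqrt t1 <= t1.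
    rewrite -[leRHS]sqr_sqrtr; last by lra.
    by rewrite ler_eXnr//; rewrite -sqrtr1 ler_sqrt//; lra.
  have : t * pi <= (2 * t1) * pi by rewrite ler_pM2r//; lra.
  lra.
rewrite /K0 /normal_fun -!expRD ler_expR subr0 (sqr_sqrtr (ltW t0)).
have v2' : mu * t + c * y <= q * t1 + 1 by rewrite zE; have := ln2_le1; move: v2; lra.
have v1' : q * t1 <= mu * t + c * y by rewrite zE.
have n0' : 0 < (q - mu) / (2 * sigma ^+ 2) by rewrite -nE.
have := gaussian_exponent_le sigma0 q2 t11 t1t tt1 v1' v2' n0'.
rewrite -nE zE.
have -> : (mu * t + c * y - mu * t) ^+ 2 / (4 * sigma ^+ 2 * t) = y ^+ 2 / (t *+ 2).
  rewrite addrC addrA addNr add0r exprMn c2 -mulr_natr; field.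
  by rewrite sigma0 gt_eqF.
rewrite mulNr; lra.
Qed.

Let Y (z : T * R) : R := if 0 <= z.2 then W z.2 z.1 else 0.

Let mY : measurable_fun setT Y.
Proof. by apply: measurable_joint; have [_ ] := hW. Qed.

Lemma measurable_visit_weight :
  measurable_fun setT (fun z : (T * R) * R => visit_weight z.2 z.1.1 z.1.2).
Proof.
pose XX (z : (T * R) * R) := expR (mu * z.1.2 + c * Y z.1).
have mt : measurable_fun setT (fun z : (T * R) * R => z.1.2).
  exact: (measurableT_comp measurable_snd measurable_fst).
have ms : measurable_fun setT (fun z : (T * R) * R => z.2).
  exact: measurable_snd.
have mXX : measurable_fun setT XX.
  apply: (measurableT_comp (@measurable_expR R)).
  apply: measurable_funD; apply: measurable_funM => //.
  exact: (measurableT_comp mY measurable_fst).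
have -> : (fun z : (T * R) * R => visit_weight z.2 z.1.1 z.1.2) =
    (fun z => if (0 < z.1.2) && ((z.2 <= XX z) && (XX z <= 2 * z.2))
              then expR (- (r * z.1.2)) else 0).
  apply/funext => z; rewrite /visit_weight; case: ltP => //= t0.
  by have -> : XX z = X z.1.2 z.1.1 by rewrite XE /XX /Y (ltW t0).
apply: measurable_fun_ifT => //; last first.
  apply: (measurableT_comp (@measurable_expR R)).
  by apply: measurable_funN; apply: measurable_funM.
apply: measurable_and; first exact: measurable_fun_ltr.
apply: measurable_and; first exact: measurable_fun_ler.
by apply: measurable_fun_ler => //; apply: measurable_funM.
Qed.

Let occupation_const : R := (Num.sqrt (4 * pi))^-1 * K0 * l.

(** The window of length sqrt t1 compensates the factor 1 / sqrt t1 of the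
    Gaussian density. *)
Lemma occupation_ge s : expR q <= s ->
  ((occupation_const * s `^ (- n))%:E <=
   \int[lebesgue_measure]_t \int[P]_w (visit_weight s w t)%:E)%E.
Proof.
move=> sq; set t1 := ln s / q.
have s0 : 0 < s by exact: lt_le_trans (expR_gt0 q) sq.
have zq : q <= ln s by rewrite -[leLHS]expRK ler_ln ?posrE ?expR_gt0.
have t11 : 1 <= t1 by rewrite ler_pdivlMr// mul1r.
have t10 : 0 < t1 by lra.
have st1 : 0 < Num.sqrt t1 by rewrite sqrtr_gt0.
pose D : set R := `[t1, t1 + Num.sqrt t1]%classic.
have mD : measurable D by exact: measurable_itv.
have muD : lebesgue_measure D = (Num.sqrt t1)%:E.
  by rewrite /D lebesgue_measure_itv/= lte_fin ltrDl st1 -EFinB addrC addKr.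
have mV : measurable_fun setT (fun z : T * R => (visit_weight s z.1 z.2)%:E).
  apply/measurable_EFinP.
  have mi : measurable_fun setT (fun z : T * R => (z, s)).
    exact: measurable_fun_pair.
  exact: (measurableT_comp measurable_visit_weight mi).
have V0 (z : T * R) : (0 <= (visit_weight s z.1 z.2)%:E)%E.
  by rewrite lee_fin /visit_weight; case: ifP => // _; rewrite expR_ge0.
have mH : measurable_fun setT
    (fun t => \int[P]_w (visit_weight s w t)%:E)%E.
  exact: (@measurable_fun_fubini_tonelli_G _ _ _ _ _ P _ mV V0).
pose kap := (Num.sqrt (4 * pi * t1))^-1 * K0 * expR (- (n * ln s)) * l.
have kap0 : 0 <= kap.
  rewrite /kap; apply: mulr_ge0 => //; apply: mulr_ge0; last exact: expR_ge0.
  by apply: mulr_ge0; [rewrite invr_ge0 sqrtr_ge0|exact: expR_ge0].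
have H0 t : (0 <= \int[P]_w (visit_weight s w t)%:E)%E.
  by apply: integral_ge0 => w _; exact: (V0 (w, t)).
apply: (@le_trans _ _ (\int[lebesgue_measure]_(t in D) \int[P]_w (visit_weight s w t)%:E)%E); last first.
  by apply: ge0_subset_integral.
apply: (@le_trans _ _ (\int[lebesgue_measure]_(t in D) (cst kap%:E t))%E).
  rewrite integral_cst//= muD -EFinM lee_fin /kap /occupation_const.
  rewrite /powR gt_eqF// mulNr le_eqVlt; apply/orP; left; apply/eqP.
  rewrite [Num.sqrt (4 * pi * t1)]sqrtrM ?mulr_ge0 ?pi_ge0//.
  have pi0 : Num.sqrt (4 * pi) != 0 :> R.
    by rewrite gt_eqF// sqrtr_gt0 mulr_gt0 ?pi_gt0.
  have st0 : Num.sqrt t1 != 0 by rewrite gt_eqF.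
  by move: (Num.sqrt t1) (Num.sqrt (4 * pi)) st0 pi0 => A B A0 B0; field; rewrite A0 B0.
apply: ge0_le_integral => //.
  exact: measurable_funTS.
move=> t; rewrite /D/= in_itv/= => /andP[t1t tt1].
have t0 : 0 < t by lra.
apply: le_trans (visit_prob sq t1t tt1) _.
have mv := measurable_visit s t.
have <- : (\int[P]_w (\1_[set w | (s <= X t w <= 2 * s)%R] w)%:E =
    P [set w | (s <= X t w <= 2 * s)%R])%E by rewrite integral_indic// setIT.
rewrite -ge0_integralZl//; last exact/measurable_EFinP/measurable_indic.
rewrite le_eqVlt; apply/orP; left; apply/eqP; apply: eq_integral => w _.
rewrite -EFinM /visit_weight t0/= indicE; congr EFin.
case: ifPn => h; first by rewrite mem_set// mulr1.
by rewrite memNset ?mulr0//=; exact/negP.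
Qed.

Lemma occupation_lower_bound : exists2 C : R, 0 < C & forall s, expR q <= s ->
  ((C * s `^ (- n))%:E <=
   \int[lebesgue_measure]_t \int[P]_w (visit_weight s w t)%:E)%E.
Proof.
exists occupation_const; last exact: occupation_ge.
rewrite /occupation_const; apply: mulr_gt0; last first.
  by rewrite /l divr_gt0 ?normr_gt0// ln_gt0// ltr1n.
apply: mulr_gt0; last exact: expR_gt0.
by rewrite invr_gt0 sqrtr_gt0 mulr_gt0 ?pi_gt0.
Qed.
End occupation_bound.

(** * Integrability of the running payoff at infinity *)

Section monotone_functions.
Context {R : realType}.
Variable h : R -> R.
Hypothesis hincr : increasing_on_pos h.

Lemma measurable_increasing_expR : measurable_fun setT (h \o expR).
Proof.
apply: nondecreasing_measurable => // x y xy /=.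
by apply: hincr; rewrite ?expR_gt0 ?ler_expR.
Qed.

Lemma measurable_increasing : measurable_fun (`]0, +oo[%classic : set R) h.
Proof.
apply: (@eq_measurable_fun _ _ _ _ _ ((h \o expR) \o (@ln R))).
  by move=> s; rewrite inE/= in_itv/= andbT => s0; rewrite lnK.
apply: measurable_funTS; apply: measurableT_comp; last exact: measurable_ln.
exact: measurable_increasing_expR.
Qed.

Lemma measurable_powR_increasing (e : R) (D : set R) : D `<=` (`]0, +oo[%classic : set R) ->
  measurable D -> measurable_fun D (fun s => s `^ e * h s).
Proof.
move=> D0 mD; apply: measurable_funM.
  by apply: measurable_funTS; exact: measurable_powR.
exact: (measurable_funS _ D0 measurable_increasing).
Qed.

Lemma integrable_powR_increasing_itv (e a b : R) : 0 < a ->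
  lebesgue_measure.-integrable `]a, b] (fun s => (s `^ e * h s)%:E).
Proof.
move=> a0; have [ab|ba] := ltP a b; last first.
  by rewrite set_itv_ge -?leNgt ?bnd_simp//; exact: integrable_set0.
have b0 : 0 < b by exact: lt_trans ab.
have D0 : `]a, b]%classic `<=` `]0, +oo[%classic.
  by move=> s /=; rewrite !in_itv/= andbT => /andP[+ _]; exact: lt_trans.
have mD : measurable (`]a, b]%classic : set R) by exact: measurable_itv.
pose M := (`|a `^ e| + `|b `^ e|) * (`|h a| + `|h b|).
apply: (@le_integrable _ _ _ lebesgue_measure _ mD _ (cst M%:E)).
- by apply/measurable_EFinP; exact: measurable_powR_increasing.
- move=> s /=; rewrite in_itv/= => /andP[as_ sb].
  have s0 : 0 < s by exact: lt_trans as_.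
  rewrite lee_fin normrM [`|M|]ger0_norm ?mulr_ge0 ?addr_ge0//.
  apply: ler_pM => //; last first.
    have h1 := hincr a0 (ltW as_); have h2 := hincr s0 sb.
    rewrite ler_norml; apply/andP; split.
      have := ler_norm (- h a); rewrite normrN; have := normr_ge0 (h b); lra.
    have := ler_norm (h b); have := normr_ge0 (h a); lra.
  rewrite !ger0_norm ?powR_ge0//.
  have [e0|e0] := leP 0 e.
    apply: (@le_trans _ _ (b `^ e)); last by rewrite lerDr powR_ge0.
    by apply: ge0_ler_powR => //; rewrite nnegrE ltW.
  apply: (@le_trans _ _ (a `^ e)); last by rewrite lerDl powR_ge0.
  have : a `^ (- e) <= s `^ (- e).
    by apply: ge0_ler_powR; rewrite ?nnegrE ?ltW// oppr_gt0.
  by rewrite !powRN lef_pV2 ?posrE ?powR_gt0.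
- apply/integrableP; split; first exact/measurable_EFinP.
  rewrite integral_cst//= lebesgue_measure_itv/= lte_fin ab -EFinB -EFinM.
  by rewrite ltry.
Qed.
End monotone_functions.

Section integrability_at_infinity.
Context d (T : measurableType d) (R : realType) (P : probability T R).
Variables (W : R -> {RV P >-> R}) (b sigma r : R) (h : R -> R).
Hypotheses (hW : brownian_motion W) (sigma0 : sigma != 0) (r0 : 0 < r).
Hypothesis hincr : increasing_on_pos h.
Hypothesis hinfty : h x @[x --> +oo] --> +oo.
Hypothesis hint :
  (\int[P]_w \int[lebesgue_measure]_(t in `[0%R, +oo[)
     (expR (- (r * t)) * `|h (gbm W b sigma 1 t w)|)%:E < +oo)%E.

Let q := Num.sqrt ((b - sigma ^+ 2) ^+ 2 + 4 * sigma ^+ 2 * r).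
Let n := root_n b sigma r.
Let c := Num.sqrt 2 * sigma.
Let mu := b - c ^+ 2 / 2.
Let X := gbm_path W b sigma 1.
Local Notation mu1 := (@lebesgue_measure R).

Let XE t w : X t w = expR (mu * t + c * W t w).
Proof. by rewrite /X /gbm_path mul1r. Qed.

Let Y (z : T * R) : R := if 0 <= z.2 then W z.2 z.1 else 0.
Let mY : measurable_fun setT Y.
Proof. by apply: measurable_joint; have [_ ] := hW. Qed.

Let k (z : T * R) : R :=
  if 0 <= z.2 then expR (- (r * z.2)) * `|(h \o expR) (mu * z.2 + c * Y z)| else 0.

Let mk : measurable_fun setT k.
Proof.
have m2 : measurable_fun setT (fun z : T * R => z.2) by exact: measurable_snd.
apply: measurable_fun_ifT => //; first exact: measurable_fun_ler.
apply: measurable_funM.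
  apply: (measurableT_comp (@measurable_expR R)).
  by apply: measurable_funN; apply: measurable_funM.
apply: (measurableT_comp (@normr_measurable R setT)).
apply: (measurableT_comp (measurable_increasing_expR hincr)).
by apply: measurable_funD; apply: measurable_funM.
Qed.

Let k0 z : 0 <= k z.
Proof. by rewrite /k; case: ifP => // _; rewrite mulr_ge0 ?expR_ge0. Qed.

Let k_int w : (\int[mu1]_t (k (w, t))%:E =
  \int[lebesgue_measure]_(t in `[0%R, +oo[) (expR (- (r * t)) * `|h (gbm W b sigma 1 t w)|)%:E)%E.
Proof.
rewrite [RHS]integral_mkcond; apply: eq_integral => t _.
rewrite patchE /k /=; case: ifPn => t0.
  by rewrite ifT ?inE/= ?in_itv/= ?t0// /Y/= t0 -XE.
apply/esym/ifN; rewrite notin_setE/= in_itv/= andbT; exact/negP.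
Qed.

(** The payoff per level: integrating over the level [s] the discounted time
    spent in [s, 2 s], weighted by h(s) / s, is dominated by the discounted
    payoff itself.  The maximum makes [h] monotone on the whole line. *)
Let Fk (S : R) (z : (T * R) * R) : R :=
  if S <= z.2 then h (Num.max z.2 S) * z.2 `^ (-1) * visit_weight W b sigma r z.2 z.1.1 z.1.2
  else 0.

Let mFk S : 0 < S -> measurable_fun setT (Fk S).
Proof.
move=> S0.
have m2 : measurable_fun setT (fun z : (T * R) * R => z.2) by exact: measurable_snd.
apply: measurable_fun_ifT => //; first exact: measurable_fun_ler.
apply: measurable_funM; last exact: measurable_visit_weight.
apply: measurable_funM.
  have mh : measurable_fun setT (fun s : R => h (Num.max s S)).
    apply: nondecreasing_measurable => // x y xy.
    apply: hincr; first by rewrite lt_max S0 orbT.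
    by rewrite ge_max !le_max xy/= lexx !orbT.
  exact: (measurableT_comp mh m2).
exact: (measurableT_comp (measurable_powR (-1)) m2).
Qed.

Let visit_weight_ge0 s w t : 0 <= visit_weight W b sigma r s w t.
Proof. by rewrite /visit_weight; case: ifP => // _; rewrite expR_ge0. Qed.

Let Fk_le S z : 0 < S -> (forall s, S <= s -> 0 <= h s) ->
  (\int[mu1]_s (Fk S (z, s))%:E <= (k z)%:E)%E.
Proof.
move=> S0 hS; case: z => w t.
pose Z := X t w.
have Z0 : 0 < Z by rewrite /Z XE expR_gt0.
pose D : set R := `[Z / 2, Z]%classic.
have mD : measurable D by exact: measurable_itv.
pose A := k (w, t) * (2 / Z).
have A0 : 0 <= A by rewrite mulr_ge0// divr_ge0// ltW.
have le1 s : Fk S (w, t, s) <= A * \1_D s.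
  have A1 : 0 <= A * \1_D s by rewrite mulr_ge0// indicE.
  rewrite /Fk/=; case: ifP => // Ss.
  rewrite /visit_weight -/X -/Z; case: ifPn; last by rewrite mulr0.
  move=> /and3P[t0 s1 s2].
  rewrite indicE mem_set ?mulr1; last first.
    by rewrite /D/= in_itv/= s1 andbT ler_pdivrMr// mulrC.
  have s0 : 0 < s by exact: lt_le_trans Ss.
  rewrite max_l// /A /k/= (ltW t0) /Y/= (ltW t0) -XE -/Z.
  have hs0 : 0 <= h s by exact: hS.
  have hsZ : h s <= `|h Z| by rewrite (le_trans _ (ler_norm _))// hincr.
  have sV : s `^ (-1) <= 2 / Z.
    rewrite powR_inv1 ?(ltW s0)// -[leRHS]invf_div lef_pV2 ?posrE ?divr_gt0//.
    by rewrite ler_pdivrMr// mulrC.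
  rewrite mulrC -mulrA ler_wpM2l ?expR_ge0//.
  by apply: ler_pM => //; rewrite powR_ge0.
apply: (@le_trans _ _ (\int[mu1]_s (A * \1_D s)%:E)%E).
  apply: ge0_le_integral => //.
  - move=> s _; rewrite lee_fin /Fk/=; case: ifP => // Ss.
    have s0 : 0 < s by exact: lt_le_trans Ss.
    by rewrite !mulr_ge0 ?powR_ge0// max_l// hS.
  - apply/measurable_EFinP.
    have mi : measurable_fun setT (fun s : R => ((w, t), s)).
      exact: measurable_fun_pair.
    exact: (measurableT_comp (mFk S0) mi).
  - apply/measurable_EFinP; apply: measurable_funM => //.
  - by move=> s _; rewrite lee_fin.
under eq_integral do rewrite EFinM.
rewrite ge0_integralZl//; last exact/measurable_EFinP/measurable_indic.
rewrite integral_indic//= setIT /D lebesgue_measure_itv/= lte_fin.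
rewrite ltr_pdivrMr// ltr_pMr// ltr1n -EFinB -EFinM lee_fin /A.
rewrite le_eqVlt; apply/orP; left; apply/eqP.
have Zn0 : Z != 0 by rewrite gt_eqF.
have alg (u v : R) : v != 0 -> u * (2 / v) * (v - v / 2) = u by move=> v0; field.
exact: alg.
Qed.

(** The expected discounted payoff is finite.  By Tonelli it dominates the
    integral over high levels [s] of h(s) / s times the expected discounted time
    spent in [s, 2 s], and that time is at least of order s^-n. *)
Lemma integrable_at_infinity a : 0 < a ->
  lebesgue_measure.-integrable `]a, +oo[ (fun s => (s `^ (- n - 1) * h s)%:E).
Proof.
move=> a0.
have [S0 hS0] : exists S0 : R, forall s, S0 <= s -> 0 <= h s.
  have /cvgryPge/(_ 0) [S0 [_ H]] := hinfty.
  exists (S0 + 1) => s hs; apply: H; apply: lt_le_trans hs.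
  by rewrite ltrDl.
pose S := Num.max (Num.max S0 (expR q)) a.
have Sa : a <= S by rewrite /S le_max lexx orbT.
have SpS : 0 < S by exact: lt_le_trans Sa.
have Sq : expR q <= S by rewrite /S !le_max lexx orbT.
have hS s : S <= s -> 0 <= h s.
  by move=> Ss; apply: hS0; apply: le_trans Ss; rewrite /S !le_max lexx.
have F0 z : (0 <= (Fk S z)%:E)%E.
  rewrite lee_fin /Fk; case: ifP => // Sz.
  rewrite mulr_ge0// mulr_ge0 ?powR_ge0// hS//.
  by rewrite le_max lexx orbT.
have mF : measurable_fun setT (EFin \o Fk S) by apply/measurable_EFinP; exact: mFk.
have mFw w : measurable_fun setT (fun z : R * R => (Fk S ((w, z.1), z.2))%:E).
  have mi : measurable_fun setT (fun z : R * R => ((w, z.1), z.2) : (T * R) * R).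
    apply: measurable_fun_pair => //; apply: measurable_fun_pair => //.
  exact: (measurableT_comp mF mi).
have mFt w t : measurable_fun setT (fun s => (Fk S ((w, t), s))%:E).
  have mi : measurable_fun setT (fun s : R => ((w, t), s) : (T * R) * R).
    exact: measurable_fun_pair.
  exact: (measurableT_comp mF mi).
have mFs s : measurable_fun setT (fun z : T * R => (Fk S (z, s))%:E).
  have mi : measurable_fun setT (fun z : T * R => (z, s)).
    exact: measurable_fun_pair.
  exact: (measurableT_comp mF mi).
pose G (z : T * R) : \bar R := (\int[mu1]_t (Fk S ((z.1, t), z.2))%:E)%E.
have G0 z : (0 <= G z)%E by apply: integral_ge0 => t _; exact: F0.
have mG : measurable_fun setT G.
  have mi : measurable_fun setT (fun z : (T * R) * R => ((z.1.1, z.2), z.1.2) : (T * R) * R).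
    apply: measurable_fun_pair; last first.
      exact: (measurableT_comp measurable_snd measurable_fst).
    apply: measurable_fun_pair => //.
    exact: (measurableT_comp measurable_fst measurable_fst).
  have mF' := measurableT_comp mF mi.
  exact: (@measurable_fun_fubini_tonelli_F _ _ _ _ _ mu1 _ mF' (fun=> F0 _)).
have up : (\int[P]_w \int[mu1]_t \int[mu1]_s (Fk S ((w, t), s))%:E < +oo)%E.
  have mEk : measurable_fun setT (EFin \o k) by exact/measurable_EFinP.
  have Ek0 z : (0 <= (EFin \o k) z)%E by rewrite lee_fin.
  have mI := @measurable_fun_fubini_tonelli_F _ _ _ _ _ mu1 _ mF F0.
  have I0 z : (0 <= \int[mu1]_s (Fk S (z, s))%:E)%E.
    by apply: integral_ge0 => s _; exact: F0.
  apply: (@le_lt_trans _ _ (\int[P]_w \int[mu1]_t (k (w, t))%:E)%E); last first.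
    by under eq_integral do rewrite k_int.
  apply: ge0_le_integral => //.
  - by move=> w _; apply: integral_ge0 => t _; exact: I0.
  - exact: (@measurable_fun_fubini_tonelli_F _ _ _ _ _ mu1 _ mI I0).
  - exact: (@measurable_fun_fubini_tonelli_F _ _ _ _ _ mu1 _ mEk Ek0).
  move=> w _; apply: ge0_le_integral.
  - exact: measurableT.
  - by move=> t _; exact: I0.
  - have mi : measurable_fun setT (fun t : R => (w, t)) by exact: measurable_fun_pair.
    exact: (measurableT_comp mI mi).
  - have mi : measurable_fun setT (fun t : R => (w, t)) by exact: measurable_fun_pair.
    exact: (measurableT_comp mEk mi).
  - by move=> t _; exact: (Fk_le (w, t)).
have swap : (\int[P]_w \int[mu1]_t \int[mu1]_s (Fk S ((w, t), s))%:E =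
    \int[mu1]_s \int[P]_w \int[mu1]_t (Fk S ((w, t), s))%:E)%E.
  transitivity (\int[P]_w \int[mu1]_s G (w, s))%E.
    apply: eq_integral => w _.
    exact: (@fubini_tonelli _ _ _ _ _ mu1 mu1 _ (mFw w) (fun=> F0 _)).
  exact: (@fubini_tonelli _ _ _ _ _ P mu1 _ mG G0).
rewrite swap {swap} in up.
have [C C0 HC] := @occupation_lower_bound _ _ _ P W b sigma r hW sigma0 r0.
have inner s : S <= s ->
    ((C * (s `^ (- n - 1) * h s))%:E <= \int[P]_w \int[mu1]_t (Fk S ((w, t), s))%:E)%E.
  move=> Ss; have s0 : 0 < s by exact: lt_le_trans Ss.
  have hs0 := hS _ Ss.
  have mv : measurable_fun setT
      (fun z : T * R => (visit_weight W b sigma r s z.1 z.2)%:E).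
    apply/measurable_EFinP.
    have mi : measurable_fun setT (fun z : T * R => (z, s)).
      exact: measurable_fun_pair.
    have mV := @measurable_visit_weight _ _ _ P W b sigma r hW.
    exact: (measurableT_comp mV mi).
  have v0 (z : T * R) : (0 <= (visit_weight W b sigma r s z.1 z.2)%:E)%E.
    by rewrite lee_fin.
  have -> : (\int[P]_w \int[mu1]_t (Fk S ((w, t), s))%:E =
     \int[mu1]_t \int[P]_w (Fk S ((w, t), s))%:E)%E.
    exact: (@fubini_tonelli _ _ _ _ _ P mu1 _ (mFs s) (fun=> F0 _)).
  have -> : (\int[mu1]_t \int[P]_w (Fk S ((w, t), s))%:E =
      (h s * s `^ (-1))%:E * \int[mu1]_t \int[P]_w (visit_weight W b sigma r s w t)%:E)%E.
    rewrite -ge0_integralZl//; last 3 first.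
    - exact: (@measurable_fun_fubini_tonelli_G _ _ _ _ _ P _ mv v0).
    - by move=> t _; apply: integral_ge0 => w _; exact: (v0 (w, t)).
    - by rewrite lee_fin mulr_ge0// powR_ge0.
    apply: eq_integral => t _; rewrite -ge0_integralZl//; last 3 first.
    - have mi : measurable_fun setT (fun w : T => (w, t)) by exact: measurable_fun_pair.
      exact: (measurableT_comp mv mi).
    - by move=> w _; exact: (v0 (w, t)).
    - by rewrite lee_fin mulr_ge0// powR_ge0.
    by apply: eq_integral => w _; rewrite /Fk/= Ss max_l// EFinM.
  apply: le_trans (_ : _ <= (h s * s `^ (-1))%:E * (C * s `^ (- n))%:E)%E _.
    rewrite -EFinM lee_fin powRD; last by rewrite (gt_eqF s0) implybT.
    by rewrite le_eqVlt; apply/orP; left; apply/eqP; ring.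
  apply: lee_wpmul2l; first by rewrite lee_fin mulr_ge0// powR_ge0.
  by apply: HC; exact: le_trans Ss.
have D0 : `[S, +oo[%classic `<=` (`]0, +oo[%classic : set R).
  by move=> s /=; rewrite !in_itv/= !andbT; exact: lt_le_trans.
have mD : measurable (`[S, +oo[%classic : set R) by exact: measurable_itv.
have tail : mu1.-integrable `[S, +oo[ (fun s => (s `^ (- n - 1) * h s)%:E).
  have mg := measurable_powR_increasing hincr (- n - 1) D0 mD.
  apply/integrableP; split; first exact/measurable_EFinP.
  apply: (@le_lt_trans _ _
     ((C^-1)%:E * \int[mu1]_s \int[P]_w \int[mu1]_t (Fk S ((w, t), s))%:E)%E); last first.
    by rewrite lte_mul_pinfty// ?lee_fin ?invr_ge0 ?ltW.
  have mI : measurable_fun setT (fun s => \int[P]_w \int[mu1]_t (Fk S ((w, t), s))%:E)%E.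
    exact: (@measurable_fun_fubini_tonelli_G _ _ _ _ _ P _ mG G0).
  have I0 s : (0 <= \int[P]_w \int[mu1]_t (Fk S ((w, t), s))%:E)%E.
    by apply: integral_ge0 => w _; exact: (G0 (w, s)).
  rewrite -lee_pdivrMl ?invr_gt0// invrK.
  rewrite -ge0_integralZl//; last 2 first.
  - by apply: measurableT_comp => //; exact/measurable_EFinP.
  - by rewrite lee_fin ltW.
  apply: (@le_trans _ _ (\int[mu1]_(s in `[S, +oo[) \int[P]_w \int[mu1]_t (Fk S ((w, t), s))%:E)%E); last first.
    exact: ge0_subset_integral.
  apply: ge0_le_integral => //.
  - by move=> s _; rewrite mule_ge0// lee_fin ltW.
  - apply: measurable_funeM; apply: measurableT_comp => //.
    exact/measurable_EFinP.
  - exact: measurable_funTS.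
  move=> s /=; rewrite in_itv/= andbT => Ss.
  rewrite ger0_norm ?mulr_ge0 ?powR_ge0 ?hS// -EFinM.
  exact: inner.
have sub : `]a, +oo[%classic `<=` `]a, S]%classic `|` (`[S, +oo[%classic : set R).
  move=> s /=; rewrite !in_itv/= !andbT => as_.
  by have [sS|/ltW Ss] := leP s S; [left; rewrite as_|right].
apply: (@integrableS _ _ _ mu1 _ _ _ _ _ sub) => //; first exact: measurableU.
apply: integrable_setU => //.
exact: integrable_powR_increasing_itv.
Qed.
End integrability_at_infinity.

(** * Integrals of powers *)

Section power_integrals.
Context {R : realType}.
Implicit Types e a b x : R.
Local Notation mu := (@lebesgue_measure R).

Lemma continuous_powR e x : 0 < x -> {for x, continuous (fun s : R => s `^ e)}.
Proof.
move=> x0; apply: differentiable_continuous; apply/derivable1_diffP.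
by have [] := is_derive1_powR e x0.
Qed.

Lemma is_derive_powR_div e x : e != 0 -> 0 < x ->
  is_derive x 1 (fun s => e^-1 * s `^ e) (x `^ (e - 1)).
Proof.
move=> e0 x0; have d := is_derive1_powR e x0.
rewrite (_ : (fun s : R => _) = e^-1 \*: (fun s : R => s `^ e))//.
apply: is_derive_eq; rewrite /GRing.scale/= mulrA mulVf// mul1r//.
Qed.

Lemma cvg_powR_div e x : 0 < x ->
  e^-1 * s `^ e @[s --> x] --> e^-1 * x `^ e.
Proof. by move=> x0; apply: cvgM; [exact: cvg_cst|exact: continuous_powR]. Qed.

Lemma integral_powR_itv e a b : e != 0 -> 0 < a -> a <= b ->
  (\int[mu]_(s in `]a, b]) (s `^ (e - 1))%:E)%E = (e^-1 * b `^ e - e^-1 * a `^ e)%:E.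
Proof.
move=> e0 a0; rewrite le_eqVlt => /predU1P[<-|ab].
  by rewrite set_itv_ge ?bnd_simp ?ltxx// integral_set0 subrr.
have pos x : x \in `[a, b] -> 0 < x.
  by rewrite in_itv/= => /andP[ax _]; exact: lt_le_trans ax.
rewrite integral_itv_obnd_cbnd; last first.
  by apply/measurable_EFinP; apply: measurable_funTS; exact: measurable_powR.
rewrite (@continuous_FTC2 _ _ (fun s => e^-1 * s `^ e)) ?EFinB//.
- apply/continuous_in_subspaceT => x; rewrite inE/= => xab.
  by apply: continuous_powR; exact: pos.
- split.
  + move=> x /subset_itv_oo_cc/pos x0.
    by have [] := is_derive_powR_div e0 x0.
  + by apply: cvg_at_right_filter; exact: cvg_powR_div.
  + by apply: cvg_at_left_filter; apply: cvg_powR_div; exact: lt_trans ab.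
- move=> x /subset_itv_oo_cc/pos x0.
  by rewrite derive1E; have [_ ->] := is_derive_powR_div e0 x0.
Qed.

Lemma integral_powR_itvo e a b : e != 0 -> 0 < a -> a <= b ->
  (\int[mu]_(s in `]a, b[) (s `^ (e - 1))%:E)%E = (e^-1 * b `^ e - e^-1 * a `^ e)%:E.
Proof.
move=> e0 a0 ab; rewrite integral_itv_bndo_bndc ?integral_powR_itv//.
by apply/measurable_EFinP; apply: measurable_funTS; exact: measurable_powR.
Qed.

Lemma powR_cvgy0 e : 0 < e -> x `^ (- e) @[x --> +oo%R] --> (0 : R).
Proof.
move=> e0; have : expR (- y) @[y --> +oo%R] --> (0 : R) by exact: cvgr_expR.
move=> H; apply/cvgrPdist_le => eps eps0.
have /cvgrPdist_le/(_ _ eps0)[M [_ HM]] := H.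
exists (expR (Num.max 1 ((M + 1) / e))); split; first exact: num_real.
move=> x /= Mx; have x0 : 0 < x by apply: lt_trans Mx; exact: expR_gt0.
have -> : x `^ (- e) = expR (- (e * ln x)) by rewrite /powR gt_eqF// mulNr.
apply: HM => /=.
have : (M + 1) / e <= ln x.
  rewrite -ler_expR lnK ?posrE//; apply: le_trans (ltW Mx).
  by rewrite ler_expR le_max lexx orbT.
by rewrite ler_pdivrMr// mulrC; apply: lt_le_trans; rewrite ltrDl.
Qed.

Lemma integral_powR_infty e x : 0 < e -> 0 < x ->
  (\int[mu]_(s in `]x, +oo[) (s `^ (- e - 1))%:E)%E = (e^-1 * x `^ (- e))%:E.
Proof.
move=> e0 x0; have ne0 : - e != 0 by rewrite oppr_eq0 gt_eqF.
rewrite integral_itv_obnd_cbnd; last first.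
  by apply/measurable_EFinP; apply: measurable_funTS; exact: measurable_powR.
rewrite (@ge0_continuous_FTC2y _ _ (fun s => (- e)^-1 * s `^ (- e)) _ 0).
- by rewrite -EFinB invrN mulNr sub0r opprK.
- by move=> s _; exact: powR_ge0.
- apply/continuous_in_subspaceT => s; rewrite inE/= in_itv/= andbT => xs.
  by apply: continuous_powR; exact: lt_le_trans xs.
- by rewrite -[X in _ --> X](mulr0 (- e)^-1); apply: cvgMr; exact: powR_cvgy0.
- move=> s xs; have s0 : 0 < s by exact: lt_trans xs.
  by have [] := is_derive_powR_div ne0 s0.
- by apply: cvg_at_right_filter; exact: cvg_powR_div.
- move=> s; rewrite in_itv/= andbT => xs; have s0 : 0 < s by exact: lt_trans xs.
  by rewrite derive1E; have [_ ->] := is_derive_powR_div ne0 s0.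
Qed.

(** The primitive is used on (x / k, x), away from the singularity, and then
    monotone convergence. *)
Lemma integral_powR_zero e x : 0 < e -> 0 < x ->
  (\int[mu]_(s in `]0%R, x[) (s `^ (e - 1))%:E)%E = (e^-1 * x `^ e)%:E.
Proof.
move=> e0 x0.
pose a (k : nat) := x / k.+1%:R; have a0 k : 0 < a k by rewrite divr_gt0.
have ax k : a k <= x.
  by rewrite ler_pdivrMr// ler_peMr ?(ltW x0)// ler1n.
have aS k l : (k <= l)%N -> a l <= a k.
  by move=> kl; rewrite ler_pM2l// lef_pV2 ?posrE// ler_nat.
have acvg : a k @[k --> \oo] --> (0 : R).
  by rewrite -[X in _ --> X](mulr0 x); apply: cvgMr; exact: cvg_harmonic.
pose F k : set R := `]a k, x[%classic.
have UF : \bigcup_k F k = `]0, x[%classic.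
  apply/seteqP; split => s /=.
    by move=> [k _]; rewrite /F/= !in_itv/= => /andP[/(lt_trans (a0 k))-> ->].
  rewrite in_itv/= => /andP[s0 sx].
  have /cvgrPdist_lt/(_ _ s0)[k _ /(_ k (leqnn k))] := acvg.
  rewrite /= sub0r normrN gtr0_norm// => aks.
  by exists k => //; rewrite /F/= in_itv/= aks.
have := @ge0_nondecreasing_set_cvg_integral _ (measurableTypeR R) R F (fun s : R => (s `^ (e - 1))%:E) mu.
rewrite UF => /(_ _ _ _ _)/cvg_lim => <- //; last 4 first.
- move=> k l kl; apply/subsetPset => s; rewrite /F/= !in_itv/= => /andP[ks ->].
  by rewrite andbT; apply: le_lt_trans ks; exact: aS.
- by move=> k; exact: measurable_itv.
- move=> k; apply/measurable_EFinP; apply: measurable_funTS; exact: measurable_powR.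
- by move=> k s _; rewrite lee_fin powR_ge0.
apply/cvg_lim => //.
have -> : (fun k => \int[mu]_(s in F k) (s `^ (e - 1))%:E)%E =
    (fun k => (e^-1 * x `^ e - e^-1 * (a k) `^ e)%:E).
  by apply/funext => k; rewrite integral_powR_itvo// gt_eqF.
apply: cvg_EFin; first by near=> k.
rewrite -[X in _ --> X]subr0; apply: cvgB; first exact: cvg_cst.
rewrite -[X in _ --> X](mulr0 e^-1); apply: cvgMr.
apply: (@cvg_comp _ _ _ a (fun s : R => s `^ e) _ (0^'+)); last exact: powR_cvg0.
move=> A [d d0 HA]; have /cvgrPdist_lt/(_ _ d0) := acvg.
by apply: filterS => k Hk; apply: HA.
Unshelve. all: by end_near. Qed.

Lemma integrable_powR_zero e x : 0 < e -> 0 < x ->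
  mu.-integrable `]0, x[ (fun s => (s `^ (e - 1))%:E).
Proof.
move=> e0 x0; apply/integrableP; split.
  by apply/measurable_EFinP; apply: measurable_funTS; exact: measurable_powR.
rewrite (_ : (\int[mu]_(s in _) _)%E = (e^-1 * x `^ e)%:E) ?ltry//.
rewrite -(integral_powR_zero e0 x0); apply: eq_integral => s _.
by rewrite gee0_abs// lee_fin powR_ge0.
Qed.

Lemma integrable_powR_infty e x : 0 < e -> 0 < x ->
  mu.-integrable `]x, +oo[ (fun s => (s `^ (- e - 1))%:E).
Proof.
move=> e0 x0; apply/integrableP; split.
  by apply/measurable_EFinP; apply: measurable_funTS; exact: measurable_powR.
rewrite (_ : (\int[mu]_(s in _) _)%E = (e^-1 * x `^ (- e))%:E) ?ltry//.
rewrite -(integral_powR_infty e0 x0); apply: eq_integral => s _.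
by rewrite gee0_abs// lee_fin powR_ge0.
Qed.
End power_integrals.

(** * Potentials and their derivatives *)

Definition lower_integral {R : realType} (p : R) (g : R -> R) (x : R) : R :=
  \int[lebesgue_measure]_(s in `]0, x[) (s `^ (p - 1) * g s).

Definition upper_integral {R : realType} (n : R) (g : R -> R) (x : R) : R :=
  \int[lebesgue_measure]_(s in `]x, +oo[) (s `^ (- n - 1) * g s).

(** Up to the factor sigma^2 (n + p), the expected discounted payoff of [g],
    written with the two power solutions of the homogeneous equation. *)
Definition potential {R : realType} (p n : R) (g : R -> R) (x : R) : R :=
  x `^ (- p) * lower_integral p g x + x `^ n * upper_integral n g x.

(** The combination of the two powers obtained by freezing both integrals at [x];
    it touches the potential at [x] to first order. *)
Definition smooth_potential {R : realType} (p n : R) (g : R -> R) (x y : R) : R :=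
  y `^ (- p) * lower_integral p g x + y `^ n * upper_integral n g x.

Section squeeze.
Context {R : realType}.

(** A function within a second-order error of a differentiable one has the same
    derivative; this differentiates potentials at the jumps of [g]. *)
Lemma is_derive_squeeze (F G Q : R -> R) (x l : R) :
  is_derive x 1 F l -> is_derive x 1 Q 0 -> F x = G x -> Q x = 0 ->
  (\forall y \near x, `|G y - F y| <= `|Q y|) -> is_derive x 1 G l.
Proof.
move=> dF dQ FG Q0 H.
suff dE : is_derive x 1 (fun y => G y - F y) 0.
  have -> : G = F + (fun y => G y - F y).
    by apply/funext => y; rewrite fctE addrC subrK.
  by rewrite -[l]addr0; exact: is_deriveD.
have [dQ1 dQ2] := dQ.
have cQ : h^-1 *: (Q (h *: 1 + x) - Q x) @[h --> 0^'] --> (0 : R).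
  rewrite -[X in _ --> X]dQ2.
  exact: dQ1.
have cE : h^-1 *: ((G (h *: 1 + x) - F (h *: 1 + x)) - (G x - F x)) @[h --> 0^'] --> (0 : R).
  apply/cvgrPdist_le => e e0.
  move/cvgrPdist_le/(_ _ e0) : cQ => cQ.
  have H' : \forall h \near (0 : R)^', `|G (h *: 1 + x) - F (h *: 1 + x)| <= `|Q (h *: 1 + x)|.
    have c : (h *: 1 + x : R) @[h --> 0^'] --> x.
      rewrite -[X in _ --> X]add0r; apply: cvgD; last exact: cvg_cst.
      rewrite -[X in _ --> X](scale0r (1 : R^o)); apply: cvgZr_tmp.
      exact: cvg_within.
    exact: c H.
  near=> h.
  have Hh : `|G (h *: 1 + x) - F (h *: 1 + x)| <= `|Q (h *: 1 + x)| by near: h.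
  have Ch : `|0 - h^-1 *: (Q (h *: 1 + x) - Q x)| <= e by near: h.
  apply: le_trans Ch; rewrite !sub0r !normrN FG subrr subr0 Q0 subr0.
  rewrite !normrZ ler_wpM2l//; exact: Hh.
split; first by apply/cvg_ex; exists 0; exact: cE.
by apply/cvg_lim => //; exact: cE.
Unshelve. all: by end_near. Qed.
End squeeze.
Lemma is_derive_powR2 {R : realType} (e1 e2 c1 c2 c0 x : R) : 0 < x ->
  is_derive x 1 (fun y => c1 * y `^ e1 + c2 * y `^ e2 + c0)
    (c1 * (e1 * x `^ (e1 - 1)) + c2 * (e2 * x `^ (e2 - 1))).
Proof.
move=> x0; have d1 := is_derive1_powR e1 x0; have d2 := is_derive1_powR e2 x0.
rewrite (_ : (fun y => _) = c1 \*: (fun y : R => y `^ e1) +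
  c2 \*: (fun y : R => y `^ e2) + cst c0)//.
by apply: is_derive_eq; rewrite addr0.
Qed.

Section kernel.
Context {R : realType}.
Variables p n : R.
Hypotheses (p0 : 0 < p) (n0 : 0 < n).
Local Notation mu := (@lebesgue_measure R).

Let powR_kernel (s : R) : 0 < s -> s `^ (p - 1) = s `^ (- n - 1) * s `^ (n + p).
Proof.
move=> s0; rewrite -powRD; last by rewrite (gt_eqF s0) implybT.
by congr (_ `^ _); ring.
Qed.

(** The two weights have the ratio [s `^ (n + p)], which is increasing: if [g]
    changes sign only where this ratio crosses [c], the weighted integrals
    compare. *)
Lemma kernel_ge (g : R -> R) (a b c : R) : 0 < a ->
  mu.-integrable `]a, b] (fun s => (s `^ (p - 1) * g s)%:E) ->
  mu.-integrable `]a, b] (fun s => (s `^ (- n - 1) * g s)%:E) ->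
  (forall s, a < s <= b -> 0 <= g s * (s `^ (n + p) - c)) ->
  c * \int[mu]_(s in `]a, b]) (s `^ (- n - 1) * g s) <=
  \int[mu]_(s in `]a, b]) (s `^ (p - 1) * g s).
Proof.
move=> a0 ip iN H; rewrite -RintegralZl//.
apply: le_Rintegral => //.
  exact: integrable_realZl.
move=> s; rewrite /= in_itv/= => sab.
have s0 : 0 < s by case/andP: sab => + _; exact: lt_trans.
rewrite powR_kernel// -subr_ge0.
have -> : s `^ (- n - 1) * s `^ (n + p) * g s - c * (s `^ (- n - 1) * g s) =
  s `^ (- n - 1) * (g s * (s `^ (n + p) - c)) by ring.
by rewrite mulr_ge0 ?powR_ge0 ?H.
Qed.

Lemma kernel_le (g : R -> R) (a b c : R) : 0 < a ->
  mu.-integrable `]a, b] (fun s => (s `^ (p - 1) * g s)%:E) ->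
  mu.-integrable `]a, b] (fun s => (s `^ (- n - 1) * g s)%:E) ->
  (forall s, a < s <= b -> g s * (s `^ (n + p) - c) <= 0) ->
  \int[mu]_(s in `]a, b]) (s `^ (p - 1) * g s) <=
  c * \int[mu]_(s in `]a, b]) (s `^ (- n - 1) * g s).
Proof.
move=> a0 ip iN H; rewrite -RintegralZl//.
apply: le_Rintegral => //.
  exact: integrable_realZl.
move=> s; rewrite /= in_itv/= => sab.
have s0 : 0 < s by case/andP: sab => + _; exact: lt_trans.
rewrite powR_kernel// -subr_ge0.
have -> : c * (s `^ (- n - 1) * g s) - s `^ (- n - 1) * s `^ (n + p) * g s =
  s `^ (- n - 1) * - (g s * (s `^ (n + p) - c)) by ring.
by rewrite mulr_ge0 ?powR_ge0// oppr_ge0 H.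
Qed.
End kernel.

Lemma le_powR_l {R : realType} (e a b : R) : 0 <= e -> 0 <= a -> a <= b -> a `^ e <= b `^ e.
Proof.
move=> e0 a0 ab; apply: ge0_ler_powR => //; rewrite nnegrE//; exact: le_trans ab.
Qed.

Section potential.
Context {R : realType}.
Variables (p n : R) (g : R -> R).
Hypotheses (p0 : 0 < p) (n0 : 0 < n) (gincr : increasing_on_pos g).
Local Notation mu := (@lebesgue_measure R).
Hypothesis iI : forall x : R, 0 < x -> mu.-integrable `]0, x[ (fun s => (s `^ (p - 1) * g s)%:E).
Hypothesis iJ : forall x : R, 0 < x -> mu.-integrable `]x, +oo[ (fun s => (s `^ (- n - 1) * g s)%:E).
Local Notation I := (lower_integral p g).
Local Notation J := (upper_integral n g).
Local Notation A a b := (\int[mu]_(s in `]a, b]) (s `^ (p - 1) * g s)).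
Local Notation B a b := (\int[mu]_(s in `]a, b]) (s `^ (- n - 1) * g s)).

Let iab (e a b : R) : 0 < a -> mu.-integrable `]a, b] (fun s => (s `^ e * g s)%:E).
Proof. exact: integrable_powR_increasing_itv. Qed.

Lemma lower_integral_split (x y : R) : 0 < x -> x <= y -> I y = I x + A x y.
Proof.
move=> x0 xy; have y0 := lt_le_trans x0 xy.
have i (x' : R) : 0 < x' -> mu.-integrable `]0, x'] (EFin \o (fun s : R => s `^ (p - 1) * g s)).
  move=> x'0; have x'1 : 0 < x' + 1 by rewrite addr_gt0.
  apply: (@integrableS _ _ _ mu _ _ _ _ _ _ (iI x'1)) => //.
  by move=> s /=; rewrite !in_itv/= => /andP[-> /le_lt_trans]; apply; rewrite ltrDl.
rewrite /lower_integral !Rintegral_itv_bndo_bndc; last 2 first.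
- exact: iI.
- exact: iI.
have := @Rintegral_itvB R (fun s => s `^ (p - 1) * g s) (BRight 0) (BRight y) x (i _ y0).
have h1 : (BRight 0 <= BRight x)%O by rewrite bnd_simp ltW.
have h2 : (BRight x <= BRight y)%O by rewrite bnd_simp.
by move=> /(_ h1 h2) <-; rewrite [RHS]addrC subrK.
Qed.

Lemma upper_integral_split (x y : R) : 0 < x -> x <= y -> J x = B x y + J y.
Proof.
move=> x0 xy; rewrite /upper_integral.
have := @Rintegral_itvB R (fun s => s `^ (- n - 1) * g s) (BRight x) (BInfty _ false) y (iJ x0).
have h1 : (BRight x <= BRight y)%O by rewrite bnd_simp.
have h2 : (BRight y <= BInfty _ false)%O by rewrite bnd_simp.
by move=> /(_ h1 h2) <-; rewrite [RHS]addrC subrK.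
Qed.

Let a1 (a b : R) : 0 < a -> a <= b ->
  \int[mu]_(s in `]a, b]) (s `^ (p - 1)) = p^-1 * b `^ p - p^-1 * a `^ p.
Proof. by move=> a0 ab; rewrite /Rintegral integral_powR_itv// gt_eqF. Qed.

Let b1 (a b : R) : 0 < a -> a <= b ->
  \int[mu]_(s in `]a, b]) (s `^ (- n - 1)) = n^-1 * a `^ (- n) - n^-1 * b `^ (- n).
Proof.
move=> a0 ab; rewrite /Rintegral integral_powR_itv//=; last by rewrite oppr_eq0 gt_eqF.
by rewrite invrN; ring.
Qed.

Let i1 (e a b : R) : 0 < a -> mu.-integrable `]a, b] (fun s => (s `^ e)%:E).
Proof.
move=> a0; have c : increasing_on_pos (fun=> 1 : R) by move=> *; exact: lexx.
rewrite (_ : (fun s : R => _) = (fun s : R => (s `^ e * (fun=> 1) s)%:E)); last first.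
  by apply/funext => s; rewrite mulr1.
exact: integrable_powR_increasing_itv.
Qed.

Lemma lower_integral_le (x c : R) : 0 < x -> (forall s, 0 < s < x -> g s <= c) ->
  I x <= c * (p^-1 * x `^ p).
Proof.
move=> x0 gc; rewrite -[p^-1 * _]/(fine (p^-1 * x `^ p)%:E) -integral_powR_zero//.
rewrite -[fine _]/(\int[mu]_(s in `]0, x[) (s `^ (p - 1))) -RintegralZl//; last first.
  exact: integrable_powR_zero.
apply: le_Rintegral => //; first exact: iI.
  by apply: integrable_realZl => //; exact: integrable_powR_zero.
by move=> s /=; rewrite in_itv/= => sx; rewrite mulrC ler_wpM2r ?powR_ge0 ?gc.
Qed.

Lemma lower_integral_ge (x c : R) : 0 < x -> (forall s, 0 < s < x -> c <= g s) ->
  c * (p^-1 * x `^ p) <= I x.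
Proof.
move=> x0 gc; rewrite -[p^-1 * _]/(fine (p^-1 * x `^ p)%:E) -integral_powR_zero//.
rewrite -[fine _]/(\int[mu]_(s in `]0, x[) (s `^ (p - 1))) -RintegralZl//; last first.
  exact: integrable_powR_zero.
apply: le_Rintegral => //; last 2 first.
- exact: iI.
- by move=> s /=; rewrite in_itv/= => sx; rewrite mulrC ler_wpM2l ?powR_ge0 ?gc.
by apply: integrable_realZl => //; exact: integrable_powR_zero.
Qed.

Lemma upper_integral_ge (x c : R) : 0 < x -> (forall s, x < s -> c <= g s) ->
  c * (n^-1 * x `^ (- n)) <= J x.
Proof.
move=> x0 gc; rewrite -[n^-1 * _]/(fine (n^-1 * x `^ (- n))%:E) -integral_powR_infty//.
rewrite -[fine _]/(\int[mu]_(s in `]x, +oo[) (s `^ (- n - 1))) -RintegralZl//; last first.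
  exact: integrable_powR_infty.
apply: le_Rintegral => //; last 2 first.
- exact: iJ.
- by move=> s /=; rewrite in_itv/= andbT => sx; rewrite mulrC ler_wpM2l ?powR_ge0 ?gc.
by apply: integrable_realZl => //; exact: integrable_powR_infty.
Qed.

Lemma itv_lower_integral_bounds (a b c1 c2 : R) : 0 < a -> a <= b ->
  (forall s, a < s <= b -> c1 <= g s <= c2) ->
  c1 * (p^-1 * b `^ p - p^-1 * a `^ p) <= A a b <= c2 * (p^-1 * b `^ p - p^-1 * a `^ p).
Proof.
move=> a0 ab gc; rewrite -a1// -!RintegralZl//; try exact: i1.
apply/andP; split; apply: le_Rintegral => //; try exact: iab.
- by apply: integrable_realZl => //; exact: i1.
- move=> s /=; rewrite in_itv/= => /gc/andP[+ _].
  by rewrite mulrC => ?; rewrite ler_wpM2l ?powR_ge0.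
- by apply: integrable_realZl => //; exact: i1.
- move=> s /=; rewrite in_itv/= => /gc/andP[_ +].
  by rewrite (mulrC c2) => ?; rewrite ler_wpM2l ?powR_ge0.
Qed.

Lemma itv_upper_integral_bounds (a b c1 c2 : R) : 0 < a -> a <= b ->
  (forall s, a < s <= b -> c1 <= g s <= c2) ->
  c1 * (n^-1 * a `^ (- n) - n^-1 * b `^ (- n)) <= B a b
    <= c2 * (n^-1 * a `^ (- n) - n^-1 * b `^ (- n)).
Proof.
move=> a0 ab gc; rewrite -b1// -!RintegralZl//; try exact: i1.
apply/andP; split; apply: le_Rintegral => //; try exact: iab.
- by apply: integrable_realZl => //; exact: i1.
- move=> s /=; rewrite in_itv/= => /gc/andP[+ _].
  by rewrite mulrC => ?; rewrite ler_wpM2l ?powR_ge0.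
- by apply: integrable_realZl => //; exact: i1.
- move=> s /=; rewrite in_itv/= => /gc/andP[_ +].
  by rewrite (mulrC c2) => ?; rewrite ler_wpM2l ?powR_ge0.
Qed.

Let Q (x y : R) : R :=
  n^-1 * (y `^ n * x `^ (- n) - 1) + p^-1 * (y `^ (- p) * x `^ p - 1).

Let is_derive_Q (x : R) : 0 < x -> is_derive x 1 (Q x) 0.
Proof.
move=> x0.
have d := is_derive_powR2 n (- p) (n^-1 * x `^ (- n)) (p^-1 * x `^ p) (- n^-1 - p^-1) x0.
have -> : Q x = (fun y => n^-1 * x `^ (- n) * y `^ n + p^-1 * x `^ p * y `^ (- p)
    + (- n^-1 - p^-1)) by apply/funext => y; rewrite /Q; ring.
apply: is_derive_eq.
have xn : x `^ n != 0 by rewrite gt_eqF// powR_gt0.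
have xp : x `^ p != 0 by rewrite gt_eqF// powR_gt0.
have xne : x != 0 by rewrite gt_eqF.
rewrite !powRB ?(negbTE xne) ?implybT// !powRN powRr1 ?(ltW x0)//.
have pn : p != 0 by rewrite gt_eqF.
have nn : n != 0 by rewrite gt_eqF.
by field; rewrite xn xp xne pn nn.
Qed.

Let lin (e k M a b : R) : 0 < a ->
  (mu.-integrable `]a, b] (fun s => (s `^ e * (k * g s + M))%:E)) /\
  (\int[mu]_(s in `]a, b]) (s `^ e * (k * g s + M)) =
   k * \int[mu]_(s in `]a, b]) (s `^ e * g s) + M * \int[mu]_(s in `]a, b]) (s `^ e)).
Proof.
move=> a0.
have E (s : R) : s `^ e * (k * g s + M) = k * (s `^ e * g s) + M * s `^ e by ring.
have ig : mu.-integrable `]a, b] (EFin \o (fun s => k * (s `^ e * g s))).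
  by apply: integrable_realZl => //; exact: iab.
have i2 : mu.-integrable `]a, b] (EFin \o (fun s => M * s `^ e)).
  by apply: integrable_realZl => //; exact: i1.
split.
  rewrite (_ : (fun s : R => _) = (fun s : R => (k * (s `^ e * g s) + M * s `^ e)%:E)).
    exact: integrable_realD.
  by apply/funext => s; rewrite E.
under eq_Rintegral do rewrite E.
rewrite RintegralD// RintegralZl//; last exact: iab.
by rewrite RintegralZl//; exact: i1.
Qed.

(** The difference is the integral of [g] against the kernel
    y^-p s^(p - 1) - y^n s^(- n - 1) between [x] and [y], which has a constant
    sign there and vanishes for s = y.  So |g| <= M gives the value for g = M,
    namely [M * Q x y]. *)
Let potential_smooth_le (x y M : R) : 0 < x -> 0 < y ->
  (forall s, Num.min x y < s <= Num.max x y -> `|g s| <= M) ->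
  `|potential p n g y - smooth_potential p n g x y| <= M * Q x y.
Proof.
move=> x0 y0 gM.
have yp : y `^ (- p) * y `^ p = 1 by rewrite -powRD ?addNr ?powRr0// (gt_eqF y0) implybT.
have yn : y `^ n * y `^ (- n) = 1 by rewrite -powRD ?subrr ?powRr0// (gt_eqF y0) implybT.
have ync : y `^ (- p) * y `^ (n + p) = y `^ n.
  by rewrite -powRD ?(gt_eqF y0) ?implybT//; congr (_ `^ _); ring.
pose c := y `^ (n + p).
have yp0 : 0 <= y `^ (- p) by exact: powR_ge0.
have pos (k s : R) : `|k| <= 1 -> Num.min x y < s <= Num.max x y -> 0 <= k * g s + M.
  move=> k1 /gM gs; have : `|k * g s| <= M.
    rewrite normrM (le_trans _ gs)// ler_piMl//.
  by rewrite ler_norml => /andP[+ _]; lra.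
have k1 : `|1 : R| <= 1 by rewrite normr1.
have k2 : `|-1 : R| <= 1 by rewrite normrN normr1.
have alg (a b s1 s2 : R) : a + M * s1 <= c * (b + M * s2) ->
    - a + M * s1 <= c * (- b + M * s2) ->
    `|y `^ (- p) * a - y `^ n * b| <= M * (y `^ n * s2 - y `^ (- p) * s1).
  move=> /(ler_wpM2l yp0) + /(ler_wpM2l yp0).
  rewrite !(mulrA _ c) ync; move: (y `^ (- p)) (y `^ n) => Y U h1 h2.
  by rewrite ler_norml; apply/andP; split; lra.
have alg' (a b s1 s2 : R) : c * (b + M * s2) <= a + M * s1 ->
    c * (- b + M * s2) <= - a + M * s1 ->
    `|y `^ (- p) * a - y `^ n * b| <= M * (y `^ (- p) * s1 - y `^ n * s2).
  move=> /(ler_wpM2l yp0) + /(ler_wpM2l yp0).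
  rewrite !(mulrA _ c) ync; move: (y `^ (- p)) (y `^ n) => Y U h1 h2.
  by rewrite ler_norml; apply/andP; split; lra.
have [xy|/ltW yx] := leP x y.
- rewrite min_l// max_r// in pos.
  have K (k : R) : `|k| <= 1 -> k * A x y + M * (p^-1 * y `^ p - p^-1 * x `^ p) <=
      c * (k * B x y + M * (n^-1 * x `^ (- n) - n^-1 * y `^ (- n))).
    move=> kk; rewrite -a1// -b1//.
    have [l1 <-] := @lin (p - 1) k M x y x0; have [l2 <-] := @lin (- n - 1) k M x y x0.
    apply: kernel_le => // s sxy; rewrite mulr_ge0_le0 ?(pos k)// subr_le0.
    case/andP: sxy => xs sy; have s0 := lt_trans x0 xs.
    by apply: le_powR_l => //; rewrite ltW// addr_gt0.
  have := K _ k1; have := K _ k2; rewrite !mulN1r !mul1r => K2 K1.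
  have := alg _ _ _ _ K1 K2.
  rewrite /potential /smooth_potential (lower_integral_split x0 xy).
  rewrite (upper_integral_split x0 xy) => H.
  rewrite [X in `|X|](_ : _ = y `^ (- p) * A x y - y `^ n * B x y); last by ring.
  apply: le_trans H _; rewrite le_eqVlt; apply/orP; left; apply/eqP; congr (M * _).
  rewrite /Q; move: yp yn; move: (y `^ (- p)) (y `^ p) (y `^ n) (y `^ (- n)).
  by move=> Y Z U V E1 E2; rewrite !mulrBr !(mulrCA _ n^-1) !(mulrCA _ p^-1) E1 E2; ring.
- rewrite min_r// max_l// in pos.
  have K (k : R) : `|k| <= 1 -> 
      c * (k * B y x + M * (n^-1 * y `^ (- n) - n^-1 * x `^ (- n))) <=
      k * A y x + M * (p^-1 * x `^ p - p^-1 * y `^ p).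
    move=> kk; rewrite -a1// -b1//.
    have [l1 <-] := @lin (p - 1) k M y x y0; have [l2 <-] := @lin (- n - 1) k M y x y0.
    apply: kernel_ge => // s sxy; rewrite mulr_ge0 ?(pos k)// subr_ge0.
    case/andP: sxy => ys sx.
    by apply: le_powR_l; rewrite ltW// addr_gt0.
  have := K _ k1; have := K _ k2; rewrite !mulN1r !mul1r => K2 K1.
  have := alg' _ _ _ _ K1 K2.
  rewrite /potential /smooth_potential (lower_integral_split y0 yx).
  rewrite (upper_integral_split y0 yx) -normrN => H.
  rewrite [X in `|X|](_ : _ = - (y `^ (- p) * A y x - y `^ n * B y x)); last by ring.
  apply: le_trans H _; rewrite le_eqVlt; apply/orP; left; apply/eqP; congr (M * _).
  rewrite /Q; move: yp yn; move: (y `^ (- p)) (y `^ p) (y `^ n) (y `^ (- n)).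
  by move=> Y Z U V E1 E2; rewrite !mulrBr !(mulrCA _ n^-1) !(mulrCA _ p^-1) E1 E2; ring.
Qed.

Lemma is_derive_smooth_potential (x y : R) : 0 < y ->
  is_derive y 1 (smooth_potential p n g x)
    (- p * y `^ (- p - 1) * I x + n * y `^ (n - 1) * J x).
Proof.
move=> y0; have d := is_derive_powR2 (- p) n (I x) (J x) 0 y0.
rewrite (_ : smooth_potential p n g x =
   (fun y => I x * y `^ (- p) + J x * y `^ n + 0)); last first.
  by apply/funext => z; rewrite /smooth_potential addr0 mulrC [J x * _]mulrC.
by apply: is_derive_eq; ring.
Qed.

(** [Q x] vanishes to second order at [x], whence differentiability also at the
    discontinuities of [g]. *)
Lemma is_derive_potential (x : R) : 0 < x ->
  is_derive x 1 (potential p n g)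
    (- p * x `^ (- p - 1) * I x + n * x `^ (n - 1) * J x).
Proof.
move=> x0; pose M := `|g (x / 2)| + `|g (x *+ 2)|.
have dQ := is_derive_Q x0.
have dMQ : is_derive x 1 (M \*: Q x) 0.
  by apply: is_derive_eq; rewrite scaler0.
have x2 : x / 2 < x by rewrite ltr_pdivrMr// ltr_pMr// ltr1n.
have x3 : x < x *+ 2 by rewrite mulr2n ltrDl.
apply: (is_derive_squeeze (is_derive_smooth_potential x x0) dMQ) => //.
- have xn : x `^ n * x `^ (- n) = 1 by rewrite -powRD ?subrr ?powRr0// (gt_eqF x0) implybT.
  have xp : x `^ (- p) * x `^ p = 1 by rewrite -powRD ?addNr ?powRr0// (gt_eqF x0) implybT.
  by rewrite /Q /= xn xp !subrr !mulr0 addr0 scaler0.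
- near=> y.
  have y1 : x / 2 < y by near: y; exact: lt_nbhsr.
  have y2 : y < x *+ 2 by near: y; exact: lt_nbhsl.
  have y0 : 0 < y by apply: lt_trans y1; rewrite divr_gt0.
  apply: le_trans (ler_norm _); apply: potential_smooth_le => // s /andP[s1 s2].
  have s1' : x / 2 < s by apply: le_lt_trans s1; rewrite le_min !ltW.
  have s2' : s <= x *+ 2 by apply: le_trans s2 _; rewrite ge_max !ltW.
  have h1 : g (x / 2) <= g s by apply: gincr; rewrite ?divr_gt0// ltW.
  have h2 : g s <= g (x *+ 2).
    by apply: gincr => //; apply: lt_trans s1'; rewrite divr_gt0.
  rewrite ler_norml /M; apply/andP; split.
    have := ler_norm (- g (x / 2)); rewrite normrN; have := normr_ge0 (g (x *+ 2)); lra.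
  have := ler_norm (g (x *+ 2)); have := normr_ge0 (g (x / 2)); lra.
Unshelve. all: by end_near. Qed.
End potential.

Definition potential_d1 {R : realType} (p n : R) (g : R -> R) (x : R) : R :=
  - p * x `^ (- p - 1) * lower_integral p g x + n * x `^ (n - 1) * upper_integral n g x.

Definition potential_d2 {R : realType} (p n : R) (g : R -> R) (x : R) : R :=
  p * (p + 1) * x `^ (- p - 2) * lower_integral p g x +
  n * (n - 1) * x `^ (n - 2) * upper_integral n g x - (p + n) * x `^ (- 2) * g x.

Lemma continuous_dominated {R : realType} (F G : R -> R) (M x : R) :
  {for x, continuous G} -> (\forall y \near x, `|F y - F x| <= M * `|G y - G x|) ->
  {for x, continuous F}.
Proof.
move=> cG H; apply/cvgrPdist_le => e e0.
have M1 : 0 < `|M| + 1 by rewrite ltr_wpDl.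
have e1 : 0 < e / (`|M| + 1) by rewrite divr_gt0.
move/cvgrPdist_le/(_ _ e1) : cG => cG; near=> y.
rewrite distrC; apply: (@le_trans _ _ (M * `|G y - G x|)); first by near: y.
have Gy : `|G y - G x| <= e / (`|M| + 1) by rewrite distrC; near: y.
apply: (@le_trans _ _ ((`|M| + 1) * (e / (`|M| + 1)))).
  apply: (@le_trans _ _ ((`|M| + 1) * `|G y - G x|)).
    by rewrite ler_wpM2r// (le_trans (ler_norm _))// lerDl.
  by rewrite ler_wpM2l// ltW.
by rewrite mulrCA divff ?mulr1// gt_eqF.
Unshelve. all: by end_near. Qed.

Lemma is_derive_powR_mul {R : realType} (c e x l : R) (F : R -> R) : 0 < x ->
  is_derive x 1 F l ->
  is_derive x 1 (fun y => c * y `^ e * F y)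
    (c * (e * x `^ (e - 1)) * F x + c * x `^ e * l).
Proof.
move=> x0 dF; have d := is_derive1_powR e x0.
rewrite (_ : (fun y => _) = (cst c * (fun y : R => y `^ e)) * F)//.
by apply: is_derive_eq; rewrite /GRing.scale/= !fctE; ring.
Qed.

Section regularity.
Context {R : realType}.
Variables (p n : R) (g : R -> R).
Hypotheses (p0 : 0 < p) (n0 : 0 < n) (gincr : increasing_on_pos g).
Local Notation mu := (@lebesgue_measure R).
Hypothesis iI : forall x : R, 0 < x -> mu.-integrable `]0, x[ (fun s => (s `^ (p - 1) * g s)%:E).
Hypothesis iJ : forall x : R, 0 < x -> mu.-integrable `]x, +oo[ (fun s => (s `^ (- n - 1) * g s)%:E).
Local Notation I := (lower_integral p g).
Local Notation J := (upper_integral n g).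

Let near_bound (x : R) : 0 < x -> exists M, \forall y \near x, 0 < y /\
  (forall s, Num.min x y < s <= Num.max x y -> - M <= g s <= M).
Proof.
move=> x0; exists (`|g (x / 2)| + `|g (x *+ 2)|).
have x2 : x / 2 < x by rewrite ltr_pdivrMr// ltr_pMr// ltr1n.
have x3 : x < x *+ 2 by rewrite mulr2n ltrDl.
near=> y.
have y1 : x / 2 < y by near: y; exact: lt_nbhsr.
have y2 : y < x *+ 2 by near: y; exact: lt_nbhsl.
split; first by apply: lt_trans y1; rewrite divr_gt0.
move=> s /andP[s1 s2].
have s1' : x / 2 < s by apply: le_lt_trans s1; rewrite le_min !ltW.
have s2' : s <= x *+ 2 by apply: le_trans s2 _; rewrite ge_max !ltW.
have h1 : g (x / 2) <= g s by apply: gincr; rewrite ?divr_gt0// ltW.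
have h2 : g s <= g (x *+ 2).
  by apply: gincr => //; apply: lt_trans s1'; rewrite divr_gt0.
apply/andP; split.
  have := ler_norm (- g (x / 2)); rewrite normrN; have := normr_ge0 (g (x *+ 2)); lra.
have := ler_norm (g (x *+ 2)); have := normr_ge0 (g (x / 2)); lra.
Unshelve. all: by end_near. Qed.

Lemma continuous_lower_integral (x : R) : 0 < x -> {for x, continuous I}.
Proof.
move=> x0; have [M HM] := near_bound x0.
apply: (@continuous_dominated _ _ (fun y => p^-1 * y `^ p) M).
  exact: cvg_powR_div.
apply: filterS HM => y [y0 HM].
have sol (a c1 c2 : R) : - M * (c2 - c1) <= a <= M * (c2 - c1) -> `|a| <= M * (c2 - c1).
  by rewrite ler_norml mulNr.
have [xy|/ltW yx] := leP x y.
  rewrite min_l// max_r// in HM.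
  have H := itv_lower_integral_bounds p0 gincr x0 xy HM.
  rewrite (lower_integral_split iI x0 xy) addrAC subrr add0r.
  rewrite (@ger0_norm _ (p^-1 * y `^ p - _)); first exact: sol.
  by rewrite subr_ge0 ler_wpM2l ?invr_ge0 ?(ltW p0)// le_powR_l// ltW.
rewrite min_r// max_l// in HM.
have H := itv_lower_integral_bounds p0 gincr y0 yx HM.
rewrite distrC [in leRHS]distrC.
rewrite (lower_integral_split iI y0 yx) addrAC subrr add0r.
rewrite (@ger0_norm _ (p^-1 * x `^ p - _)); first exact: sol.
by rewrite subr_ge0 ler_wpM2l ?invr_ge0 ?(ltW p0)// le_powR_l// ltW.
Qed.

Lemma continuous_upper_integral (x : R) : 0 < x -> {for x, continuous J}.
Proof.
move=> x0; have [M HM] := near_bound x0.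
apply: (@continuous_dominated _ _ (fun y => n^-1 * y `^ (- n)) M).
  by apply: cvgM; [exact: cvg_cst|exact: continuous_powR].
apply: filterS HM => y [y0 HM].
have sol (a c1 c2 : R) : - M * (c2 - c1) <= a <= M * (c2 - c1) -> `|a| <= M * (c2 - c1).
  by rewrite ler_norml mulNr.
have mono (a b : R) : 0 < a -> a <= b -> n^-1 * b `^ (- n) <= n^-1 * a `^ (- n).
  move=> a0 ab; have b0 := lt_le_trans a0 ab.
  rewrite ler_wpM2l ?invr_ge0 ?(ltW n0)// !powRN lef_pV2 ?posrE ?powR_gt0//.
  by rewrite le_powR_l// ltW.
have [xy|/ltW yx] := leP x y.
  rewrite min_l// max_r// in HM.
  have H := itv_upper_integral_bounds n0 gincr x0 xy HM.
  rewrite distrC [in leRHS]distrC (upper_integral_split iJ x0 xy) addrK.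
  rewrite (@ger0_norm _ (n^-1 * x `^ (- n) - _)); first exact: sol.
  by rewrite subr_ge0 mono.
rewrite min_r// max_l// in HM.
have H := itv_upper_integral_bounds n0 gincr y0 yx HM.
rewrite (upper_integral_split iJ y0 yx) addrK.
rewrite (@ger0_norm _ (n^-1 * y `^ (- n) - _)); first exact: sol.
by rewrite subr_ge0 mono.
Qed.

Lemma continuous_potential_d1 (x : R) : 0 < x -> {for x, continuous (potential_d1 p n g)}.
Proof.
move=> x0; apply: cvgD; apply: cvgM.
- by apply: cvgM; [exact: cvg_cst|exact: continuous_powR].
- exact: continuous_lower_integral.
- by apply: cvgM; [exact: cvg_cst|exact: continuous_powR].
- exact: continuous_upper_integral.
Qed.

Lemma continuous_potential_d2 (x : R) : 0 < x -> {for x, continuous g} ->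
  {for x, continuous (potential_d2 p n g)}.
Proof.
move=> x0 gx; apply: cvgB; first apply: cvgD; apply: cvgM => //.
- by apply: cvgM; [exact: cvg_cst|exact: continuous_powR].
- exact: continuous_lower_integral.
- by apply: cvgM; [exact: cvg_cst|exact: continuous_powR].
- exact: continuous_upper_integral.
- by apply: cvgM; [exact: cvg_cst|exact: continuous_powR].
Qed.

Let ftc (e x : R) : 0 < x -> {for x, continuous g} ->
  is_derive x 1 (fun y => \int[mu]_(s in `]x / 2, y]) (s `^ e * g s)) (x `^ e * g x).
Proof.
move=> x0 gx; have x2 : 0 < x / 2 by rewrite divr_gt0.
have x3 : x / 2 < x by rewrite ltr_pdivrMr// ltr_pMr// ltr1n.
have x1 : x < x + 1 by rewrite ltrDl.
have i : mu.-integrable [set` Interval (BRight (x / 2)) (BRight (x + 1))]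
    (EFin \o (fun s : R => s `^ e * g s)) by exact: integrable_powR_increasing_itv.
have c : {for x, continuous (fun s : R => s `^ e * g s)}.
  by apply: cvgM => //; exact: continuous_powR.
have b : (BRight (x / 2) < BRight x)%O by rewrite bnd_simp.
have [d1 d2] := continuous_FTC1 x1 i b c.
by split; [exact: d1|rewrite -derive1E; exact: d2].
Qed.

Lemma is_derive_lower_integral (x : R) : 0 < x -> {for x, continuous g} ->
  is_derive x 1 I (x `^ (p - 1) * g x).
Proof.
move=> x0 gx; have x2 : 0 < x / 2 by rewrite divr_gt0.
have x3 : x / 2 < x by rewrite ltr_pdivrMr// ltr_pMr// ltr1n.
have d := ftc (p - 1) x0 gx.
apply: (@near_eq_is_derive _ _ _
  (cst (I (x / 2)) + (fun y => \int[mu]_(s in `]x / 2, y]) (s `^ (p - 1) * g s)))) => //.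
- near=> y; have y1 : x / 2 < y by near: y; exact: lt_nbhsr.
  by rewrite fctE /= -lower_integral_split// ltW.
- by apply: is_derive_eq; rewrite add0r.
Unshelve. all: by end_near. Qed.

Lemma is_derive_upper_integral (x : R) : 0 < x -> {for x, continuous g} ->
  is_derive x 1 J (- (x `^ (- n - 1) * g x)).
Proof.
move=> x0 gx; have x2 : 0 < x / 2 by rewrite divr_gt0.
have x3 : x / 2 < x by rewrite ltr_pdivrMr// ltr_pMr// ltr1n.
have d := ftc (- n - 1) x0 gx.
apply: (@near_eq_is_derive _ _ _
  (cst (J (x / 2)) - (fun y => \int[mu]_(s in `]x / 2, y]) (s `^ (- n - 1) * g s)))) => //.
- near=> y; have y1 : x / 2 < y by near: y; exact: lt_nbhsr.
  rewrite fctE /= (upper_integral_split iJ x2 (ltW y1)).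
  by rewrite [X in X - _]addrC addrK.
- by apply: is_derive_eq; rewrite sub0r.
Unshelve. all: by end_near. Qed.

Lemma is_derive_potential_d1 (x : R) : 0 < x -> {for x, continuous g} ->
  is_derive x 1 (potential_d1 p n g) (potential_d2 p n g x).
Proof.
move=> x0 gx.
have dI := is_derive_lower_integral x0 gx; have dJ := is_derive_upper_integral x0 gx.
have d1 := is_derive_powR_mul (- p) (- p - 1) x0 dI.
have d2 := is_derive_powR_mul n (n - 1) x0 dJ.
have := is_deriveD d1 d2; rewrite -/(potential_d1 p n g) => d; apply: is_derive_eq.
rewrite /potential_d2.
have E1 : - p - 1 - 1 = - p - 2 by ring.
have E2 : n - 1 - 1 = n - 2 by ring.
rewrite E1 E2.
have F1 : x `^ (- p - 1) * x `^ (p - 1) = x `^ (- 2).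
  by rewrite -powRD ?(gt_eqF x0) ?implybT//; congr (_ `^ _); ring.
have F2 : x `^ (n - 1) * x `^ (- n - 1) = x `^ (- 2).
  by rewrite -powRD ?(gt_eqF x0) ?implybT//; congr (_ `^ _); ring.
transitivity (- p * g x * (x `^ (- p - 1) * x `^ (p - 1)) + p * (p + 1) * x `^ (- p - 2) * I x
  - n * g x * (x `^ (n - 1) * x `^ (- n - 1)) + n * (n - 1) * x `^ (n - 2) * J x).
  by ring.
by rewrite F1 F2; ring.
Qed.
End regularity.

(** * Weighted means of an increasing function *)

Lemma powR_mulNr {R : realType} (e x : R) : 0 < x -> x `^ (- e) * x `^ e = 1.
Proof. by move=> x0; rewrite -powRD ?addNr ?powRr0// (gt_eqF x0) implybT. Qed.

Lemma lt_powR_l {R : realType} (e a b : R) : 0 < e -> 0 <= a -> a < b -> a `^ e < b `^ e.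
Proof.
by move=> e0 a0 ab; apply: gt0_ltr_powR => //; rewrite nnegrE// ltW// (le_lt_trans a0 ab).
Qed.

Lemma powR_le1 {R : realType} (e a : R) : 0 <= e -> 0 <= a -> a <= 1 -> a `^ e <= 1.
Proof. by move=> e0 a0 a1; have := le_powR_l e0 a0 a1; rewrite powR1. Qed.

Lemma powR_lt1 {R : realType} (e a : R) : 0 < e -> 0 <= a -> a < 1 -> a `^ e < 1.
Proof. by move=> e0 a0 a1; have := lt_powR_l e0 a0 a1; rewrite powR1. Qed.

(** The mean of [g] on (0, x) for the probability density p x^-p s^(p - 1). *)
Definition lower_mean {R : realType} (p : R) (g : R -> R) (x : R) : R :=
  p * x `^ (- p) * lower_integral p g x.

(** The mean of [g] on (x, +oo) for the probability density n x^n s^(- n - 1). *)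
Definition upper_mean {R : realType} (n : R) (g : R -> R) (x : R) : R :=
  n * x `^ n * upper_integral n g x.

Section means.
Context {R : realType}.
Variables (p n : R) (g : R -> R).
Hypotheses (p0 : 0 < p) (n0 : 0 < n) (gincr : increasing_on_pos g).
Local Notation mu := (@lebesgue_measure R).
Hypothesis iI : forall x : R, 0 < x -> mu.-integrable `]0, x[ (fun s => (s `^ (p - 1) * g s)%:E).
Hypothesis iJ : forall x : R, 0 < x -> mu.-integrable `]x, +oo[ (fun s => (s `^ (- n - 1) * g s)%:E).
Hypothesis gunb : forall M : R, exists2 z : R, 0 < z & M <= g z.
Local Notation I := (lower_integral p g).
Local Notation J := (upper_integral n g).
Local Notation am := (lower_mean p g).
Local Notation bm := (upper_mean n g).

Let pV : p * p^-1 = 1. Proof. by rewrite mulfV// gt_eqF. Qed.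
Let nV : n * n^-1 = 1. Proof. by rewrite mulfV// gt_eqF. Qed.

Lemma lower_mean_le (x c : R) : 0 < x -> (forall s, 0 < s < x -> g s <= c) -> am x <= c.
Proof.
move=> x0 gc; have := lower_integral_le p0 iI x0 gc.
have pos : 0 <= p * x `^ (- p) by rewrite mulr_ge0 ?powR_ge0// ltW.
move=> /(ler_wpM2l pos); rewrite /lower_mean => /le_trans; apply.
have -> : p * x `^ (- p) * (c * (p^-1 * x `^ p)) = c * (p * p^-1) * (x `^ (- p) * x `^ p) by ring.
by rewrite pV powR_mulNr// !mulr1.
Qed.

Lemma lower_mean_ge (x c : R) : 0 < x -> (forall s, 0 < s < x -> c <= g s) -> c <= am x.
Proof.
move=> x0 gc; have := lower_integral_ge p0 iI x0 gc.
have pos : 0 <= p * x `^ (- p) by rewrite mulr_ge0 ?powR_ge0// ltW.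
move=> /(ler_wpM2l pos); rewrite /lower_mean; apply: le_trans.
have -> : p * x `^ (- p) * (c * (p^-1 * x `^ p)) = c * (p * p^-1) * (x `^ (- p) * x `^ p) by ring.
by rewrite pV powR_mulNr// !mulr1.
Qed.

Lemma upper_mean_ge (x c : R) : 0 < x -> (forall s, x < s -> c <= g s) -> c <= bm x.
Proof.
move=> x0 gc; have := upper_integral_ge n0 iJ x0 gc.
have pos : 0 <= n * x `^ n by rewrite mulr_ge0 ?powR_ge0// ltW.
move=> /(ler_wpM2l pos); rewrite /upper_mean; apply: le_trans.
have -> : n * x `^ n * (c * (n^-1 * x `^ (- n))) = c * (n * n^-1) * (x `^ (- n) * x `^ n) by ring.
by rewrite nV powR_mulNr// !mulr1.
Qed.

Lemma lower_mean_le_fun (x : R) : 0 < x -> am x <= g x.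
Proof.
by move=> x0; apply: lower_mean_le => // s /andP[s0 sx]; apply: gincr => //; exact: ltW.
Qed.

(** The mean at [y] is the barycentre of the mean at [x] and of a mean of [g] on
    (x, y]. *)
Lemma lower_mean_step_ge (x y c : R) : 0 < x -> x <= y -> (forall s, x < s <= y -> c <= g s) ->
  c + (x / y) `^ p * (am x - c) <= am y.
Proof.
move=> x0 xy gc; have y0 := lt_le_trans x0 xy.
have := itv_lower_integral_bounds p0 gincr x0 xy (c1 := c) (c2 := g y).
have H s : x < s <= y -> c <= g s <= g y.
  move=> sxy; rewrite gc//=; case/andP: sxy => xs sy; apply: gincr => //.
  exact: lt_trans xs.
move=> /(_ H)/andP[+ _].
have pos : 0 <= p * y `^ (- p) by rewrite mulr_ge0 ?powR_ge0// ltW.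
move=> /(ler_wpM2l pos) h; rewrite {2}/lower_mean (lower_integral_split iI x0 xy).
have E1 : (x / y) `^ p = x `^ p * y `^ (- p).
  by rewrite powRM ?invr_ge0 ?ltW// -powR_inv1 ?(ltW y0)// -powRrM mulN1r.
rewrite [leRHS]mulrDr; apply: le_trans (lerD (lexx _) h).
rewrite le_eqVlt; apply/orP; left; apply/eqP.
have := powR_mulNr p x0; have := powR_mulNr p y0.
rewrite E1 /lower_mean; move: (x `^ p) (x `^ (- p)) (y `^ p) (y `^ (- p)) => X X' Y Y' e1 e2.
transitivity (c - c * X * Y' + p * Y' * I x * (X' * X)); first by ring.
rewrite e2 mulr1.
transitivity (p * Y' * I x + (p * p^-1) * c * (Y' * Y) - (p * p^-1) * c * Y' * X); last by ring.
by rewrite pV e1; ring.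
Qed.

Lemma upper_mean_step_le (x y c : R) : 0 < x -> x <= y -> (forall s, x < s <= y -> g s <= c) ->
  bm x <= c + (x / y) `^ n * (bm y - c).
Proof.
move=> x0 xy gc; have y0 := lt_le_trans x0 xy.
have := itv_upper_integral_bounds n0 gincr x0 xy (c1 := g x) (c2 := c).
have H s : x < s <= y -> g x <= g s <= c.
  move=> sxy; rewrite gc//= andbT; case/andP: sxy => xs sy; apply: gincr => //.
  exact: ltW.
move=> /(_ H)/andP[_].
have pos : 0 <= n * x `^ n by rewrite mulr_ge0 ?powR_ge0// ltW.
move=> /(ler_wpM2l pos) h; rewrite {1}/upper_mean (upper_integral_split iJ x0 xy).
have E1 : (x / y) `^ n = x `^ n * y `^ (- n).
  by rewrite powRM ?invr_ge0 ?ltW// -powR_inv1 ?(ltW y0)// -powRrM mulN1r.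
rewrite mulrDr; apply: le_trans (lerD h (lexx _)) _.
rewrite le_eqVlt; apply/orP; left; apply/eqP.
have := powR_mulNr n x0; have := powR_mulNr n y0.
rewrite E1 /upper_mean; move: (x `^ n) (x `^ (- n)) (y `^ n) (y `^ (- n)) => X X' Y Y' e1 e2.
transitivity (n * n^-1 * c * (X' * X) - n * n^-1 * c * X * Y' + n * X * J y); first by ring.
rewrite nV e2.
transitivity (c - c * X * Y' + n * X * J y * (Y' * Y)); first by rewrite e1; ring.
by ring.
Qed.

Lemma lower_mean_incr (x y : R) : 0 < x -> x <= y -> am x <= am y.
Proof.
move=> x0 xy; have y0 := lt_le_trans x0 xy.
have gc s : x < s <= y -> g x <= g s by move=> /andP[/ltW xs _]; exact: gincr.
apply: le_trans (lower_mean_step_ge x0 xy gc).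
have h := lower_mean_le_fun x0.
have t1 : (x / y) `^ p <= 1.
  by apply: powR_le1; rewrite ?(ltW p0) ?divr_ge0 ?(ltW x0) ?(ltW y0)// ler_pdivrMr// mul1r.
nra.
Qed.

(** Strict because [g] is unbounded. *)
Lemma fun_lt_upper_mean (x : R) : 0 < x -> g x < bm x.
Proof.
move=> x0; have [z z0 gz] := gunb (g x + 1).
have xz : x < z.
  by rewrite ltNge; apply/negP => zx; have := gincr z0 zx; lra.
have pos : 0 < n * x `^ n by rewrite mulr_gt0// powR_gt0.
have H s : x < s <= z -> g x <= g s <= g z.
  move=> /andP[xs sz]; rewrite !gincr//; [exact: lt_trans xs|exact: ltW].
have /andP[h1 _] := itv_upper_integral_bounds n0 gincr x0 (ltW xz) H.
have h2 : g z * (n^-1 * z `^ (- n)) <= J z.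
  by apply: upper_integral_ge => // s zs; apply: gincr => //; exact: ltW.
have h3 : 0 < n^-1 * z `^ (- n) by rewrite mulr_gt0 ?invr_gt0// powR_gt0.
have h4 : g x * (n^-1 * x `^ (- n)) < J x.
  rewrite (upper_integral_split iJ x0 (ltW xz)).
  move: h1 h2 h3; move: (n^-1 * z `^ (- n)) (n^-1 * x `^ (- n)) => u v h1 h2 h3.
  nra.
have := h4; rewrite -(ltr_pM2l pos) /upper_mean; apply: le_lt_trans.
rewrite le_eqVlt; apply/orP; left; apply/eqP.
have -> : n * x `^ n * (g x * (n^-1 * x `^ (- n))) = g x * (n * n^-1) * (x `^ (- n) * x `^ n) by ring.
by rewrite nV powR_mulNr// !mulr1.
Qed.

Lemma upper_mean_incr (x y : R) : 0 < x -> x < y -> bm x < bm y.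
Proof.
move=> x0 xy; have y0 := lt_trans x0 xy.
have gc s : x < s <= y -> g s <= g y.
  by move=> /andP[xs sy]; apply: gincr => //; exact: lt_trans xs.
apply: le_lt_trans (upper_mean_step_le x0 (ltW xy) gc) _.
have h := fun_lt_upper_mean y0.
have t1 : (x / y) `^ n < 1.
  by apply: powR_lt1; rewrite ?divr_ge0 ?(ltW x0) ?(ltW y0)// ltr_pdivrMr// mul1r.
nra.
Qed.
End means.

(** * The free boundary system *)

Section free_boundary.
Context {R : realType}.
Variables (p n : R) (g : R -> R).
Hypotheses (p0 : 0 < p) (n0 : 0 < n) (gincr : increasing_on_pos g).
Local Notation mu := (@lebesgue_measure R).
Hypothesis iI : forall x : R, 0 < x -> mu.-integrable `]0, x[ (fun s => (s `^ (p - 1) * g s)%:E).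
Hypothesis iJ : forall x : R, 0 < x -> mu.-integrable `]x, +oo[ (fun s => (s `^ (- n - 1) * g s)%:E).
Hypothesis gunb : forall M : R, exists2 z : R, 0 < z & M <= g z.
Local Notation am := (lower_mean p g).
Local Notation bm := (upper_mean n g).

Lemma continuous_lower_mean (x : R) : 0 < x -> {for x, continuous am}.
Proof.
move=> x0; apply: cvgM; last exact: (continuous_lower_integral p0 gincr iI).
by apply: cvgM; [exact: cvg_cst|exact: continuous_powR].
Qed.

Lemma continuous_upper_mean (x : R) : 0 < x -> {for x, continuous bm}.
Proof.
move=> x0; apply: cvgM; last exact: (continuous_upper_integral n0 gincr iJ).
by apply: cvgM; [exact: cvg_cst|exact: continuous_powR].
Qed.

Lemma lower_mean_unbounded (M : R) : exists2 y : R, 0 < y & M <= am y.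
Proof.
have [z z0 gz] := gunb (M + 1).
have [h|h] := leP M (am z); first by exists z.
pose D := M + 1 - am z; have D0 : 0 < D by rewrite /D; lra.
have D1 : 1 <= D + 1 by rewrite lerDr ltW.
pose t := (D + 1) `^ p^-1.
have t1 : 1 <= t.
  by rewrite -(powRr0 (D + 1)) /t; apply: ler_powR => //; rewrite invr_ge0 ltW.
have t0 : 0 < t by exact: lt_le_trans t1.
exists (z * t); first exact: mulr_gt0.
have zt : z <= z * t by rewrite ler_peMr// ltW.
have gc s : z < s <= z * t -> M + 1 <= g s.
  by move=> /andP[/ltW zs _]; apply: le_trans gz _; exact: gincr.
apply: le_trans (lower_mean_step_ge p0 gincr iI z0 zt gc).
have -> : (z / (z * t)) `^ p = (D + 1)^-1.
  have -> : z / (z * t) = t^-1 by field; rewrite !gt_eqF.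
  rewrite /t -powRN -powRrM mulNr mulVf ?gt_eqF// powR_inv1// addr_ge0//; exact: ltW.
have -> : am z - (M + 1) = - D by rewrite /D; ring.
have : (D + 1)^-1 * D <= 1 by rewrite mulrC ler_pdivrMr ?mul1r ?lerDl// addr_gt0.
by move: ((D + 1)^-1) => u; lra.
Qed.

Lemma upper_mean_small (s0 eta kap : R) : 0 < s0 -> eta < kap ->
  (forall s : R, 0 < s <= s0 -> g s <= eta) -> exists2 x : R, 0 < x <= s0 & bm x < kap.
Proof.
move=> s00 ek geta; pose e := kap - eta; have e0 : 0 < e by rewrite subr_gt0.
pose D := bm s0 - eta.
pose u := e / (e + `|D| + 1).
have den : 0 < e + `|D| + 1 by rewrite ltr_wpDl// addr_ge0// ltW.
have u0 : 0 < u by rewrite divr_gt0.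
have u1 : u <= 1.
  rewrite ler_pdivrMr// mul1r; have := normr_ge0 D; lra.
pose t := u `^ n^-1; have t0 : 0 < t by exact: powR_gt0.
have t1 : t <= 1 by apply: powR_le1 => //; [rewrite invr_ge0 ltW|exact: ltW].
have x0 : 0 < s0 * t by exact: mulr_gt0.
have xs : s0 * t <= s0 by rewrite ler_piMr// ltW.
exists (s0 * t); first by rewrite x0.
have gc s : s0 * t < s <= s0 -> g s <= eta.
  by move=> /andP[xs' ss]; apply: geta; rewrite ss andbT; exact: lt_trans xs'.
apply: le_lt_trans (upper_mean_step_le n0 gincr iJ x0 xs gc) _.
have -> : (s0 * t / s0) `^ n = u.
  rewrite mulrAC divff ?gt_eqF// mul1r /t -powRrM mulVf ?gt_eqF//.
  by rewrite powRr1// ltW.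
rewrite -/D; suff : u * D < e by rewrite /e; lra.
apply: (@le_lt_trans _ _ (u * `|D|)); first by rewrite ler_wpM2l ?(ltW u0)// ler_norm.
rewrite /u mulrAC ltr_pdivrMr// ltr_pM2l//; lra.
Qed.

(** Eliminating the ratio [zeta / alpha] leaves one equation in alpha: the lower
    mean equals kap (upper mean / kap)^(- p / n).  The upper mean is below [kap]
    near 0 and the lower mean above [kap] far out, so the intermediate value
    theorem applies; truncating the upper mean at [kap] keeps the power defined,
    and at a solution the truncation is inactive because the lower mean is
    smaller than the upper one. *)
Lemma free_boundary_exists (s0 eta kap : R) : 0 < kap -> 0 < s0 -> eta < kap ->
  (forall s : R, 0 < s <= s0 -> g s <= eta) ->
  exists zeta alpha : R, [/\ 0 < zeta < alpha,
    am alpha = kap * (zeta / alpha) `^ p & bm alpha = kap * (zeta / alpha) `^ (- n)].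
Proof.
move=> k0 s00 ek geta.
have [a0 /andP[a00 a0s] ba0] := upper_mean_small s00 ek geta.
have [a1 a10 aa1] := lower_mean_unbounded kap.
have am_lt_bm (x : R) : 0 < x -> am x < bm x.
  move=> x0; apply: le_lt_trans (lower_mean_le_fun p0 gincr iI x0) _.
  exact: (fun_lt_upper_mean n0 gincr iJ gunb x0).
have a01 : a0 <= a1.
  rewrite leNgt; apply/negP => /ltW a10'.
  have := lower_mean_incr p0 gincr iI a10 a10'; have := am_lt_bm _ a00; lra.
pose B (x : R) : R := Num.max (bm x) kap / kap.
have B1 x : 1 <= B x by rewrite ler_pdivlMr// mul1r le_max lexx orbT.
have B0 x : 0 < B x by exact: lt_le_trans (B1 x).
pose F (x : R) : R := am x - kap * (B x) `^ (- (p / n)).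
have cF (x : R) : 0 < x -> {for x, continuous F}.
  move=> x0; apply: cvgB; first exact: continuous_lower_mean.
  apply: cvgM; first exact: cvg_cst.
  apply: (@continuous_comp _ _ _ B (fun s : R => s `^ (- (p / n)))); last first.
    by apply: continuous_powR; exact: B0.
  apply: cvgM; last exact: cvg_cst.
  apply: (@continuous_max _ _ bm (cst kap)); first exact: continuous_upper_mean.
  exact: cst_continuous.
have F0 : F a0 < 0.
  have Ba0 : B a0 = 1 by rewrite /B max_r ?divff ?gt_eqF// ltW.
  rewrite /F Ba0 powR1 mulr1; have := am_lt_bm _ a00; lra.
have Fk x : am x >= kap -> 0 <= F x.
  move=> ax; rewrite /F subr_ge0; apply: le_trans ax.
  rewrite ler_piMr ?(ltW k0)// powRN invf_le1 ?powR_gt0//.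
  by rewrite -(powRr0 (B x)) ler_powR// divr_ge0 ?ltW.
have cF' : {within `[a0, a1], continuous F}.
  apply/continuous_in_subspaceT => x; rewrite inE/= in_itv/= => /andP[ax _].
  by apply: cF; exact: lt_le_trans ax.
have F01 : Num.min (F a0) (F a1) <= 0 <= Num.max (F a0) (F a1).
  have := Fk _ aa1; move: (F a0) (F a1) F0 => u v u0 v0.
  by rewrite ge_min le_max (ltW u0) v0 orbT.
have [alpha aab Fa] := IVT a01 cF' F01.
have al0 : 0 < alpha by move: aab; rewrite in_itv/= => /andP[ax _]; exact: lt_le_trans ax.
have kb : kap < bm alpha.
  rewrite ltNge; apply/negP => bk.
  have Ba : B alpha = 1 by rewrite /B max_r ?divff ?gt_eqF.
  move: Fa; rewrite /F Ba powR1 mulr1; have := am_lt_bm _ al0; lra.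
have Ba : B alpha = bm alpha / kap by rewrite /B (max_l (ltW kb)).
pose th := (B alpha) `^ (- n^-1).
have th0 : 0 < th by exact: powR_gt0.
have th1 : th < 1.
  rewrite /th powRN invf_lt1 ?powR_gt0//.
  have B1' : 1 < B alpha by rewrite Ba (ltr_pdivlMr _ _ k0) mul1r.
  have nV0 : 0 < n^-1 by rewrite invr_gt0.
  by have := lt_powR_l nV0 ler01 B1'; rewrite powR1.
exists (th * alpha), alpha.
have -> : th * alpha / alpha = th by rewrite mulfK// gt_eqF.
split.
- by rewrite mulr_gt0//= gtr_pMl.
- rewrite /th -powRrM; move/eqP: Fa; rewrite subr_eq0 => /eqP ->.
  by congr (_ * _ `^ _); field; rewrite gt_eqF.
- rewrite /th -powRrM mulrNN mulVf ?gt_eqF// powRr1 ?(ltW (B0 _))// Ba.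
  by rewrite mulrCA divff ?mulr1// gt_eqF.
Qed.

(** Moving alpha to the right increases both means, strictly for the upper one,
    while the two equations make them vary in opposite directions as functions
    of [zeta / alpha]. *)
Lemma free_boundary_unique (kap z a z' a' : R) : 0 < kap ->
  0 < z < a -> 0 < z' < a' ->
  am a = kap * (z / a) `^ p -> bm a = kap * (z / a) `^ (- n) ->
  am a' = kap * (z' / a') `^ p -> bm a' = kap * (z' / a') `^ (- n) ->
  z' = z /\ a' = a.
Proof.
move=> k0 za za' e1 e2 e3 e4.
have aux (y b y' b' : R) : 0 < y < b -> 0 < y' < b' ->
    am b = kap * (y / b) `^ p -> bm b = kap * (y / b) `^ (- n) ->
    am b' = kap * (y' / b') `^ p -> bm b' = kap * (y' / b') `^ (- n) -> b < b' -> False.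
  move=> /andP[y0 yb] /andP[y0' yb'] f1 f2 f3 f4 bb.
  have b0 := lt_trans y0 yb; have b0' := lt_trans y0' yb'.
  have q0 : 0 < y / b by rewrite divr_gt0.
  have q0' : 0 < y' / b' by rewrite divr_gt0.
  have := lower_mean_incr p0 gincr iI b0 (ltW bb).
  have := upper_mean_incr n0 gincr iJ gunb b0 bb.
  rewrite f1 f2 f3 f4 !ler_pM2l// !ltr_pM2l// !powRN ltf_pV2 ?posrE ?powR_gt0// => h1 h2.
  have [h|h] := ltP (y' / b') (y / b).
    by have := lt_powR_l p0 (ltW q0') h; rewrite ltNge h2.
  by have := le_powR_l (ltW n0) (ltW q0) h; rewrite leNgt h1.
have aa : a' = a.
  by apply/eqP; rewrite eq_le !leNgt; apply/andP; split; apply/negP => h;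
    [exact: (aux z a z' a')|exact: (aux z' a' z a)].
split => //; subst a'.
case/andP: za => z0 za; case/andP: za' => z0' za'.
have a0 := lt_trans z0 za.
have E : (z / a) `^ p = (z' / a) `^ p.
  have kn : kap != 0 by rewrite gt_eqF.
  by apply: (mulfI kn); rewrite -e1 -e3.
have q0 : 0 < z / a by rewrite divr_gt0.
have q0' : 0 < z' / a by rewrite divr_gt0.
have : z' / a = z / a.
  apply/eqP; rewrite eq_le !leNgt; apply/andP; split; apply/negP => h.
    by have := lt_powR_l p0 (ltW q0) h; rewrite E ltxx.
  by have := lt_powR_l p0 (ltW q0') h; rewrite E ltxx.
have an : a^-1 != 0 by rewrite invr_eq0 gt_eqF.
exact: mulIf.
Qed.
End free_boundary.

(** * Gluing and explicit derivatives *)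

Section gluing.
Context {R : realType}.

Lemma is_derive_glue (f f1 f2 : R -> R) (x l : R) :
  is_derive x 1 f1 l -> is_derive x 1 f2 l -> f1 x = f x -> f2 x = f x ->
  (\forall y \near x, f y = f1 y \/ f y = f2 y) -> is_derive x 1 f l.
Proof.
move=> d1 d2 e1 e2 H.
have dQ : is_derive x 1 (fun y => f2 y - f1 y) 0.
  by rewrite -(subrr l); exact: is_deriveB.
apply: (is_derive_squeeze d1 dQ) => //; first by rewrite e1 e2 subrr.
apply: filterS H => y [->|->]; last exact: lexx.
by rewrite subrr normr0 normr_ge0.
Qed.

Lemma continuous_glue (f f1 f2 : R -> R) (x : R) :
  {for x, continuous f1} -> {for x, continuous f2} -> f1 x = f x -> f2 x = f x ->
  (\forall y \near x, f y = f1 y \/ f y = f2 y) -> {for x, continuous f}.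
Proof.
move=> c1 c2 e1 e2 H; apply/cvgrPdist_le => e e0.
move/cvgrPdist_le/(_ _ e0) : c1 => c1; move/cvgrPdist_le/(_ _ e0) : c2 => c2.
near=> y.
have [->|->] : f y = f1 y \/ f y = f2 y by near: y.
  by rewrite -e1; near: y.
by rewrite -e2; near: y.
Unshelve. all: by end_near. Qed.

Section explicit_derivatives.
Variables (w d : R -> R).
Hypothesis wd : forall x : R, 0 < x -> is_derive x 1 w (d x).

Lemma derive1_explicit (x : R) : 0 < x -> derive1 w x = d x.
Proof. by move=> x0; rewrite derive1E; have [_ ->] := wd x0. Qed.

Lemma near_derive1_explicit (x : R) : 0 < x -> \forall y \near x, d y = derive1 w y.
Proof.
move=> x0; near=> y; rewrite derive1_explicit//.
by near: y; exact: lt_nbhsr.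
Unshelve. all: by end_near. Qed.

Lemma C1_on_posI : (forall x : R, 0 < x -> {for x, continuous d}) -> C1_on_pos w.
Proof.
move=> cd x x0; split; first by have [] := wd x0.
rewrite /prop_for /continuous_at derive1_explicit//.
have := cd _ x0; rewrite /prop_for /continuous_at; apply: cvg_trans.
by apply: near_eq_cvg; exact: near_derive1_explicit.
Qed.

Variables (E : set R) (dd : R -> R).
Hypothesis ddd : forall x : R, 0 < x -> ~ E x -> is_derive x 1 d (dd x).

Lemma is_derive_derive1 (x : R) : 0 < x -> ~ E x -> is_derive x 1 (derive1 w) (dd x).
Proof.
move=> x0 Ex; apply: (@near_eq_is_derive _ _ _ d); last exact: ddd.
exact: near_derive1_explicit.
Qed.

Lemma derive2_explicit (x : R) : 0 < x -> ~ E x -> derive1 (derive1 w) x = dd x.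
Proof. by move=> x0 Ex; rewrite derive1E; have [_ ->] := is_derive_derive1 x0 Ex. Qed.

Lemma C2_offI : (forall x : R, 0 < x -> ~ E x -> {for x, continuous dd}) -> C2_off E w.
Proof.
move=> cdd; split => [x x0 Ex|]; first by have [] := is_derive_derive1 x0 Ex.
apply/subspace_continuousP => x [/=]; rewrite in_itv/= andbT => x0 Ex.
rewrite /from_subspace derive2_explicit//.
apply: (@cvg_trans _ (dd y @[y --> within (`]0, +oo[ `\` E) (nbhs x)])); last first.
  by apply: cvg_within_filter; exact: cdd.
apply: near_eq_cvg; rewrite near_withinE; near=> y => -[/=].
by rewrite in_itv/= andbT => y0 Ey; rewrite derive2_explicit.
Unshelve. all: by end_near. Qed.
End explicit_derivatives.
End gluing.

(** * Differential equation and obstacle inequality *)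

Section potential_facts.
Context {R : realType}.
Variables (p n : R) (g : R -> R).
Hypotheses (p0 : 0 < p) (n0 : 0 < n) (gincr : increasing_on_pos g).
Local Notation mu := (@lebesgue_measure R).
Hypothesis iI : forall x : R, 0 < x -> mu.-integrable `]0, x[ (fun s => (s `^ (p - 1) * g s)%:E).
Hypothesis iJ : forall x : R, 0 < x -> mu.-integrable `]x, +oo[ (fun s => (s `^ (- n - 1) * g s)%:E).
Hypothesis gunb : forall M : R, exists2 z : R, 0 < z & M <= g z.
Local Notation I := (lower_integral p g).
Local Notation J := (upper_integral n g).
Local Notation am := (lower_mean p g).
Local Notation bm := (upper_mean n g).
Local Notation A a b := (\int[mu]_(s in `]a, b]) (s `^ (p - 1) * g s)).
Local Notation B a b := (\int[mu]_(s in `]a, b]) (s `^ (- n - 1) * g s)).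

Let pn0 : p != 0. Proof. by rewrite gt_eqF. Qed.
Let nn0 : n != 0. Proof. by rewrite gt_eqF. Qed.

Lemma potentialE (x : R) : potential p n g x = p^-1 * am x + n^-1 * bm x.
Proof. by rewrite /potential /lower_mean /upper_mean; field; rewrite pn0 nn0. Qed.

Lemma potential_incr : increasing_on_pos (potential p n g).
Proof.
move=> x y x0; rewrite le_eqVlt => /predU1P[->//|xy].
rewrite !potentialE lerD// ler_wpM2l ?invr_ge0 ?(ltW p0) ?(ltW n0)//.
  exact: (lower_mean_incr p0 gincr iI x0 (ltW xy)).
exact/ltW/(upper_mean_incr n0 gincr iJ gunb x0 xy).
Qed.

Lemma potential_ge (x c : R) : 0 < x -> (forall s, 0 < s -> c <= g s) ->
  c * (p^-1 + n^-1) <= potential p n g x.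
Proof.
move=> x0 gc; rewrite potentialE mulrDr.
rewrite lerD// mulrC ler_wpM2l ?invr_ge0 ?(ltW p0) ?(ltW n0)//.
  by apply: (lower_mean_ge p0 iI) => // s /andP[s0 _]; exact: gc.
by apply: (upper_mean_ge n0 iJ) => // s s0; apply: gc; exact: lt_trans s0.
Qed.

Lemma powR_ode (v b r x a c : R) : 0 < x ->
  v * p * (p + 1) - b * p - r = 0 -> v * n * (n - 1) + b * n - r = 0 ->
  v * x ^+ 2 * (p * (p + 1) * x `^ (- p - 2) * a + n * (n - 1) * x `^ (n - 2) * c)
    + b * x * (- p * x `^ (- p - 1) * a + n * x `^ (n - 1) * c)
    - r * (x `^ (- p) * a + x `^ n * c) = 0.
Proof.
move=> x0 hp hn.
have xne : x != 0 by rewrite gt_eqF.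
have d2 (e : R) : x `^ (e - 2) = x `^ e / x ^+ 2.
  by rewrite powRB ?(gt_eqF x0) ?implybT// powR_mulrn// ltW.
have d1 (e : R) : x `^ (e - 1) = x `^ e / x.
  by rewrite powRB ?(gt_eqF x0) ?implybT// powRr1// ltW.
rewrite !d2 !d1.
transitivity (x `^ (- p) * a * (v * p * (p + 1) - b * p - r) +
  x `^ n * c * (v * n * (n - 1) + b * n - r)); last by rewrite hp hn !mulr0 addr0.
by move: (x `^ (- p)) (x `^ n) => X1 X2; field.
Qed.

Lemma potential_ode (v b r x : R) : 0 < x ->
  v * p * (p + 1) - b * p - r = 0 -> v * n * (n - 1) + b * n - r = 0 ->
  v * x ^+ 2 * potential_d2 p n g x + b * x * potential_d1 p n g x
    - r * potential p n g x + v * (p + n) * g x = 0.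
Proof.
move=> x0 hp hn; rewrite -[RHS](powR_ode (I x) (J x) x0 hp hn).
have dd : x `^ (- 2) = (x ^+ 2)^-1 by rewrite powRN powR_mulrn// ltW.
rewrite /potential_d2 /potential_d1 /potential dd.
by field; rewrite gt_eqF.
Qed.

(** An increasing [g] changes sign at most once, at the infimum of the points
    where it is nonnegative; the weights are compared there. *)
Lemma kernel_sign_change (y a : R) : 0 < y -> y <= a -> 0 <= B y a ->
  y `^ (n + p) * B y a <= A y a.
Proof.
move=> y0 ya E0.
have [z z0 gz] := gunb 0.
pose S := [set s : R | 0 < s /\ 0 <= g s].
have iS : has_inf S.
  by split; [exists z|exists 0 => s [/ltW]].
pose s0 := inf S; pose c := Num.max s0 y.
have cy : y <= c by rewrite le_max lexx orbT.
have c0 : 0 < c by exact: lt_le_trans cy.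
have np0 : 0 <= n + p by rewrite addr_ge0// ltW.
apply: (@le_trans _ _ (c `^ (n + p) * B y a)).
  by rewrite ler_wpM2r// le_powR_l// ltW.
apply: kernel_ge => //; [exact: integrable_powR_increasing_itv|exact: integrable_powR_increasing_itv|].
move=> s /andP[ys sa]; have spos : 0 < s by exact: lt_trans ys.
have [sc|cs] := leP s c.
  have := sc; rewrite le_eqVlt => /predU1P[->|sc'].
    by rewrite subrr mulr0.
  have ss0 : s < s0.
    by move: sc'; rewrite /c lt_max => /orP[//|/lt_trans/(_ ys)]; rewrite ltxx.
  have gs : g s < 0.
    rewrite ltNge; apply/negP => gs0.
    have /(ge_inf iS.2) : S s by split.
    by rewrite leNgt ss0.
  rewrite mulr_le0// ?(ltW gs)// subr_le0; apply: le_powR_l => //; exact: ltW.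
have s0s : s0 < s by apply: le_lt_trans cs; rewrite le_max lexx.
have [s' [s'0 gs'] s's] := inf_lt iS.1 s0s.
have gs : 0 <= g s by apply: le_trans gs' _; apply: gincr => //; exact: ltW.
by rewrite mulr_ge0// subr_ge0; apply: le_powR_l => //; exact: ltW.
Qed.

Section obstacle.
Variables kap zeta alpha : R.
Hypotheses (k0 : 0 < kap) (z0 : 0 < zeta) (za : zeta < alpha).
Hypothesis ea : am alpha = kap * (zeta / alpha) `^ p.
Hypothesis eb : bm alpha = kap * (zeta / alpha) `^ (- n).

Let a0 : 0 < alpha. Proof. exact: lt_trans za. Qed.

Let q (e : R) : (zeta / alpha) `^ e = zeta `^ e * alpha `^ (- e).
Proof. by rewrite powRM ?invr_ge0 ?ltW// -powR_inv1 ?(ltW a0)// -powRrM mulN1r. Qed.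

Lemma lower_integral_boundary : I alpha = kap * (p^-1 * zeta `^ p).
Proof.
have ap := powR_mulNr p a0.
move: ea; rewrite /lower_mean q => E.
transitivity (p^-1 * (p * alpha `^ (- p) * I alpha) * alpha `^ p).
  transitivity ((p^-1 * p) * (alpha `^ (- p) * alpha `^ p) * I alpha); last by ring.
  by rewrite mulVf// ap !mul1r.
rewrite E; transitivity (p^-1 * kap * zeta `^ p * (alpha `^ (- p) * alpha `^ p)).
  by ring.
by rewrite ap mulr1; ring.
Qed.

Lemma upper_integral_boundary : J alpha = kap * (n^-1 * zeta `^ (- n)).
Proof.
have an := powR_mulNr n a0.
move: eb; rewrite /upper_mean q opprK => E.
transitivity (n^-1 * (n * alpha `^ n * J alpha) * alpha `^ (- n)).
  transitivity ((n^-1 * n) * (alpha `^ (- n) * alpha `^ n) * J alpha); last by ring.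
  by rewrite mulVf// an !mul1r.
rewrite E; transitivity (n^-1 * kap * zeta `^ (- n) * (alpha `^ (- n) * alpha `^ n)).
  by ring.
by rewrite an mulr1; ring.
Qed.

(** The equations say that the frozen potential has value kap (1 / p + 1 / n)
    and derivative 0 at [zeta]. *)
Lemma smooth_potential_boundary (y : R) : 0 < y ->
  smooth_potential p n g alpha y =
  kap * (p^-1 * (y / zeta) `^ (- p) + n^-1 * (y / zeta) `^ n).
Proof.
move=> y0.
have q' (e : R) : (y / zeta) `^ e = y `^ e * zeta `^ (- e).
  by rewrite powRM ?invr_ge0 ?ltW// -powR_inv1 ?(ltW z0)// -powRrM mulN1r.
rewrite /smooth_potential lower_integral_boundary upper_integral_boundary !q' opprK.
by ring.
Qed.

(** s^(- p - 1) <= s^(n - 1) for s >= 1. *)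
Lemma smooth_potential_boundary_incr (x y : R) : zeta <= x -> x <= y ->
  smooth_potential p n g alpha x <= smooth_potential p n g alpha y.
Proof.
move=> zx; rewrite le_eqVlt => /predU1P[->//|xy].
have x0 := lt_le_trans z0 zx; have y0 := lt_trans x0 xy.
rewrite !smooth_potential_boundary// ler_wpM2l ?(ltW k0)//.
have u1 : 1 <= x / zeta by rewrite ler_pdivlMr// mul1r.
have uv : x / zeta <= y / zeta by rewrite ler_wpM2r ?invr_ge0 ?(ltW z0)// ltW.
move: (x / zeta) (y / zeta) u1 uv => u w u1 uw.
have u0 : 0 < u by exact: lt_le_trans u1.
have np : - p != 0 by rewrite oppr_eq0.
have : \int[mu]_(s in `]u, w]) (s `^ (- p - 1)) <= \int[mu]_(s in `]u, w]) (s `^ (n - 1)).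
  have i1 (e : R) : mu.-integrable `]u, w] (EFin \o (fun s : R => s `^ e)).
    have c : increasing_on_pos (fun=> 1 : R) by move=> *; exact: lexx.
    rewrite (_ : EFin \o _ = (fun s : R => (s `^ e * (fun=> 1) s)%:E)); last first.
      by apply/funext => s /=; rewrite mulr1.
    exact: integrable_powR_increasing_itv.
  apply: le_Rintegral => //.
  move=> s /=; rewrite in_itv/= => /andP[us _]; apply: ler_powR.
    by apply: le_trans (ltW us).
  by rewrite lerD2r (@le_trans _ _ 0)// ?oppr_le0 ltW.
rewrite /Rintegral !integral_powR_itv//= invrN !mulNr; lra.
Qed.

Let theta1 : (zeta / alpha) `^ p <= 1.
Proof.
by apply: powR_le1; rewrite ?(ltW p0) ?divr_ge0 ?(ltW z0) ?(ltW a0)// ler_pdivrMr// mul1r ltW.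
Qed.

Let diff (y : R) : 0 < y -> y <= alpha ->
  smooth_potential p n g alpha y - potential p n g y =
  y `^ (- p) * (A y alpha - y `^ (n + p) * B y alpha).
Proof.
move=> y0 ya; rewrite /smooth_potential /potential (lower_integral_split iI y0 ya).
rewrite (upper_integral_split iJ y0 ya) mulrBr mulrA.
have -> : y `^ (- p) * y `^ (n + p) = y `^ n.
  by rewrite -powRD ?(gt_eqF y0) ?implybT//; congr (_ `^ _); ring.
by ring.
Qed.

Let diff_zeta : B zeta alpha <= 0 -> zeta `^ (n + p) * B zeta alpha <= A zeta alpha.
Proof.
move=> Ez.
have zp : 0 < zeta `^ (- p) by exact: powR_gt0.
rewrite -subr_ge0 -(pmulr_rge0 _ zp) -diff//; last exact: ltW.
rewrite smooth_potential_boundary// divff ?gt_eqF// !powR1 !mulr1 potentialE.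
have h1 : am zeta <= kap.
  apply: le_trans (lower_mean_incr p0 gincr iI z0 (ltW za)) _.
  by rewrite ea ler_piMr// ltW.
have h2 : bm zeta <= kap.
  rewrite /upper_mean (upper_integral_split iJ z0 (ltW za)) mulrDr.
  have -> : n * zeta `^ n * J alpha = kap.
    rewrite upper_integral_boundary.
    transitivity (n * n^-1 * kap * (zeta `^ (- n) * zeta `^ n)); first by ring.
    by rewrite mulfV// (powR_mulNr n z0) mul1r mulr1.
  rewrite gerDr; apply: mulr_ge0_le0 => //; rewrite mulr_ge0 ?powR_ge0//; exact: ltW.
have pp : 0 < p^-1 by rewrite invr_gt0.
have nn : 0 < n^-1 by rewrite invr_gt0.
have := ler_wpM2l (ltW pp) h1; have := ler_wpM2l (ltW nn) h2; lra.
Qed.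

(** The difference is y^-p times the excess over [y, alpha] of the first weighted
    integral over y^(n + p) times the second one, B.  If B >= 0, this is the sign
    change lemma.  If B < 0, then [g] is nonpositive up to [y], which lets the
    excess grow from [zeta] to [y]; and at [zeta] it is nonnegative because both
    means there are at most [kap]. *)
Lemma obstacle_middle (y : R) : zeta <= y -> y <= alpha ->
  potential p n g y <= smooth_potential p n g alpha y.
Proof.
move=> zy ya; have y0 := lt_le_trans z0 zy.
rewrite -subr_ge0 diff// mulr_ge0 ?powR_ge0// subr_ge0.
have [E0|E0] := leP 0 (B y alpha); first exact: kernel_sign_change.
have gy : g y <= 0.
  rewrite leNgt; apply/negP => gy; move: E0; rewrite ltNge => /negP; apply.
  apply: Rintegral_ge0 => s /=; rewrite in_itv/= => /andP[ys _].
  by rewrite mulr_ge0 ?powR_ge0// (le_trans (ltW gy))// gincr// ltW.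
have np0 : 0 <= n + p by rewrite addr_ge0// ltW.
have gneg s : zeta < s <= y -> g s <= 0.
  move=> /andP[zs sy]; apply: le_trans gy; apply: gincr => //; exact: lt_trans zs.
have Bsplit : B zeta alpha = B zeta y + B y alpha.
  apply: (@addIr _ (J alpha)); rewrite -upper_integral_split//; last exact: ltW.
  by rewrite -addrA -!upper_integral_split.
have Asplit : A zeta alpha = A zeta y + A y alpha.
  apply: (@addrI _ (I zeta)); rewrite -lower_integral_split//; last exact: ltW.
  by rewrite addrA -!lower_integral_split.
have Bz : B zeta y <= 0.
  have H s : zeta < s <= y -> g zeta <= g s <= 0.
    by move=> sy; rewrite gneg// andbT; case/andP: sy => zs _; apply: gincr => //; exact: ltW.
  by have /andP[_] := itv_upper_integral_bounds n0 gincr z0 zy H; rewrite mul0r.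
have Bza : B zeta alpha <= 0 by rewrite Bsplit -(addr0 0) lerD// ltW.
have := diff_zeta Bza; rewrite Bsplit Asplit.
have K : A zeta y <= zeta `^ (n + p) * B zeta y.
  apply: kernel_le => //; [exact: integrable_powR_increasing_itv|exact: integrable_powR_increasing_itv|].
  move=> s sy; rewrite mulr_le0_ge0 ?gneg// subr_ge0.
  by case/andP: sy => zs _; apply: le_powR_l => //; exact: ltW.
have Z : zeta `^ (n + p) <= y `^ (n + p) by apply: le_powR_l => //; exact: ltW.
move: (zeta `^ (n + p)) (y `^ (n + p)) (A zeta y) (A y alpha) (B zeta y) (B y alpha) K Z E0.
move=> u v a1 a2 b1 b2 K Z /ltW b20 H; apply: le_trans (ler_wnM2r b20 Z) _.
by rewrite -(lerD2l a1); apply: le_trans H; rewrite mulrDr lerD2r.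
Qed.

Lemma obstacle_left (y : R) : 0 < y -> y <= zeta ->
  potential p n g y <= kap * (p^-1 + n^-1).
Proof.
move=> y0 yz; apply: le_trans (potential_incr y0 yz) _.
apply: le_trans (obstacle_middle (lexx _) (ltW za)) _.
by rewrite smooth_potential_boundary// divff ?gt_eqF// !powR1 !mulr1.
Qed.

(** [g] dominates its lower mean, which is positive at alpha. *)
Lemma obstacle_right_ge0 (y : R) : alpha <= y -> 0 <= g y.
Proof.
move=> ay; apply: (@le_trans _ _ (am alpha)).
  by rewrite ea mulr_ge0 ?powR_ge0// ltW.
apply: le_trans (lower_mean_le_fun p0 gincr iI a0) _; exact: gincr.
Qed.
End obstacle.
End potential_facts.

(** * The value at zero and the characteristic roots *)

Section value_at_zero.
Context {R : realType}.
Variable h : R -> R.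
Hypothesis hincr : increasing_on_pos h.

(** A monotone function has a limit at 0 in the extended reals, its infimum. *)
Lemma value_at_zeroE :
  value_at_zero h = ereal_inf ((fun x => (h x)%:E) @` `]0, +oo[).
Proof.
rewrite /value_at_zero; apply/cvg_lim => //.
apply: (@nondecreasing_at_right_cvge _ (fun x => (h x)%:E) 0 (BInfty _ false)) => //.
move=> x y; rewrite !in_itv/= !andbT => x0 _ xy; rewrite lee_fin; exact: hincr.
Qed.

Lemma value_at_zero_ge (L : R) :
  (L%:E <= value_at_zero h)%E <-> forall x, 0 < x -> L <= h x.
Proof.
rewrite value_at_zeroE; split=> [H x x0|H].
  rewrite -lee_fin; apply: le_trans H _; apply: ereal_inf_lbound.
  by exists x => //=; rewrite in_itv/= x0.
apply: le_ereal_inf_tmp => y [x /=]; rewrite in_itv/= andbT => x0 <-.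
by rewrite lee_fin H.
Qed.

Lemma value_at_zero_lt (L : R) :
  (value_at_zero h < L%:E)%E <-> exists2 x : R, 0 < x & h x < L.
Proof.
split=> [H|[x x0 hx]].
  apply/not_exists2P => H'; move: H; rewrite ltNge => /negP; apply.
  apply/value_at_zero_ge => x x0; have [//|] := H' x.
  by move/negP; rewrite -leNgt.
rewrite value_at_zeroE; apply: (@le_lt_trans _ _ (h x)%:E); last by rewrite lte_fin.
by apply: ereal_inf_lbound; exists x => //=; rewrite in_itv/= x0.
Qed.
End value_at_zero.

Section roots.
Context {R : realType}.
Variables b sigma r : R.
Hypotheses (sigma0 : sigma != 0) (r0 : 0 < r).
Local Notation m := (root_m b sigma r).
Local Notation n := (root_n b sigma r).
Let v := sigma ^+ 2.
Let D := (b - v) ^+ 2 + 4 * v * r.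
Let q := Num.sqrt D.

Let v0 : 0 < v. Proof. by rewrite /v exprn_even_gt0. Qed.
Let D0 : 0 <= D.
Proof. by rewrite addr_ge0 ?sqr_ge0// mulr_ge0 ?(ltW r0)// mulr_ge0 ?(ltW v0). Qed.
Let q2 : q ^+ 2 = D. Proof. by rewrite sqr_sqrtr. Qed.
Let q0 : 0 <= q. Proof. exact: sqrtr_ge0. Qed.
Let vne : v != 0. Proof. by rewrite gt_eqF. Qed.

Let v2 : 0 < 2 * v. Proof. by apply: mulr_gt0. Qed.
Let mE : m = (v - b - q) / (2 * v). Proof. by []. Qed.
Let nE : n = (v - b + q) / (2 * v). Proof. by []. Qed.

Let char (e s : R) : s ^+ 2 = 1 -> e = (v - b + s * q) / (2 * v) ->
  v * e * (e - 1) + b * e - r = 0.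
Proof.
move=> s2 ->.
have E : v * ((v - b + s * q) / (2 * v)) * ((v - b + s * q) / (2 * v) - 1) +
  b * ((v - b + s * q) / (2 * v)) - r = ((s ^+ 2 * q ^+ 2) - D) / (4 * v).
  by rewrite /D; move: q v vne => a w w0; field.
by rewrite E s2 mul1r q2 subrr mul0r.
Qed.

Lemma root_m_char : v * m * (m - 1) + b * m - r = 0.
Proof. by apply: (@char _ (-1)); rewrite ?sqrrN ?expr1n// mE mulN1r. Qed.

Lemma root_n_char : v * n * (n - 1) + b * n - r = 0.
Proof. by apply: (@char _ 1); rewrite ?expr1n// nE mul1r. Qed.

Lemma roots_mul : v * (- m) * n = r.
Proof.
have E : v * (- m) * n = (q ^+ 2 - (b - v) ^+ 2) / (4 * v).
  by rewrite mE nE; move: q v vne => a w w0; field.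
by rewrite E q2 /D; move: v vne => w w0; field.
Qed.

Let qpos : `|b - v| < q.
Proof.
rewrite -(@ltr_pXn2r _ 2%N)// ?nnegrE// real_normK ?num_real// q2 /D ltrDl.
by rewrite mulr_gt0// mulr_gt0.
Qed.

Lemma root_m_lt0 : m < 0.
Proof.
rewrite mE pmulr_llt0 ?invr_gt0//.
by rewrite subr_lt0; apply: le_lt_trans qpos; rewrite distrC ler_norm.
Qed.

Lemma root_n_gt0 : 0 < n.
Proof.
rewrite nE pmulr_lgt0 ?invr_gt0//.
by rewrite addrC -opprB subr_gt0; apply: le_lt_trans qpos; exact: ler_norm.
Qed.
End roots.

(** * The candidate functions as potentials *)

Section shift.
Context {R : realType}.
Variables (p n : R) (h : R -> R).
Hypotheses (p0 : 0 < p) (n0 : 0 < n) (hincr : increasing_on_pos h).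
Local Notation mu := (@lebesgue_measure R).

Lemma integrable_at_zero (L x : R) : (forall s, 0 < s -> L <= h s) -> 0 < x ->
  mu.-integrable `]0, x[ (fun s => (s `^ (p - 1) * h s)%:E).
Proof.
move=> hL x0.
have D0 : `]0, x[%classic `<=` (`]0, +oo[%classic : set R).
  by move=> s /=; rewrite !in_itv/= andbT => /andP[].
have mD : measurable (`]0, x[%classic : set R) by exact: measurable_itv.
pose M := `|L| + `|h x|.
have iM : mu.-integrable `]0, x[ (EFin \o (fun s => M * s `^ (p - 1))).
  by apply: integrable_realZl => //; exact: integrable_powR_zero.
apply: le_integrable iM => //.
  by apply/measurable_EFinP; exact: measurable_powR_increasing.
move=> s /=; rewrite in_itv/= => /andP[s0 sx].
rewrite lee_fin !normrM mulrC ler_wpM2r//.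
have h1 := hL _ s0; have h2 := hincr s0 (ltW sx).
rewrite (ger0_norm (_ : 0 <= M)) ?addr_ge0// ler_norml; apply/andP; split.
  have := ler_norm (- L); rewrite normrN; have := normr_ge0 (h x); rewrite /M; lra.
have := ler_norm (h x); have := normr_ge0 L; rewrite /M; lra.
Qed.

Hypothesis iI : forall x : R, 0 < x -> mu.-integrable `]0, x[ (fun s => (s `^ (p - 1) * h s)%:E).
Hypothesis iJ : forall x : R, 0 < x -> mu.-integrable `]x, +oo[ (fun s => (s `^ (- n - 1) * h s)%:E).
Variable c : R.
Local Notation g := (fun s => h s - c).

Lemma increasing_shift : increasing_on_pos g.
Proof. by move=> x y x0 xy; rewrite lerD2r; exact: hincr. Qed.

Lemma integrable_shift_lower (x : R) : 0 < x ->
  mu.-integrable `]0, x[ (fun s => (s `^ (p - 1) * g s)%:E).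
Proof.
move=> x0; rewrite (_ : (fun s : R => _) =
  EFin \o (fun s : R => s `^ (p - 1) * h s - c * s `^ (p - 1))); last first.
  by apply/funext => s /=; rewrite mulrBr (mulrC c).
apply: integrable_realB => //; first exact: iI.
by apply: integrable_realZl => //; exact: integrable_powR_zero.
Qed.

Lemma integrable_shift_upper (x : R) : 0 < x ->
  mu.-integrable `]x, +oo[ (fun s => (s `^ (- n - 1) * g s)%:E).
Proof.
move=> x0; rewrite (_ : (fun s : R => _) =
  EFin \o (fun s : R => s `^ (- n - 1) * h s - c * s `^ (- n - 1))); last first.
  by apply/funext => s /=; rewrite mulrBr (mulrC c).
apply: integrable_realB => //; first exact: iJ.
by apply: integrable_realZl => //; exact: integrable_powR_infty.
Qed.

Lemma lower_integral_shift (x : R) : 0 < x ->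
  lower_integral p g x = lower_integral p h x - c * (p^-1 * x `^ p).
Proof.
move=> x0; rewrite /lower_integral.
under eq_Rintegral do rewrite mulrBr (mulrC _ c).
rewrite RintegralB//; [|exact: iI|]; last first.
  by apply: integrable_realZl => //; exact: integrable_powR_zero.
congr (_ - _); rewrite RintegralZl//; last exact: integrable_powR_zero.
by rewrite /Rintegral integral_powR_zero.
Qed.

Lemma upper_integral_shift (x : R) : 0 < x ->
  upper_integral n g x = upper_integral n h x - c * (n^-1 * x `^ (- n)).
Proof.
move=> x0; rewrite /upper_integral.
under eq_Rintegral do rewrite mulrBr (mulrC _ c).
rewrite RintegralB//; [|exact: iJ|]; last first.
  by apply: integrable_realZl => //; exact: integrable_powR_infty.
congr (_ - _); rewrite RintegralZl//; last exact: integrable_powR_infty.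
by rewrite /Rintegral integral_powR_infty.
Qed.

Lemma potential_shift (x : R) : 0 < x ->
  potential p n g x = potential p n h x - c * (p^-1 + n^-1).
Proof.
move=> x0; rewrite /potential lower_integral_shift// upper_integral_shift//.
transitivity (x `^ (- p) * lower_integral p h x + x `^ n * upper_integral n h x -
  c * (p^-1 * (x `^ (- p) * x `^ p) + n^-1 * (x `^ (- n) * x `^ n))); first by ring.
by rewrite (powR_mulNr p x0) (powR_mulNr n x0) (mulr1 p^-1) (mulr1 n^-1).
Qed.
End shift.

Section candidates.
Context {R : realType}.
Variables (b sigma r : R) (h : R -> R) (K1 K : R).
Hypotheses (sigma0 : sigma != 0) (r0 : 0 < r).
Local Notation m := (root_m b sigma r).
Local Notation n := (root_n b sigma r).
Local Notation p := (- m).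
Local Notation v := (sigma ^+ 2).
Local Notation S := (v * (n - m)).
Local Notation g := (fun s => h s - r * K1).
Local Notation kap := (- (r * K)).

Lemma root_scale_gt0 : 0 < S.
Proof.
rewrite pmulr_rgt0 ?exprn_even_gt0// subr_gt0.
exact: lt_trans (root_m_lt0 b sigma0 r0) (root_n_gt0 b sigma0 r0).
Qed.

Lemma root_scale_inv : S^-1 * (p^-1 + n^-1) = r^-1.
Proof.
have m0 := root_m_lt0 b sigma0 r0; have n0 := root_n_gt0 b sigma0 r0.
have E := roots_mul b sigma0 r0; have S0 := root_scale_gt0.
have mn : n - m != 0 by rewrite subr_eq0 gt_eqF// (lt_trans m0 n0).
rewrite -[in RHS]E; field.
by rewrite sigma0 mn (gt_eqF n0) (lt_eqF m0).
Qed.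

Lemma R_hE (x : R) : R_h b sigma r h x = S^-1 * potential p n h x.
Proof. by rewrite /R_h /potential opprK. Qed.

(** The two equations of the system in terms of the means of h - r K1 at the
    right end. *)
Lemma free_boundary_systemE (z a : R) : 0 < z -> 0 < a ->
  free_boundary_system b sigma r h K1 K z a <->
  lower_mean p g a = kap * (z / a) `^ p /\ upper_mean n g a = kap * (z / a) `^ (- n).
Proof.
move=> z0 a0.
have q (e : R) : (z / a) `^ e = z `^ e * a `^ (- e).
  by rewrite powRM ?invr_ge0 ?ltW// -powR_inv1 ?(ltW a0)// -powRrM mulN1r.
rewrite /lower_mean /upper_mean !q !opprK /free_boundary_system.
rewrite -/(lower_integral p g a) -/(upper_integral n g a).
have ap : a `^ m != 0 by rewrite gt_eqF// powR_gt0.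
have an : a `^ n != 0 by rewrite gt_eqF// powR_gt0.
have E1 : m * lower_integral p g a - r * K * z `^ p = 0 <->
    p * a `^ m * lower_integral p g a = kap * (z `^ p * a `^ m).
  have alg : p * a `^ m * lower_integral p g a - kap * (z `^ p * a `^ m) =
    - (a `^ m * (m * lower_integral p g a - r * K * z `^ p)) by ring.
  split => [H|/eqP]; first by apply/eqP; rewrite -subr_eq0 alg H mulr0 oppr0.
  by rewrite -subr_eq0 alg oppr_eq0 mulf_eq0 (negbTE ap)/= => /eqP.
have E2 : n * upper_integral n g a + r * K * z `^ (- n) = 0 <->
    n * a `^ n * upper_integral n g a = kap * (z `^ (- n) * a `^ n).
  have alg : n * a `^ n * upper_integral n g a - kap * (z `^ (- n) * a `^ n) =
    a `^ n * (n * upper_integral n g a + r * K * z `^ (- n)) by ring.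
  split => [H|/eqP]; first by apply/eqP; rewrite -subr_eq0 alg H mulr0.
  by rewrite -subr_eq0 alg mulf_eq0 (negbTE an)/= => /eqP.
by split=> -[/E1 ? /E2 ?].
Qed.

(** The boundary equations make this S^-1 times the lower integral at the right
    end, so that the middle piece is the potential frozen there. *)
Lemma Delta1E (z : R) : Delta1 b sigma r K z = S^-1 * (kap * (p^-1 * z `^ p)).
Proof.
have m0 := root_m_lt0 b sigma0 r0; have n0 := root_n_gt0 b sigma0 r0.
have mn : n - m != 0 by rewrite subr_eq0 gt_eqF// (lt_trans m0 n0).
rewrite /Delta1; field.
by rewrite sigma0 mn (lt_eqF m0).
Qed.

Lemma Delta2E (z : R) : Delta2 b sigma r K z = S^-1 * (kap * (n^-1 * z `^ (- n))).
Proof.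
have m0 := root_m_lt0 b sigma0 r0; have n0 := root_n_gt0 b sigma0 r0.
have mn : n - m != 0 by rewrite subr_eq0 gt_eqF// (lt_trans m0 n0).
rewrite /Delta2; field.
by rewrite sigma0 mn (gt_eqF n0).
Qed.
End candidates.

(** * Functions defined in three pieces *)

Section piecewise.
Context {R : realType}.
Variables (z a : R).
Hypothesis za : z < a.

Definition piecewise (f1 f2 f3 : R -> R) (y : R) : R :=
  if y <= z then f1 y else if y < a then f2 y else f3 y.

Section values.
Variables f1 f2 f3 : R -> R.
Local Notation f := (piecewise f1 f2 f3).

Lemma piecewise_left (y : R) : y <= z -> f y = f1 y.
Proof. by rewrite /piecewise => ->. Qed.

Lemma piecewise_middle (y : R) : z < y -> y < a -> f y = f2 y.
Proof. by rewrite /piecewise => zy ->; rewrite leNgt zy. Qed.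

Lemma piecewise_right (y : R) : a <= y -> f y = f3 y.
Proof. by move=> ay; rewrite /piecewise leNgt (lt_le_trans za ay)/= ltNge ay. Qed.

Lemma near_piecewise_left (y : R) : y < z -> \forall t \near y, f1 t = f t.
Proof.
move=> yz; near=> t; rewrite piecewise_left// ltW//.
by near: t; exact: lt_nbhsl.
Unshelve. all: by end_near. Qed.

Lemma near_piecewise_middle (y : R) : z < y -> y < a -> \forall t \near y, f2 t = f t.
Proof.
move=> zy ya; near=> t; rewrite piecewise_middle//.
  by near: t; exact: lt_nbhsr.
by near: t; exact: lt_nbhsl.
Unshelve. all: by end_near. Qed.

Lemma near_piecewise_right (y : R) : a < y -> \forall t \near y, f3 t = f t.
Proof.
move=> ay; near=> t; rewrite piecewise_right// ltW//.
by near: t; exact: lt_nbhsr.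
Unshelve. all: by end_near. Qed.

Lemma near_piecewise_join1 : \forall t \near z, f t = f1 t \/ f t = f2 t.
Proof.
near=> t; have [tz|zt] := leP t z; first by left; rewrite piecewise_left.
by right; rewrite piecewise_middle//; near: t; exact: lt_nbhsl.
Unshelve. all: by end_near. Qed.

Lemma near_piecewise_join2 : \forall t \near a, f t = f2 t \/ f t = f3 t.
Proof.
near=> t; have [ta|at_] := ltP t a; last by right; rewrite piecewise_right.
by left; rewrite piecewise_middle//; near: t; exact: lt_nbhsr.
Unshelve. all: by end_near. Qed.
End values.

Variant position_spec (y : R) : Prop :=
  | PosLeft of y < z | PosJoin1 of y = z | PosMiddle of z < y & y < a
  | PosJoin2 of y = a | PosRight of a < y.

Lemma positionP (y : R) : position_spec y.
Proof.
have [yz|zy|->] := ltgtP y z; [exact: PosLeft| |exact: PosJoin1].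
by have [ya|ay|->] := ltgtP y a; [exact: PosMiddle|exact: PosRight|exact: PosJoin2].
Qed.

Lemma is_derive_piecewise_off (f1 f2 f3 d1 d2 d3 : R -> R) (y : R) :
  y <> z -> y <> a ->
  (y < z -> is_derive y 1 f1 (d1 y)) -> (z < y -> y < a -> is_derive y 1 f2 (d2 y)) ->
  (a < y -> is_derive y 1 f3 (d3 y)) ->
  is_derive y 1 (piecewise f1 f2 f3) (piecewise d1 d2 d3 y).
Proof.
move=> yz ya h1 h2 h3; case: (positionP y) => // [lt1|lt1 lt2|lt1].
- rewrite piecewise_left ?(ltW lt1)//.
  exact: near_eq_is_derive (near_piecewise_left f1 f2 f3 lt1) (h1 lt1).
- rewrite piecewise_middle//.
  exact: near_eq_is_derive (near_piecewise_middle f1 f2 f3 lt1 lt2) (h2 lt1 lt2).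
- rewrite piecewise_right ?(ltW lt1)//.
  exact: near_eq_is_derive (near_piecewise_right f1 f2 f3 lt1) (h3 lt1).
Qed.

Lemma continuous_piecewise_off (f1 f2 f3 : R -> R) (y : R) :
  y <> z -> y <> a ->
  (y < z -> {for y, continuous f1}) -> (z < y -> y < a -> {for y, continuous f2}) ->
  (a < y -> {for y, continuous f3}) -> {for y, continuous (piecewise f1 f2 f3)}.
Proof.
have near_cont (f g : R -> R) : (\forall t \near y, f t = g t) ->
    {for y, continuous f} -> {for y, continuous g}.
  move=> fg; rewrite /prop_for /continuous_at -(nbhs_singleton fg); apply: cvg_trans.
  exact: near_eq_cvg.
move=> yz ya h1 h2 h3; case: (positionP y) => // [lt1|lt1 lt2|lt1].
- exact: near_cont (near_piecewise_left f1 f2 f3 lt1) (h1 lt1).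
- exact: near_cont (near_piecewise_middle f1 f2 f3 lt1 lt2) (h2 lt1 lt2).
- exact: near_cont (near_piecewise_right f1 f2 f3 lt1) (h3 lt1).
Qed.

Lemma is_derive_piecewise (f1 f2 f3 d1 d2 d3 : R -> R) (y : R) :
  (y <= z -> is_derive y 1 f1 (d1 y)) -> (z <= y -> y <= a -> is_derive y 1 f2 (d2 y)) ->
  (a <= y -> is_derive y 1 f3 (d3 y)) ->
  f1 z = f2 z -> d1 z = d2 z -> f2 a = f3 a -> d2 a = d3 a ->
  is_derive y 1 (piecewise f1 f2 f3) (piecewise d1 d2 d3 y).
Proof.
move=> h1 h2 h3 fz dz fa da.
have [yz|/eqP yz] := eqVneq y z.
  subst y; rewrite piecewise_left//.
  apply: (is_derive_glue (h1 (lexx _))) (near_piecewise_join1 _ _ _).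
  - by rewrite dz; apply: h2 => //; exact: ltW.
  - by rewrite piecewise_left.
  - by rewrite piecewise_left.
have [ya|/eqP ya] := eqVneq y a.
  subst y; rewrite piecewise_right//.
  apply: (is_derive_glue (f1 := f2) (f2 := f3)) (near_piecewise_join2 _ _ _).
  - by rewrite -da; apply: h2 => //; exact: ltW.
  - exact: h3.
  - by rewrite piecewise_right.
  - by rewrite piecewise_right.
apply: is_derive_piecewise_off => // [lt1|lt1 lt2|lt1].
- by apply: h1; exact: ltW.
- by apply: h2; exact: ltW.
- by apply: h3; exact: ltW.
Qed.

Lemma continuous_piecewise (f1 f2 f3 : R -> R) (y : R) :
  (y <= z -> {for y, continuous f1}) -> (z <= y -> y <= a -> {for y, continuous f2}) ->
  (a <= y -> {for y, continuous f3}) ->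
  f1 z = f2 z -> f2 a = f3 a -> {for y, continuous (piecewise f1 f2 f3)}.
Proof.
move=> h1 h2 h3 fz fa.
have [yz|/eqP yz] := eqVneq y z.
  subst y; apply: (continuous_glue (f1 := f1) (f2 := f2)) (near_piecewise_join1 _ _ _).
  - exact: h1.
  - by apply: h2 => //; exact: ltW.
  - by rewrite piecewise_left.
  - by rewrite piecewise_left.
have [ya|/eqP ya] := eqVneq y a.
  subst y; apply: (continuous_glue (f1 := f2) (f2 := f3)) (near_piecewise_join2 _ _ _).
  - by apply: h2 => //; exact: ltW.
  - exact: h3.
  - by rewrite piecewise_right.
  - by rewrite piecewise_right.
apply: continuous_piecewise_off => // [lt1|lt1 lt2|lt1].
- by apply: h1; exact: ltW.
- by apply: h2; exact: ltW.
- by apply: h3; exact: ltW.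
Qed.
End piecewise.

(** * Sufficiency *)

Lemma is_derive_scale {R : realType} (c : R) (f : R -> R) (x l : R) :
  is_derive x 1 f l -> is_derive x 1 (fun y => c * f y) (c * l).
Proof. by move=> d; exact: (is_deriveZ c). Qed.

Section verification.
Context {R : realType}.
Variables (b sigma r : R) (h : R -> R) (K1 K0 K : R).
Hypotheses (sigma0 : sigma != 0) (r0 : 0 < r) (K10 : 0 < K1) (K00 : 0 < K0) (Kneg : K < 0).
Hypothesis hincr : increasing_on_pos h.
Hypothesis hunb : forall M : R, exists2 z : R, 0 < z & M <= h z.
Hypothesis hlow : forall x : R, 0 < x -> - (r * K) <= h x.
Local Notation m := (root_m b sigma r).
Local Notation n := (root_n b sigma r).
Local Notation p := (- m).
Local Notation v := (sigma ^+ 2).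
Local Notation S := (v * (n - m)).
Local Notation g := (fun s => h s - r * K1).
Local Notation kap := (- (r * K)).
Local Notation mu := (@lebesgue_measure R).
Hypothesis iJ : forall x : R, 0 < x -> mu.-integrable `]x, +oo[ (fun s => (s `^ (- n - 1) * h s)%:E).
Local Notation w1 := (cand1 b sigma r h).

Let p0 : 0 < p. Proof. by rewrite oppr_gt0; exact: root_m_lt0. Qed.
Let n0 : 0 < n. Proof. exact: root_n_gt0. Qed.
Let S0 : 0 < S. Proof. exact: root_scale_gt0. Qed.
Let Si0 : 0 < S^-1. Proof. by rewrite invr_gt0. Qed.
Let iI : forall x : R, 0 < x -> mu.-integrable `]0, x[ (fun s => (s `^ (p - 1) * h s)%:E).
Proof. by move=> x x0; exact: (integrable_at_zero p0 hincr hlow x0). Qed.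
Let k0 : 0 < kap. Proof. by rewrite oppr_gt0 pmulr_rlt0. Qed.
Let gincr : increasing_on_pos g. Proof. exact: increasing_shift. Qed.
Let iIg (x : R) : 0 < x -> mu.-integrable `]0, x[ (fun s => (s `^ (p - 1) * g s)%:E).
Proof. exact: (integrable_shift_lower p0 iI). Qed.
Let iJg (x : R) : 0 < x -> mu.-integrable `]x, +oo[ (fun s => (s `^ (- n - 1) * g s)%:E).
Proof. exact: (integrable_shift_upper n0 iJ). Qed.
Let gunb (M : R) : exists2 z : R, 0 < z & M <= g z.
Proof. by have [z z0 hz] := hunb (M + r * K1); exists z => //; rewrite lerBrDr. Qed.
Let char_p : v * p * (p + 1) - b * p - r = 0.
Proof. by rewrite -[RHS](root_m_char b sigma0 r0); ring. Qed.
Let char_n : v * n * (n - 1) + b * n - r = 0.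
Proof. exact: (root_n_char b sigma0 r0). Qed.

Let w1E (x : R) : w1 x = S^-1 * potential p n h x. Proof. exact: R_hE. Qed.

Let w1gE (x : R) : 0 < x -> w1 x - K1 = S^-1 * potential p n g x.
Proof.
move=> x0; rewrite w1E (potential_shift p0 n0 iI iJ _ x0) [RHS]mulrBr; congr (_ - _).
have E := root_scale_inv b sigma0 r0.
transitivity (r * K1 * (S^-1 * (p^-1 + n^-1))); last by ring.
by rewrite E mulrC mulrA mulVf ?mul1r// gt_eqF.
Qed.

Let is_derive_w1 (x : R) : 0 < x -> is_derive x 1 w1 (S^-1 * potential_d1 p n h x).
Proof.
move=> x0; have d := is_derive_potential p0 n0 hincr iI iJ x0.
rewrite (_ : w1 = fun y => S^-1 * potential p n h y); last by apply/funext => y; rewrite w1E.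
exact: is_derive_scale.
Qed.

Let is_derive_w1g (x : R) : 0 < x ->
  is_derive x 1 (fun y => w1 y - K1) (S^-1 * potential_d1 p n g x).
Proof.
move=> x0; have d := is_derive_potential p0 n0 gincr iIg iJg x0.
apply: near_eq_is_derive (is_derive_scale S^-1 d).
near=> y; rewrite w1gE//; near: y; exact: lt_nbhsr.
Unshelve. all: by end_near. Qed.

Let cts_scale (f : R -> R) (x : R) : {for x, continuous f} ->
  {for x, continuous (fun y => S^-1 * f y)}.
Proof. by move=> cf; apply: cvgM => //; exact: cvg_cst. Qed.

Let cts_w1' (x : R) : 0 < x -> {for x, continuous (fun y => S^-1 * potential_d1 p n h y)}.
Proof. by move=> x0; apply: cts_scale; exact: (continuous_potential_d1 p0 n0 hincr iI iJ). Qed.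

Let is_derive_w1' (x : R) : 0 < x -> {for x, continuous h} ->
  is_derive x 1 (fun y => S^-1 * potential_d1 p n h y) (S^-1 * potential_d2 p n h x).
Proof.
move=> x0 hx; have d := is_derive_potential_d1 hincr iI iJ x0 hx.
exact: is_derive_scale.
Qed.

Let cts_w1'' (x : R) : 0 < x -> {for x, continuous h} ->
  {for x, continuous (fun y => S^-1 * potential_d2 p n h y)}.
Proof. by move=> x0 hx; apply: cts_scale; exact: (continuous_potential_d2 p0 n0 hincr iI iJ). Qed.

Let w1_incr : increasing_on_pos w1.
Proof.
move=> x y x0 xy; rewrite !w1E ler_wpM2l ?(ltW Si0)//.
exact: (potential_incr p0 n0 hincr iI iJ hunb).
Qed.

Let kapE : S^-1 * (kap * (p^-1 + n^-1)) = - K.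
Proof.
have E := root_scale_inv b sigma0 r0.
transitivity (kap * (S^-1 * (p^-1 + n^-1))); first by ring.
by rewrite E mulNr mulrAC mulfV ?mul1r// gt_eqF.
Qed.

Let w1_ge (x : R) : 0 < x -> - K <= w1 x.
Proof.
move=> x0; rewrite w1E -kapE ler_wpM2l ?(ltW Si0)//.
exact: (potential_ge p0 n0 iI iJ).
Qed.

Variables z a : R.
Hypotheses (z0 : 0 < z) (za : z < a).
Hypothesis ea : lower_mean p g a = kap * (z / a) `^ p.
Hypothesis eb : upper_mean n g a = kap * (z / a) `^ (- n).
Local Notation w0 := (cand0 b sigma r h K1 K z a).
Local Notation D1 := (Delta1 b sigma r K z).
Local Notation D2 := (Delta2 b sigma r K z).

Let a0 : 0 < a. Proof. exact: lt_trans za. Qed.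

Let F2 (y : R) : R := D1 * y `^ m + D2 * y `^ n.

Let f2E (y : R) : F2 y = S^-1 * smooth_potential p n g a y.
Proof.
rewrite /F2 Delta1E// Delta2E// -(lower_integral_boundary p0 z0 za ea).
rewrite -(upper_integral_boundary n0 z0 za eb) /smooth_potential opprK; ring.
Qed.

Lemma Delta1_gt0 : 0 < D1.
Proof. by rewrite Delta1E// !pmulr_rgt0 ?invr_gt0// powR_gt0. Qed.

Lemma Delta2_gt0 : 0 < D2.
Proof. by rewrite Delta2E// !pmulr_rgt0 ?invr_gt0// powR_gt0. Qed.
Local Notation Ia := (lower_integral p g a).
Local Notation Ja := (upper_integral n g a).
Let d2 (y : R) := S^-1 * (- p * y `^ (- p - 1) * Ia + n * y `^ (n - 1) * Ja).
Let dd2 (y : R) := S^-1 *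
  (p * (p + 1) * y `^ (- p - 2) * Ia + n * (n - 1) * y `^ (n - 2) * Ja).
Let w0' := piecewise z a (cst 0) d2 (fun y => S^-1 * potential_d1 p n g y).
Let w0'' := piecewise z a (cst 0) dd2 (fun y => S^-1 * potential_d2 p n g y).

Let w0E : w0 = piecewise z a (cst (- K)) F2 (fun y => w1 y - K1).
Proof. by []. Qed.

Let F2z : F2 z = - K.
Proof.
rewrite f2E (smooth_potential_boundary p0 n0 z0 za ea eb)// divff ?gt_eqF// !powR1.
by rewrite -kapE (mulr1 p^-1) (mulr1 n^-1).
Qed.

Let F2a : F2 a = w1 a - K1.
Proof. by rewrite f2E w1gE. Qed.

Let d2z : d2 z = 0.
Proof.
rewrite /d2 (lower_integral_boundary p0 z0 za ea) (upper_integral_boundary n0 z0 za eb).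
have zp := powR_mulNr p z0; have zn := powR_mulNr n z0.
rewrite !powRB ?(gt_eqF z0) ?implybT// powRr1 ?(ltW z0)//.
have pp : p * p^-1 = 1 by rewrite mulfV// gt_eqF.
have nn : n * n^-1 = 1 by rewrite mulfV// gt_eqF.
transitivity (S^-1 * kap * z^-1 *
  (- (p * p^-1) * (z `^ (- p) * z `^ p) + (n * n^-1) * (z `^ (- n) * z `^ n))).
  by ring.
by rewrite zp zn pp nn; ring.
Qed.

Let is_derive_F2 (y : R) : 0 < y -> is_derive y 1 F2 (d2 y).
Proof.
move=> y0; have := is_derive_scale S^-1 (is_derive_smooth_potential p n g a y0).
rewrite (_ : (fun y => S^-1 * _) = F2) => [//|].
by apply/funext => t; rewrite f2E.
Qed.

Let is_derive_d2 (y : R) : 0 < y -> is_derive y 1 d2 (dd2 y).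
Proof.
move=> y0.
have d := is_derive_powR2 (- p - 1) (n - 1) (- p * Ia) (n * Ja) 0 y0.
have := is_derive_scale S^-1 d.
rewrite (_ : (fun y => S^-1 * _) = d2); last first.
  by apply/funext => t; rewrite /d2; congr (_ * _); ring.
move=> d'; apply: is_derive_eq; rewrite /dd2; congr (_ * _).
have -> : - p - 1 - 1 = - p - 2 by ring.
have -> : n - 1 - 1 = n - 2 by ring.
by ring.
Qed.

Let cts_d2 (y : R) : 0 < y -> {for y, continuous d2}.
Proof.
move=> y0; apply: differentiable_continuous; apply/derivable1_diffP.
by have [] := is_derive_d2 y0.
Qed.

Let cts_dd2 (y : R) : 0 < y -> {for y, continuous dd2}.
Proof.
move=> y0; apply: cts_scale; apply: cvgD; (apply: cvgM; last exact: cvg_cst);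
  by apply: cvgM; [exact: cvg_cst|exact: continuous_powR].
Qed.

Let is_derive_w0 (y : R) : 0 < y -> is_derive y 1 w0 (w0' y).
Proof.
move=> y0; rewrite w0E.
have c : y <= z -> is_derive y 1 (cst (- K) : R -> R) (cst 0 y) by move=> _; exact: is_derive_cst.
exact: (is_derive_piecewise za c (fun _ _ => is_derive_F2 y0) (fun _ => is_derive_w1g y0)
  (esym F2z) (esym d2z) F2a (erefl _)).
Qed.

Let cts_w0' (y : R) : 0 < y -> {for y, continuous w0'}.
Proof.
move=> y0; have c1 : y <= z -> {for y, continuous (cst 0 : R -> R)}.
  by move=> _; exact: cst_continuous.
have c3 : a <= y -> {for y, continuous (fun y => S^-1 * potential_d1 p n g y)}.
  by move=> _; apply: cts_scale; exact: (continuous_potential_d1 p0 n0 gincr iIg iJg).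
exact: (continuous_piecewise za c1 (fun _ _ => cts_d2 y0) c3 (esym d2z) (erefl _)).
Qed.

Local Notation F := ([set z; a] : set R).
Local Notation E := (F `|` [set x | ~ {for x, continuous h}]).

Let offE (x : R) : ~ E x -> [/\ x <> z, x <> a & {for x, continuous h}].
Proof.
by move=> Ex; split => [xz|xa|]; [apply: Ex; left; left|apply: Ex; left; right|
  apply: contrapT => hx; apply: Ex; right].
Qed.

Let cts_g (x : R) : {for x, continuous h} -> {for x, continuous g}.
Proof. by move=> hx; apply: cvgB => //; exact: cvg_cst. Qed.

Let is_derive_w0' (y : R) : 0 < y -> ~ E y -> is_derive y 1 w0' (w0'' y).
Proof.
move=> y0 /offE[yz ya hy].
have c1 : y < z -> is_derive y 1 (cst 0 : R -> R) (cst 0 y) by move=> _; exact: is_derive_cst.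
have c3 : a < y -> is_derive y 1 (fun y => S^-1 * potential_d1 p n g y)
    (S^-1 * potential_d2 p n g y).
  move=> _; apply: is_derive_scale.
  exact: (is_derive_potential_d1 gincr iIg iJg y0 (cts_g hy)).
exact: (is_derive_piecewise_off za yz ya c1 (fun _ _ => is_derive_d2 y0) c3).
Qed.

Let cts_w0'' (y : R) : 0 < y -> ~ E y -> {for y, continuous w0''}.
Proof.
move=> y0 /offE[yz ya hy].
have c1 : y < z -> {for y, continuous (cst 0 : R -> R)}.
  by move=> _; exact: cst_continuous.
have c3 : a < y -> {for y, continuous (fun y => S^-1 * potential_d2 p n g y)}.
  move=> _; apply: cts_scale.
  exact: (continuous_potential_d2 p0 n0 gincr iIg iJg y0 (cts_g hy)).
exact: (continuous_piecewise_off za yz ya c1 (fun _ _ => cts_dd2 y0) c3).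
Qed.

Let F2_incr (x y : R) : z <= x -> x <= y -> F2 x <= F2 y.
Proof.
move=> zx xy; rewrite !f2E ler_wpM2l ?(ltW Si0)//.
exact: (smooth_potential_boundary_incr p0 n0 k0 z0 za ea eb).
Qed.

Lemma cand0_incr : increasing_on_pos w0.
Proof.
move=> x y x0 xy; have y0 := lt_le_trans x0 xy; rewrite w0E.
have [xz|zx] := leP x z.
  rewrite piecewise_left// -F2z; have [yz|zy] := leP y z.
    by rewrite piecewise_left// F2z.
  have [ya|ay] := ltP y a.
    by rewrite piecewise_middle//; apply: F2_incr => //; exact: ltW.
  rewrite piecewise_right//; apply: (@le_trans _ _ (w1 a - K1)).
    by rewrite -F2a; apply: F2_incr => //; exact: ltW.
  by rewrite lerD2r; exact: w1_incr.
have [xa|ax] := ltP x a; last first.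
  by rewrite !piecewise_right// ?(le_trans ax)// lerD2r; exact: w1_incr.
rewrite piecewise_middle//; have [ya|ay] := ltP y a.
  by rewrite piecewise_middle ?(lt_le_trans zx)//; apply: F2_incr => //; exact: ltW.
rewrite piecewise_right//; apply: (@le_trans _ _ (w1 a - K1)).
  by rewrite -F2a; apply: F2_incr; exact: ltW.
by rewrite lerD2r; exact: w1_incr.
Qed.

Let w0_ge (x : R) : 0 < x -> - K <= w0 x.
Proof.
move=> x0; have [xz|/ltW zx] := leP x z; first by rewrite w0E piecewise_left.
have : w0 z <= w0 x by exact: cand0_incr.
by rewrite {1}w0E piecewise_left.
Qed.

(** Term by term: y^-p z^p <= 1 and h >= kap for the first power, monotonicity
    of the upper integrals for the second. *)
Let F2_le_w1 (y : R) : z < y -> y < a -> F2 y <= w1 y.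
Proof.
move=> zy ya; have y0 := lt_trans z0 zy.
rewrite f2E w1E ler_wpM2l ?(ltW Si0)// potentialE// /smooth_potential lerD//.
  rewrite (lower_integral_boundary p0 z0 za ea).
  have e1 : y `^ (- p) * z `^ p <= 1.
    rewrite -(powR_mulNr p y0) ler_wpM2l ?powR_ge0// le_powR_l ?(ltW p0) ?(ltW z0)//.
    exact: ltW.
  have e2 : kap <= lower_mean p h y.
    by apply: (lower_mean_ge p0 iI) => // s /andP[s0 _]; exact: hlow.
  apply: (@le_trans _ _ (p^-1 * kap)); last by rewrite ler_wpM2l ?invr_ge0 ?(ltW p0).
  rewrite (_ : y `^ (- p) * _ = p^-1 * kap * (y `^ (- p) * z `^ p)); last by ring.
  by rewrite ler_piMr// mulr_ge0 ?invr_ge0 ?(ltW p0) ?(ltW k0).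
rewrite /upper_mean (_ : n^-1 * _ = (n^-1 * n) * (y `^ n * upper_integral n h y)); last by ring.
rewrite mulVf ?gt_eqF// mul1r ler_wpM2l ?powR_ge0//.
rewrite (upper_integral_shift n0 iJ _ a0) (upper_integral_split iJ y0 (ltW ya)).
have B0 : 0 <= \int[mu]_(s in `]y, a]) (s `^ (- n - 1) * h s).
  apply: Rintegral_ge0 => s /=; rewrite in_itv/= => /andP[ys _].
  have s0 := lt_trans y0 ys.
  by rewrite mulr_ge0 ?powR_ge0// (le_trans (ltW k0))// hlow.
have C0 : 0 <= r * K1 * (n^-1 * a `^ (- n)).
  by rewrite !mulr_ge0 ?powR_ge0 ?invr_ge0 ?ltW.
move: C0 B0; move: (upper_integral n h a) (r * K1 * _) (\int[mu]_(_ in _) _).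
by move=> u c1 c2 hc1 hc2; rewrite lerBlDr -addrA addrCA lerDl addr_ge0.
Qed.

Let w0_le_w1 (x : R) : 0 < x -> w0 x - w1 x - K0 <= 0.
Proof.
move=> x0; suff H : w0 x <= w1 x.
  by rewrite subr_le0; apply: (@le_trans _ _ 0); [rewrite subr_le0|exact: ltW].
rewrite w0E; have [xz|zx] := leP x z.
  by rewrite piecewise_left//; exact: w1_ge.
have [xa|ax] := ltP x a.
  by rewrite piecewise_middle//; exact: F2_le_w1.
by rewrite piecewise_right// gerBl ltW.
Qed.

Let w1_obstacle (x : R) : 0 < x -> w1 x - K1 <= w0 x.
Proof.
move=> x0; rewrite w0E; have [xz|zx] := leP x z.
  rewrite piecewise_left// w1gE// /= -kapE ler_wpM2l ?(ltW Si0)//.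
  exact: (obstacle_left p0 n0 gincr iIg iJg gunb k0 z0 za ea eb).
have [xa|ax] := ltP x a; last by rewrite piecewise_right.
rewrite piecewise_middle// w1gE// f2E ler_wpM2l ?(ltW Si0)//.
by apply: (obstacle_middle p0 n0 gincr iIg iJg gunb k0 z0 za ea eb); exact: ltW.
Qed.

(** Each variational inequality amounts to three inequalities, one of which is
    an equality. *)
Let max3 (u1 u2 u3 : R) : u1 <= 0 -> u2 <= 0 -> u3 <= 0 ->
  u1 = 0 \/ u2 = 0 \/ u3 = 0 -> Num.max (Num.max u1 u2) u3 = 0.
Proof.
move=> h1 h2 h3 H; apply/eqP; rewrite eq_le !ge_max h1 h2 h3/= !le_max.
by case: H => [->|[->|->]]; rewrite lexx ?orbT.
Qed.

Let op_w1 (x : R) : 0 < x ->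
  v * x ^+ 2 * (S^-1 * potential_d2 p n h x) + b * x * (S^-1 * potential_d1 p n h x)
    - r * w1 x + h x = 0.
Proof.
move=> x0; have H := potential_ode h x0 char_p char_n.
rewrite w1E; apply: (mulfI (lt0r_neq0 S0)); rewrite mulr0 -[RHS]H.
have Sn := lt0r_neq0 S0.
transitivity (S * S^-1 * (v * x ^+ 2 * potential_d2 p n h x + b * x * potential_d1 p n h x
  - r * potential p n h x) + S * h x); first by ring.
by rewrite mulfV// mul1r; congr (_ + _ * _); ring.
Qed.

Let op_w0 (x : R) : 0 < x -> x <> z -> x <> a ->
  v * x ^+ 2 * w0'' x + b * x * w0' x - r * w0 x <= 0 /\
  (x < z \/ a < x \/ v * x ^+ 2 * w0'' x + b * x * w0' x - r * w0 x = 0).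
Proof.
move=> x0 xz xa; rewrite w0E /w0' /w0''.
case: (positionP z a x) => // [lt1|lt1 lt2|lt1].
- rewrite !piecewise_left ?(ltW lt1)//= !mulr0 addr0 sub0r mulrN opprK.
  by split; [rewrite pmulr_rle0// ltW|left].
- rewrite !piecewise_middle// f2E /smooth_potential /d2 /dd2.
  have H := powR_ode Ia Ja x0 char_p char_n.
  have -> : forall u1 u2 u3 u4 u5 : R, u1 * (S^-1 * u2) + u3 * (S^-1 * u4) - r * (S^-1 * u5) =
    S^-1 * (u1 * u2 + u3 * u4 - r * u5) by move=> *; ring.
  by rewrite H mulr0; split => //; right; right.
- rewrite !piecewise_right ?(ltW lt1)// w1gE//; split; last by right; left.
  have H := potential_ode g x0 char_p char_n.
  have -> : forall u1 u2 u3 u4 u5 : R, u1 * (S^-1 * u2) + u3 * (S^-1 * u4) - r * (S^-1 * u5) =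
    S^-1 * (u1 * u2 + u3 * u4 - r * u5) by move=> *; ring.
  rewrite pmulr_rle0//.
  have gx : 0 <= g x by apply: (obstacle_right_ge0 p0 gincr iIg k0 z0 za ea); exact: ltW.
  have vg : 0 <= v * (p + n) * g x.
    by rewrite mulr_ge0// mulr_ge0 ?sqr_ge0// addr_ge0// ltW.
  by move/eqP: H; rewrite addr_eq0 => /eqP ->; rewrite oppr_le0.
Qed.

Theorem candidates_solve_HJB :
  [/\ 0 < D1, 0 < D2, increasing_on_pos w1, increasing_on_pos w0
    & solves_HJB b sigma r h K1 K0 K w1 w0].
Proof.
split; [exact: Delta1_gt0|exact: Delta2_gt0|exact: w1_incr|exact: cand0_incr|].
split.
- exact: C1_on_posI is_derive_w1 cts_w1'.
- exact: C1_on_posI is_derive_w0 cts_w0'.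
exists F; first exact: finite_set2.
have dw1 (x : R) : 0 < x -> ~ E x ->
    is_derive x 1 (fun y => S^-1 * potential_d1 p n h y) (S^-1 * potential_d2 p n h x).
  by move=> x0 /offE[_ _ hx]; exact: is_derive_w1'.
split.
- apply: (C2_offI is_derive_w1 dw1) => x x0 /offE[_ _ hx]; exact: cts_w1''.
- exact: (C2_offI is_derive_w0 is_derive_w0' cts_w0'').
move=> x x0 Ex; have [xz xa hx] := offE Ex.
rewrite (derive2_explicit is_derive_w1 dw1 x0 Ex) (derive1_explicit is_derive_w1 x0).
rewrite (derive2_explicit is_derive_w0 is_derive_w0' x0 Ex) (derive1_explicit is_derive_w0 x0).
have ge1 := w1_ge x0; have ge0 := w0_ge x0; have ob := w1_obstacle x0.
split.
- apply: max3.
  + by rewrite op_w1.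
  + exact: w0_le_w1.
  + by rewrite lerBlDr add0r lerNl.
  + by left; rewrite op_w1.
- have [op1 op2] := op_w0 x0 xz xa; apply: max3 => //.
  + by rewrite lerBlDr add0r lerBlDl -lerBlDr.
  + by rewrite lerBlDr add0r lerNl.
  case: op2 => [lt1|[lt1|op2]]; last by left.
  + by right; right; rewrite w0E piecewise_left ?(ltW lt1)//= opprK subrr.
  + right; left; rewrite w0E piecewise_right ?(ltW lt1)//.
    by rewrite opprB addrCA subrr addr0 subrr.
Qed.
End verification.

(** * Discontinuities of monotone functions and divergent integrals *)

Section discontinuities.
Context {R : realType}.
Variable h : R -> R.
Hypothesis hincr : increasing_on_pos h.
Hypothesis hrc : forall x : R, 0 < x -> h y @[y --> x^'+] --> h x.

Let jump_at (x : R) (t : rat) := ratr t < h x /\ forall y, 0 < y -> y < x -> h y < ratr t.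

Let discontinuity_jump (x : R) : 0 < x -> ~ {for x, continuous h} -> exists t, jump_at x t.
Proof.
move=> x0; apply: contra_notP => nojump.
apply/cvgrPdist_le => e e0.
have [y0 [y00 y0x hy0]] : exists y0, [/\ 0 < y0, y0 < x & h x - e <= h y0].
  apply: contrapT => H; apply: nojump.
  have ex : h x - e < h x by rewrite ltrBlDr ltrDl.
  have [t] := rat_in_itvoo ex; rewrite in_itv/= => /andP[t1 t2]; exists t; split => // y y0 yx.
  apply: lt_trans t1; rewrite ltNge; apply/negP => hy; apply: H; exists y; split => //.
have /cvgrPdist_le/(_ _ e0) Hr := hrc x0.
near x^'+ => y1.
have xy1 : x < y1 by near: y1; exact: nbhs_right_gt.
have hy1 : h y1 <= h x + e.
  have : `|h x - h y1| <= e by near: y1.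
  by rewrite ler_norml => /andP[+ _]; lra.
near=> y.
have yy0 : y0 <= y by apply: ltW; near: y; exact: lt_nbhsr.
have yy1 : y <= y1 by apply: ltW; near: y; exact: lt_nbhsl.
have h1 := hincr y00 yy0; have h2 := hincr (lt_le_trans y00 yy0) yy1.
by rewrite ler_norml; apply/andP; split; lra.
Unshelve. all: by end_near. Qed.

(** To each discontinuity, pick a rational in the jump; the jumps are disjoint. *)
Lemma countable_discontinuities : countable [set x : R | 0 < x /\ ~ {for x, continuous h}].
Proof.
apply/countable_injP.
pose f x := xget 0%Q [set t | jump_at x t].
have fP x : 0 < x -> ~ {for x, continuous h} -> jump_at x (f x).
  move=> x0 /(discontinuity_jump x0)[t jt].
  exact: (xgetI 0%Q (jt : [set t | jump_at x t] t)).
exists (fun x => pickle (f x)) => x y; rewrite !inE/= => -[x0 dx] [y0 dy].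
move=> /(pcan_inj pickleK) fxy.
have [jx1 jx2] := fP _ x0 dx; have [jy1 jy2] := fP _ y0 dy.
have [xy|yx|//] := ltgtP x y.
  by have := jy2 _ x0 xy; rewrite -fxy => /(lt_trans jx1); rewrite ltxx.
by have := jx2 _ y0 yx; rewrite fxy => /(lt_trans jy1); rewrite ltxx.
Qed.

(** A countable set cannot fill an interval of positive length. *)
Lemma continuity_point (F : set R) (x1 : R) : finite_set F -> 0 < x1 ->
  exists x, [/\ 0 < x, x < x1 & ~ (F `|` [set x | ~ {for x, continuous h}]) x].
Proof.
move=> finF x10; apply: contrapT => H.
have sub : `]0, x1[%classic `<=` F `|` [set x : R | 0 < x /\ ~ {for x, continuous h}].
  move=> x /=; rewrite in_itv/= => /andP[x0 xx1]; apply: contrapT => nx.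
  apply: H; exists x; split => // -[Fx|dx]; apply: nx; [by left|by right].
have cE : countable (F `|` [set x : R | 0 < x /\ ~ {for x, continuous h}]).
  rewrite -bigcup2E; apply: bigcup_countable => // -[|[|k]] _ /=.
  - exact: finite_set_countable.
  - exact: countable_discontinuities.
  - exact: countable0.
have c0 : countable (`]0, x1[%classic : set R).
  by apply: sub_countable cE; exact: subset_card_le.
have := countable_lebesgue_measure0 c0.
rewrite lebesgue_measure_itv/= lte_fin x10 oppr0 adde0 => -[] x1z.
by move: x10; rewrite x1z ltxx.
Qed.
End discontinuities.

Section integral_upper_bound.
Context {R : realType}.
Local Notation mu := (@lebesgue_measure R).

(** When the integral diverges it does so to -oo, and then its real value is by
    convention 0, which the bound allows since [c] is nonnegative. *)
Lemma lower_integral_le_unconditional (p x c : R) (h : R -> R) :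
  0 < p -> increasing_on_pos h -> 0 < x -> 0 <= c ->
  (forall s, 0 < s < x -> h s <= c) ->
  lower_integral p h x <= c * (p^-1 * x `^ p).
Proof.
move=> p0 hincr x0 c0 hc.
have D0 : `]0, x[%classic `<=` (`]0, +oo[%classic : set R).
  by move=> s /=; rewrite !in_itv/= andbT => /andP[].
have mD : measurable (`]0, x[%classic : set R) by exact: measurable_itv.
have mf : measurable_fun (`]0, x[%classic : set R) (fun s => s `^ (p - 1) * h s).
  exact: measurable_powR_increasing.
pose f (s : R) := (s `^ (p - 1) * h s)%:E.
have mEf : measurable_fun (`]0, x[%classic : set R) f by exact/measurable_EFinP.
have mp : measurable_fun (`]0, x[%classic : set R) (fun s : R => s `^ (p - 1)).
  by apply: measurable_funTS; exact: measurable_powR.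
have mEp : measurable_fun (`]0, x[%classic : set R) (fun s : R => (s `^ (p - 1))%:E).
  exact/measurable_EFinP.
have A : (\int[mu]_(s in `]0%R, x[) (f^\+ s) <= (c * (p^-1 * x `^ p))%:E)%E.
  have pos (s : R) : `]0, x[%classic s -> (0 <= (s `^ (p - 1))%:E)%E.
    by move=> _; rewrite lee_fin powR_ge0.
  rewrite EFinM -integral_powR_zero// -ge0_integralZl//.
  apply: ge0_le_integral => //.
  - exact: measurable_funepos.
  - by apply/measurable_EFinP; apply: measurable_funM.
  - move=> s /=; rewrite in_itv/= => sx.
    rewrite funeposE /maxe; case: ifP => _; rewrite -EFinM lee_fin.
      by rewrite mulr_ge0// powR_ge0.
    by rewrite mulrC ler_wpM2r ?powR_ge0 ?hc.
have A0 : (0 <= \int[mu]_(s in `]0%R, x[) (f^\+ s))%E by apply: integral_ge0.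
have B0 : (0 <= \int[mu]_(s in `]0%R, x[) (f^\- s))%E by apply: integral_ge0.
rewrite /lower_integral /Rintegral -/f integralE.
move: A A0 B0; move: (\int[mu]_(s in _) (f^\+ s))%E (\int[mu]_(s in _) (f^\- s))%E.
have cp : 0 <= c * (p^-1 * x `^ p) by rewrite !mulr_ge0 ?powR_ge0// invr_ge0 ltW.
move=> [u| |] [w| |] //=; rewrite !lee_fin => A A0 B0 //; lra.
Qed.
End integral_upper_bound.

(** * Necessity and the equivalence *)

Section necessity.
Context {R : realType}.
Variables (b sigma r : R) (h : R -> R) (K1 K0 K : R).
Hypotheses (sigma0 : sigma != 0) (r0 : 0 < r).
Hypothesis hincr : increasing_on_pos h.
Hypothesis hrc : forall x : R, 0 < x -> h y @[y --> x^'+] --> h x.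
Hypothesis hunb : forall M : R, exists2 z : R, 0 < z & M <= h z.
Local Notation m := (root_m b sigma r).
Local Notation n := (root_n b sigma r).
Local Notation p := (- m).
Local Notation v := (sigma ^+ 2).
Local Notation S := (v * (n - m)).
Local Notation g := (fun s => h s - r * K1).
Local Notation kap := (- (r * K)).
Local Notation mu := (@lebesgue_measure R).
Hypothesis iJ : forall x : R, 0 < x -> mu.-integrable `]x, +oo[ (fun s => (s `^ (- n - 1) * h s)%:E).

Let p0 : 0 < p. Proof. by rewrite oppr_gt0; exact: root_m_lt0. Qed.
Let n0 : 0 < n. Proof. exact: root_n_gt0. Qed.
Let S0 : 0 < S. Proof. exact: root_scale_gt0. Qed.
Let Si0 : 0 < S^-1. Proof. by rewrite invr_gt0. Qed.

Lemma Delta1_gt0_neg (z : R) : 0 < z -> 0 < Delta1 b sigma r K z -> K < 0.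
Proof.
move=> z0; rewrite Delta1E// pmulr_rgt0// pmulr_lgt0; last first.
  by rewrite mulr_gt0 ?invr_gt0// powR_gt0.
by rewrite oppr_gt0 pmulr_rlt0.
Qed.

(** If h(e) < kap for some e, both means of [h] are below [kap] near 0, so that
    w1 < - K there.  The inequality w1 >= - K is only available outside the
    exceptional set, which misses some points of every interval.  The lower
    integral may diverge, since nothing is known yet about [h] near 0. *)
Lemma HJB_low (w0 : R -> R) : K < 0 ->
  solves_HJB b sigma r h K1 K0 K (cand1 b sigma r h) w0 ->
  forall x : R, 0 < x -> kap <= h x.
Proof.
move=> Kneg [_ _ [F finF [_ _ HJB]]] e e0; rewrite leNgt; apply/negP => he.
have k0 : 0 < kap by rewrite oppr_gt0 pmulr_rlt0.
have hs s : 0 < s <= e -> h s <= h e by move=> /andP[s0 se]; exact: hincr.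
have [x1 /andP[x10 x1e] bx1] := upper_mean_small n0 hincr iJ e0 he hs.
have [x [x0 xx1 Ex]] := continuity_point hincr hrc finF x10.
have [H1 _] := HJB _ x0 Ex.
have : - cand1 b sigma r h x - K <= 0 by rewrite -H1 le_max lexx orbT.
apply/negP; rewrite -ltNge subr_gt0 ltrNr.
rewrite /cand1 R_hE.
have E := root_scale_inv b sigma0 r0.
have -> : - K = S^-1 * (kap * (p^-1 + n^-1)).
  transitivity (kap * (S^-1 * (p^-1 + n^-1))); last by ring.
  by rewrite E mulNr mulrAC mulfV ?mul1r// gt_eqF.
rewrite ltr_pM2l// potentialE// mulrDr ler_ltD//.
  have pc : 0 <= Num.max (h e) 0 by rewrite le_max lexx orbT.
  have := lower_integral_le_unconditional p0 hincr x0 pc (x := x).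
  have hse s : 0 < s < x -> h s <= Num.max (h e) 0.
    move=> /andP[s0 sx]; rewrite le_max hincr//.
    by apply/ltW/(lt_le_trans sx); exact: le_trans (ltW xx1) x1e.
  move=> /(_ hse) h1.
  rewrite mulrC ler_wpM2r ?invr_ge0 ?(ltW p0)// /lower_mean.
  apply: (@le_trans _ _ (Num.max (h e) 0)); last by rewrite ge_max !ltW.
  have pos : 0 <= p * x `^ (- p) by rewrite mulr_ge0 ?powR_ge0// ltW.
  apply: le_trans (ler_wpM2l pos h1) _.
  rewrite (_ : _ * _ = Num.max (h e) 0 * (p * p^-1) * (x `^ (- p) * x `^ p)); last by ring.
  by rewrite mulfV ?gt_eqF// (powR_mulNr p x0) !mulr1.
rewrite mulrC ltr_pM2r ?invr_gt0//; apply: lt_trans bx1.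
exact: (upper_mean_incr n0 hincr iJ hunb x0 xx1).
Qed.

(** Otherwise h - r K1 >= kap everywhere, so its lower mean is at least [kap],
    whereas the first equation puts it below [kap] as zeta < alpha. *)
Lemma free_boundary_value_at_zero (z a : R) : 0 < z < a -> K < 0 ->
  (forall x : R, 0 < x -> kap <= h x) ->
  free_boundary_system b sigma r h K1 K z a -> exists2 x : R, 0 < x & h x < r * K1 - r * K.
Proof.
move=> /andP[z0 za] Kneg hlow; have a0 := lt_trans z0 za.
have k0 : 0 < kap by rewrite oppr_gt0 pmulr_rlt0.
move=> /(free_boundary_systemE b sigma r h K1 K z0 a0)[ea _].
apply/not_exists2P => H.
have iI (x : R) : 0 < x -> mu.-integrable `]0, x[ (fun s => (s `^ (p - 1) * h s)%:E).
  by move=> x0; exact: (integrable_at_zero p0 hincr hlow x0).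
have : kap <= lower_mean p g a.
  have iIg := integrable_shift_lower p0 iI (r * K1).
  apply: (lower_mean_ge p0 iIg a0) => s /andP[s0 _].
  rewrite lerBrDl leNgt; apply/negP => hx.
  by have [] := H s.
rewrite ea leNgt => /negP; apply.
rewrite -[ltRHS]mulr1 ltr_pM2l//; apply: powR_lt1 => //.
  by apply: divr_ge0; exact: ltW.
by rewrite ltr_pdivrMr// mul1r.
Qed.
End necessity.

Theorem lemma3 (R : realType) (d : measure_display) (T : measurableType d)
  (P : probability T R) (W : R -> {RV P >-> R})
  (b sigma r K1 K0 K : R) (h : R -> R)
  (hW : brownian_motion W)
  (hsigma : sigma != 0) (hr : 0 < r) (hK1 : 0 < K1) (hK0 : 0 < K0)
  (hrc : forall x : R, 0 < x -> h y @[y --> x^'+] --> h x)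
  (hincr : increasing_on_pos h)
  (hinfty : h x @[x --> +oo] --> +oo)
  (hint : forall (x : R) (X : R -> {RV P >-> R}),
     0 < x -> gbm_solution W b sigma x X ->
     (\int[P]_w \int[lebesgue_measure]_(t in `[0%R, +oo[)
        (expR (- (r * t)) * `|h (X t w)|)%:E < +oo)%E) :
  (exists zeta alpha : R,
     [/\ 0 < zeta < alpha,
         free_boundary_system b sigma r h K1 K zeta alpha
       & forall zeta' alpha' : R, 0 < zeta' < alpha' ->
           free_boundary_system b sigma r h K1 K zeta' alpha' ->
           zeta' = zeta /\ alpha' = alpha] /\
     [/\ 0 < Delta1 b sigma r K zeta,
         0 < Delta2 b sigma r K zeta,
         increasing_on_pos (cand1 b sigma r h),
         increasing_on_pos (cand0 b sigma r h K1 K zeta alpha)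
       & solves_HJB b sigma r h K1 K0 K
           (cand1 b sigma r h) (cand0 b sigma r h K1 K zeta alpha)]) <->
  (K < 0 /\
   ((- (r * K))%:E <= value_at_zero h)%E /\
   (value_at_zero h < (r * K1 - r * K)%:E)%E).
Proof.
have hunb (M : R) : exists2 z : R, 0 < z & M <= h z.
  have /cvgryPge/(_ M) [A [_ HA]] := hinfty.
  exists (Num.max A 0 + 1); first by rewrite ltr_wpDl// le_max lexx orbT.
  by apply: HA; rewrite /= ltr_pwDr// le_max lexx.
have hint1 := hint 1 (gbm W b sigma 1) ltr01 (gbm_solves b hW hsigma ltr01).
have iJ (x : R) : 0 < x ->
    (@lebesgue_measure R).-integrable `]x, +oo[
      (fun s => (s `^ (- root_n b sigma r - 1) * h s)%:E).
  exact: (integrable_at_infinity hW hsigma hr hincr hinfty hint1).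
have p0 : 0 < - root_m b sigma r by rewrite oppr_gt0; exact: root_m_lt0.
have n0 : 0 < root_n b sigma r by exact: root_n_gt0.
split=> [[z [a [[za sys _] [D1 D2 _ _ HJB]]]]|[Kneg [/(value_at_zero_ge hincr) hlow]]].
  have /andP[z0 _] := za.
  have Kneg := Delta1_gt0_neg hsigma hr z0 D1.
  have hlow := HJB_low hsigma hr hincr hrc hunb iJ Kneg HJB.
  split => //; split; first exact/(value_at_zero_ge hincr).
  apply/(value_at_zero_lt hincr).
  exact: (free_boundary_value_at_zero hsigma hr hincr za Kneg hlow sys).
move=> /(value_at_zero_lt hincr)[x0 x00 hx0].
have k0 : 0 < - (r * K) by rewrite oppr_gt0 pmulr_rlt0.
have iI (x : R) : 0 < x -> (@lebesgue_measure R).-integrable `]0, x[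
    (fun s => (s `^ (- root_m b sigma r - 1) * h s)%:E).
  by move=> xp; exact: (integrable_at_zero p0 hincr hlow xp).
have gincr : increasing_on_pos (fun s => h s - r * K1) by exact: increasing_shift.
have iIg := integrable_shift_lower p0 iI (r * K1).
have iJg := integrable_shift_upper n0 iJ (r * K1).
have gunb (M : R) : exists2 z : R, 0 < z & M <= h z - r * K1.
  by have [z z0 hz] := hunb (M + r * K1); exists z => //; rewrite lerBrDr.
have eta : h x0 - r * K1 < - (r * K) by rewrite ltrBlDl.
have geta (s : R) : 0 < s <= x0 -> h s - r * K1 <= h x0 - r * K1.
  by move=> /andP[s0 sx]; apply: gincr.
have [z [a [za ea eb]]] := free_boundary_exists p0 n0 gincr iIg iJg gunb k0 x00 eta geta.
have /andP[z0 za'] := za; have a0 := lt_trans z0 za'.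
exists z, a; split; last first.
  exact: (candidates_solve_HJB hsigma hr hK1 hK0 Kneg hincr hunb hlow iJ z0 za' ea eb).
split => //; first exact/(free_boundary_systemE b sigma r h K1 K z0 a0).
move=> z' a' zaN sysN; have /andP[zN0 zaN'] := zaN; have aN0 := lt_trans zN0 zaN'.
have [eaN ebN] := (free_boundary_systemE b sigma r h K1 K zN0 aN0).1 sysN.
exact: (free_boundary_unique p0 n0 gincr iIg iJg gunb k0 za zaN ea eb eaN ebN).
Qed.
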